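(* Let $H_1,H_2\in(0,1)$, $\beta\in\mathbb{R}$ and $\mu\in\mathbb{R}\setminus\{0\}$. For $\varepsilon>0$ and $T>0$ let $P_T\big(\beta,\tfrac{\mu}{\sqrt\varepsilon}\big)$ be the minimal mean squared filtering error defined in the context. Then, for every $\varepsilon>0$, the large time limit $$P_\infty\Big(\beta,\frac{\mu}{\sqrt\varepsilon}\Big)=\lim_{T\to\infty}P_T\Big(\beta,\frac{\mu}{\sqrt\varepsilon}\Big)$$ exists, and for any $T>0$ the filtering error satisfies the scaling property $$\lim_{\varepsilon\to0}\varepsilon^{-\nu}P_T\Big(\beta,\frac{\mu}{\sqrt\varepsilon}\Big)=P_\infty(0,\mu),\qquad \nu=\frac{H_1}{1+H_1-H_2}.$$
   Context: A fractional Brownian motion (fBm) with Hurst exponent $H\in(0,1)$ is a centred Gaussian process on $\mathbb{R}_+$ with continuous paths and covariance function $K(s,t)=\frac12\big(s^{2H}+t^{2H}-|s-t|^{2H}\big)$. Let $W$ and $V$ be independent fBm's with Hurst exponents $H_1$ and $H_2$, respectively. The state process $X$ and the observation process $Y$ are given by $$X_t=\beta\int_0^tX_s\,ds+W_t,\qquad Y_t=\mu\int_0^tX_s\,ds+\sqrt{\varepsilon}\,V_t,\qquad t\ge0.$$ With $\mathcal{F}^Y_T=\sigma\{Y_s,\ s\le T\}$, the filtering error is $P_T\big(\beta,\tfrac{\mu}{\sqrt\varepsilon}\big):=\mathbb{E}\big(X_T-\mathbb{E}(X_T|\mathcal{F}^Y_T)\big)^2$ (for given $H_1,H_2$ it depends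 on $\mu,\varepsilon$ only through $\mu/\sqrt\varepsilon$). Thus $P_\infty(0,\mu)$ is the large time limit for $\beta=0$, $\varepsilon=1$. *)

(* Defs.v *)
From HB Require Import structures.
From mathcomp Require Import all_boot all_order all_algebra.
From mathcomp Require Import all_classical all_reals all_analysis.
Import Order.TTheory GRing.Theory Num.Theory.
Import numFieldNormedType.Exports.

Set Implicit Arguments.
Unset Strict Implicit.
Unset Printing Implicit Defensive.

Local Open Scope classical_set_scope.
Local Open Scope ring_scope.

(* Processes on R_+ are families of random variables indexed by the whole of R;
   only the values at times t >= 0 are ever constrained or used. *)

Section Processes.
Context (R : realType) (d : measure_display) (Omega : measurableType d).
Variable P : probability Omega R.

(* [normal_prob m s] has standard deviation s and is the normal law only when
   s != 0; hence the separate degenerate case, a point mass at m. *)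
Definition gaussian (Z : Omega -> R) : Prop :=
  exists m s : R, 0 <= s /\ forall B : set R, measurable B ->
    P (Z @^-1` B) = if s == 0 then \d_m B else normal_prob m s B.

(* All finite-dimensional distributions are multivariate normal, i.e. all
   finite linear combinations are (possibly degenerate) normal. *)
Definition gaussian_process (W : R -> {RV P >-> R}) : Prop :=
  forall (n : nat) (t a : 'I_n -> R), (forall i, 0 <= t i) ->
    gaussian (fun w => \sum_(i < n) a i * W (t i) w).

Definition fBm_cov (H s t : R) : R :=
  2^-1 * (s `^ (2 * H) + t `^ (2 * H) - `|s - t| `^ (2 * H)).

Definition fBm (H : R) (W : R -> {RV P >-> R}) : Prop :=
  [/\ gaussian_process W,
      forall t, 0 <= t -> 'E_P[W t]%E = 0%E,
      forall s t, 0 <= s -> 0 <= t -> covariance P (W s) (W t) = (fBm_cov H s t)%:E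
    & forall w, {within `[0, +oo[, continuous (fun t => W t w)}].

(* The sigma-algebra generated by (Y s), s in I. *)
Definition sigma_process (I : set R) (Y : R -> {RV P >-> R}) : set (set Omega) :=
  <<s \bigcup_(s in I) preimage_set_system setT (Y s) measurable >>.

Definition independent_processes (W V : R -> {RV P >-> R}) : Prop :=
  forall A B, sigma_process `[0, +oo[ W A -> sigma_process `[0, +oo[ V B ->
    P (A `&` B) = (P A * P B)%E.

(* Z is a version of the conditional expectation of X given the
   sub-sigma-algebra G. *)
Definition is_cond_exp (G : set (set Omega)) (X Z : Omega -> R) : Prop :=
  [/\ preimage_set_system setT Z measurable `<=` G,
      P.-integrable setT (EFin \o Z)
    & forall A, G A ->
        (\int[P]_(w in A) (Z w)%:E = \int[P]_(w in A) (X w)%:E)%E].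

(* A chosen version: any two versions are equal almost surely. *)
Definition cond_exp (G : set (set Omega)) (X : Omega -> R) : Omega -> R :=
  xget (cst 0) (is_cond_exp G X).

Definition state_equation (beta : R) (W X : R -> {RV P >-> R}) : Prop :=
  forall t w, 0 <= t ->
    lebesgue_measure.-integrable `[0, t] (fun s => (X s w)%:E) /\
    X t w = beta * (\int[lebesgue_measure]_(s in `[0, t]) X s w) + W t w.

Definition observation_equation (mu eps : R) (X V Y : R -> {RV P >-> R}) : Prop :=
  forall t w, 0 <= t ->
    Y t w = mu * (\int[lebesgue_measure]_(s in `[0, t]) X s w)
            + Num.sqrt eps * V t w.

Definition filtering_error (X Y : R -> {RV P >-> R}) (T : R) : R :=
  fine ('E_P[fun w => ((X T w - cond_exp (sigma_process `[0, T] Y) (X T) w) ^+ 2)%R])%E.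

End Processes.

(* Main.v *)
Require Import Defs.
From HB Require Import structures.
From mathcomp Require Import all_boot all_order all_algebra.
From mathcomp Require Import all_classical all_reals all_analysis measurable_realfun.
From mathcomp Require Import ring lra.
Import Order.TTheory GRing.Theory Num.Theory.
Import numFieldNormedType.Exports.

Set Implicit Arguments.
Unset Strict Implicit.
Unset Printing Implicit Defensive.

Local Open Scope classical_set_scope.
Local Open Scope ring_scope.

(** Eliminating the state gives [X_T - (b / mu) Y_T = W_T - (b / mu) sqrt eps V_T],
    and [Y_t - b int_0^t Y] is a linear functional of [W] and [V] alone that
    generates the same sigma-algebras as [Y]. In a Gaussian space the conditional
    expectation is the orthogonal projection, so the filtering error is the
    infimum of a quadratic functional over finite lists of weighted times.
    Writing the covariances as spectral integrals with weights [x ^ (1 - 2 H_i)],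
    the kernels [phi], [p] of the [W]- and [V]-parts of the error satisfy
    [(i x - b) phi + mu p = e^(i x T) - lam] for a constant [lam].

    Homogeneity of the weights turns small noise on a fixed horizon into unit
    noise on a long one with a vanishing drift:
    [eps^(-nu) F_eps(b, T) = F_1(b / c, c T)], [c = eps^(-1 / (2 (1 + H1 - H2)))].
    When [lam = 0] a time shift multiplies the kernels by [e^(i x s)] and the
    cost does not depend on the horizon. A list with [lam <> 0] can be repaired
    by a fixed kernel, asymptotically orthogonal to shifted ones by the
    Riemann-Lebesgue lemma; hence [F_1(b, T)] tends to the infimum over [lam = 0].
    The drift enters only through [|b phi|^2 = b^2 / (x^2 + b^2) |e^(i x T) - lam - mu p|^2],
    whose first factor tends to zero, so the limit may be taken along [b -> 0]. *)

(** * Real-valued integrals and derivatives *)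

(** The conditional expectation is characterised by integrals over the sets of a sigma-algebra, not
    by orthogonality to a linear space. The bridge is Stein's formula, which computes the projection
    of every trigonometric polynomial, together with the density of these polynomials among the
    bounded measurable variables.

    The main obstacle is that the cost measures the state kernel with the exponent [H1] and the
    noise kernel with [H2], while a change of drift adds a multiple of the state kernel to the noise
    kernel. A bound on the cost thus gives no bound on this perturbation in the norm where it is
    needed. The kernel identity does: divided by [i x - b], it controls the state kernel pointwise
    by the noise kernel and the constant [lam], whatever the weight. That constant is in turn
    bounded by looking at frequencies in [[1, 2]] only, where all weights are comparable.

    No minimiser is ever taken, so optimality conditions appear as quadratic inequalities for
    near-minimisers. Their slack is [e ^ 2] for a step [e], which leaves an error of order [e] after
    division by the step. *)

Section RealIntegral.
Context d (T : measurableType d) (R : realType).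
Variables (mu : {measure set T -> \bar R}) (D : set T) (mD : measurable D).
Implicit Types f g : T -> R.

Local Notation intg f := (mu.-integrable D (EFin \o f)).
Local Notation E f := (Rintegral mu D f).

Lemma intg_meas f : intg f -> measurable_fun D f.
Proof. by move=> /measurable_int/measurable_EFinP. Qed.

Lemma intgD f g : intg f -> intg g -> intg (fun x => f x + g x).
Proof. by move=> hf hg; apply: eq_integrable (integrableD mD hf hg). Qed.

Lemma intgB f g : intg f -> intg g -> intg (fun x => f x - g x).
Proof. by move=> hf hg; apply: eq_integrable (integrableB mD hf hg). Qed.

Lemma intgZ k f : intg f -> intg (fun x => k * f x).
Proof. by move=> hf; apply: eq_integrable (integrableZl mD k hf). Qed.

Lemma intg_sum n (F : 'I_n -> T -> R) :
  (forall i, intg (F i)) -> intg (fun x => \sum_(i < n) F i x).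
Proof.
move=> hF; have := @integrable_sum _ _ _ mu D mD _ (index_enum (ordinal n)) xpredT (fun i x => (F i x)%:E) (fun i _ => hF i).
by apply: eq_integrable => // x _; rewrite /= sumEFin.
Qed.

Lemma intg_le f g : measurable_fun D f -> (forall x, D x -> `|f x| <= g x) ->
  intg g -> intg f.
Proof.
move=> mf fg hg; apply: (le_integrable mD _ _ hg); first exact/measurable_EFinP.
by move=> x Dx; rewrite /= lee_fin (le_trans (fg x Dx))// ler_norm.
Qed.

Lemma intg_norm f : intg f -> intg (fun x => `|f x|).
Proof. by move=> h; apply: eq_integrable (integrable_norm h). Qed.

Lemma Rintegral_sum n (F : 'I_n -> T -> R) : (forall i, intg (F i)) ->
  E (fun x => \sum_(i < n) F i x) = \sum_(i < n) E (F i).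
Proof.
elim: n F => [|n IHn] F hF.
  rewrite big_ord0 -[RHS](mul0r (fine (mu D))) -Rintegral_cst//.
  by apply: eq_Rintegral => x _; rewrite big_ord0.
rewrite big_ord_recr/= -IHn// -RintegralD//; last exact: intg_sum.
by apply: eq_Rintegral => x _; rewrite big_ord_recr.
Qed.

Lemma dominated_intg (F : nat -> T -> R) f g :
  (forall n, measurable_fun D (F n)) -> intg g ->
  (forall x, D x -> F ^~ x @ \oo --> f x) ->
  (forall n x, D x -> `|F n x| <= g x) -> intg f.
Proof.
move=> mF ig Ff Fg.
have mf : measurable_fun D f by apply: measurable_fun_cvg Ff.
apply: intg_le ig => // x Dx.
have h : `|F n x| @[n --> \oo] --> `|f x| by apply: cvg_norm; exact: Ff.
rewrite -(cvg_lim _ h)//; apply: limr_le; first by apply/cvg_ex; eexists; exact: h.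
by apply: nearW => n; exact: Fg.
Qed.

Lemma dominated_Rintegral (F : nat -> T -> R) f g :
  (forall n, measurable_fun D (F n)) -> intg g ->
  (forall x, D x -> F ^~ x @ \oo --> f x) ->
  (forall n x, D x -> `|F n x| <= g x) ->
  E (F n) @[n --> \oo] --> E f.
Proof.
move=> mF ig Ff Fg.
have hf : intg f by apply: dominated_intg Ff Fg.
have := @dominated_cvg _ _ _ mu D mD (fun n x => (F n x)%:E) (fun x => (f x)%:E) (fun x => (g x)%:E).
have -> : (\int[mu]_(x in D) (f x)%:E)%E = (E f)%:E.
  by rewrite fineK//; exact: integrable_fin_num.
move=> h; apply: fine_cvg; apply: h => //.
- by move=> n; apply/measurable_EFinP.
- by move=> x Dx; apply: cvg_EFin; [exact: nearW|exact: Ff].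
Qed.

(** Integrability of the limit is part of the conclusion: this is how second moments and the
    spectral weight are shown to be finite, from approximants with bounded integrals. *)
Lemma fatou_Rintegral (F : nat -> T -> R) f (v : nat -> R) l :
  (forall n, intg (F n)) -> (forall n x, D x -> 0 <= F n x) ->
  (forall x, D x -> F ^~ x @ \oo --> f x) ->
  (forall n, E (F n) <= v n) -> v @ \oo --> l ->
  intg f /\ E f <= l.
Proof.
move=> iF F0 Ff Fv vl.
have mF n : measurable_fun D (F n) := intg_meas (iF n).
have mf : measurable_fun D f by apply: measurable_fun_cvg Ff.
have f0 x : D x -> 0 <= f x.
  move=> Dx; rewrite -(cvg_lim _ (Ff x Dx))//; apply: limr_ge.
    by apply/cvg_ex; eexists; exact: (Ff x Dx).
  by apply: nearW => n; exact: F0.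
have le : (\int[mu]_(x in D) (f x)%:E <= l%:E)%E.
  have H := fatou mu mD (f := fun n x => (F n x)%:E).
  have e1 : (\int[mu]_(x in D) (f x)%:E =
      \int[mu]_(x in D) limn_einf (fun n => (F n x)%:E))%E.
    apply: eq_integral => x; rewrite inE => Dx.
    have c : (F n x)%:E @[n --> \oo] --> (f x)%:E.
      by apply: cvg_EFin; [exact: nearW|exact: Ff].
    by rewrite is_cvg_limn_einfE; [apply/esym/cvg_lim|apply/cvg_ex; eexists; exact: c].
  rewrite e1; apply: (le_trans (H _ _)).
  - by move=> n; apply/measurable_EFinP.
  - by move=> n x Dx; rewrite lee_fin F0.
  have cv : (v n)%:E @[n --> \oo] --> l%:E by apply: cvg_EFin => //; exact: nearW.
  rewrite -(cvg_lim _ cv)// limn_einf_lim; apply: lee_lim; first exact: is_cvg_einfs.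
    by apply: cvgP; exact: cv.
  apply: nearW => n; apply: (@le_trans _ _ (\int[mu]_(x in D) (F n x)%:E)%E).
    by rewrite /einfs; apply: ereal_inf_lbound; exists n => /=.
  by rewrite -[leLHS]fineK ?lee_fin ?Fv//; exact: integrable_fin_num (iF n).
have hi : intg f.
  apply/integrableP; split; first exact/measurable_EFinP.
  apply: le_lt_trans (ltry l); apply: le_trans le.
  by rewrite le_eqVlt; apply/orP; left; apply/eqP; apply: eq_integral => x; rewrite inE => Dx; rewrite /= ger0_norm ?f0.
split => //; rewrite -lee_fin fineK//; exact: integrable_fin_num hi.
Qed.

End RealIntegral.

Section ProbaIntegral.
Context d (T : measurableType d) (R : realType) (P : probability T R).

Lemma intg_bounded (f : T -> R) M : measurable_fun setT f ->
  (forall x, `|f x| <= M) -> P.-integrable setT (EFin \o f).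
Proof.
move=> mf fM; apply: measurable_bounded_integrable => //.
  exact: le_lt_trans (probability_le1 _ _) (ltry 1).
by exists M; split; [exact: num_real|move=> y My x _; exact: le_trans (fM x) (ltW My)].
Qed.

Lemma Rintegral_prob_cst (c : R) : Rintegral P setT (cst c) = c.
Proof. by rewrite /cst Rintegral_cst// [X in fine X](_ : _ = 1%E) ?mulr1//; exact: probability_setT. Qed.

End ProbaIntegral.

Section Derivatives.
Variable R : realType.
Local Notation mu := (@lebesgue_measure R).
Implicit Types (f g F G : R -> R).

Lemma deriveD_fun f g (x a b : R) : is_derive x 1 f a -> is_derive x 1 g b ->
  is_derive x 1 (fun x => f x + g x) (a + b).
Proof. by move=> hf hg; exact: is_deriveD. Qed.

Lemma deriveN_fun f (x a : R) : is_derive x 1 f a -> is_derive x 1 (fun x => - f x) (- a).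
Proof. by move=> hf; exact: is_deriveN. Qed.

Lemma deriveM_fun f g (x a b : R) : is_derive x 1 f a -> is_derive x 1 g b ->
  is_derive x 1 (fun x => f x * g x) (f x * b + g x * a).
Proof. by move=> hf hg; exact: is_deriveM. Qed.

Lemma is_derive_ext f g (x a b : R) : f =1 g -> a = b ->
  is_derive x 1 f a -> is_derive x 1 g b.
Proof. by move=> /funext -> ->. Qed.

Lemma derive_affine (u m c x : R) : is_derive x 1 (fun x => u * (x - m) + c) u.
Proof.
have h1 : is_derive x 1 (fun x : R => x - m) 1.
  by rewrite -[X in is_derive _ _ _ X](addr0 1); apply: deriveD_fun.
have := deriveD_fun (deriveM_fun (is_derive_cst u x 1) h1) (is_derive_cst c x 1).
by rewrite mulr0 !addr0 mulr1.
Qed.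

Lemma derive_cos_fun f (x a : R) : is_derive x 1 f a ->
  is_derive x 1 (fun x => cos (f x)) (- sin (f x) * a).
Proof. by move=> hf; exact: (@is_derive1_comp _ cos f). Qed.

Lemma derive_sin_fun f (x a : R) : is_derive x 1 f a ->
  is_derive x 1 (fun x => sin (f x)) (cos (f x) * a).
Proof. by move=> hf; exact: (@is_derive1_comp _ sin f). Qed.

Lemma derive_expR_fun f (x a : R) : is_derive x 1 f a ->
  is_derive x 1 (fun x => expR (f x)) (expR (f x) * a).
Proof. by move=> hf; exact: (@is_derive1_comp _ expR f). Qed.

Lemma is_derive_continuous f g : (forall x : R, is_derive x 1 f (g x)) -> continuous f.
Proof.
by move=> h x; apply: differentiable_continuous; apply/derivable1_diffP; have [] := h x.
Qed.

Lemma FTC2 f F (a b : R) : a < b -> continuous f ->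
  (forall x, is_derive (x : R) 1 F (f x)) ->
  Rintegral mu `[a, b] f = F b - F a.
Proof.
move=> ab cf dF.
have cF : continuous F.
  by move=> x; apply: differentiable_continuous; apply/derivable1_diffP.
rewrite /Rintegral (@continuous_FTC2 _ f F)//.
- exact: continuous_subspaceT.
- split.
  + by move=> x _; have [] := dF x.
  + by apply: cvg_at_right_filter; exact: cF.
  + by apply: cvg_at_left_filter; exact: cF.
- by move=> x _; rewrite derive1E; have dFx := dF x; rewrite derive_val.
Qed.

(** The bound forces [F] to be of order [1 / |x|], so the boundary terms over growing symmetric
    intervals vanish. It carries the integration by parts against the normal density. *)
Lemma Rintegral_deriv0 f F (C : R) : continuous f ->
  (forall x, is_derive (x : R) 1 F (f x)) ->
  mu.-integrable setT (EFin \o f) ->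
  (forall x, `|F x| * (1 + `|x|) <= C) ->
  Rintegral mu setT f = 0.
Proof.
move=> cf dF intf FC.
pose I n : set R := `[- (n.+1%:R : R), n.+1%:R]%classic.
have mI n : measurable (I n : set (measurableTypeR R)) by exact: measurable_itv.
have mf := intg_meas intf.
have e n : Rintegral mu setT (f \_ (I n)) = F n.+1%:R - F (- n.+1%:R).
  by rewrite -Rintegral_mkcond FTC2// gtrN.
have l1 : Rintegral mu setT (f \_ (I n)) @[n --> \oo] --> Rintegral mu setT f.
  apply: (@dominated_Rintegral _ _ _ mu setT measurableT _ _ (fun x => `|f x|)).
  - move=> n; have h := measurable_funTS (D := I n) mf.
    exact: ((measurable_restrictT f (mI n)).1 h).
  - exact: intg_norm.
  - move=> x _; apply: (@cvg_near_cst _ _ _ _ _) => //.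
    near=> n; rewrite patchE mem_set// /I /= in_itv/= -ler_norml.
    near: n; apply: filterS (nbhs_infty_ger `|x|) => n hn.
    by rewrite (le_trans hn)// ler_nat.
  - by move=> n x _; rewrite patchE; case: ifP => //; rewrite normr0.
have l2 : Rintegral mu setT (f \_ (I n)) @[n --> \oo] --> 0.
  apply/norm_cvg0P.
  apply: (@squeeze_cvgr _ _ _ _ (cst 0) (fun n => 2 * `|C| * n.+1%:R^-1)).
  - apply: nearW => n; rewrite normr_ge0/= e (le_trans (ler_normB _ _))//.
    have b x : `|x| = n.+1%:R -> `|F x| <= `|C| * n.+1%:R^-1.
      move=> xn; rewrite ler_pdivlMr ?ltr0n//; apply: le_trans (ler_norm C).
      apply: le_trans (FC x); rewrite ler_wpM2l// xn lerDr.
      exact: ler01.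
    by rewrite -mulrA mulr_natl mulr2n lerD// b// ?normrN normr_nat.
  - exact: cvg_cst.
  - rewrite -(mulr0 (2 * `|C|)); apply: cvgM; first exact: cvg_cst.
    exact: cvg_harmonic.
by have := cvg_unique _ l1 l2; apply.
Unshelve. all: end_near. Qed.

End Derivatives.

Section Calculus.
Variable R : realType.
Implicit Types (f g h : R -> R).

Lemma deriv_ge0_ge0 h h' (x : R) : (forall x : R, is_derive x 1 h (h' x)) ->
  h 0 = 0 -> (forall x, 0 <= x -> 0 <= h' x) -> 0 <= x -> 0 <= h x.
Proof.
move=> dh h0 h'0 x0.
have [c /andP[c0 _]] := @MVT_segment _ h h' 0 x x0 (fun y _ => dh y)
  (continuous_subspaceT (is_derive_continuous dh)).
by rewrite h0 !subr0 => ->; rewrite mulr_ge0// h'0.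
Qed.

Lemma ler_norm_sin (x : R) : `|sin x| <= `|x|.
Proof.
wlog x0 : x / 0 <= x.
  move=> H; case: (leP 0 x) => [/H//|x0].
  by rewrite -normrN -sinN -[leRHS]normrN H// oppr_ge0 ltW.
rewrite [leRHS]ger0_norm// ler_norml; apply/andP; split.
  have H := @deriv_ge0_ge0 (fun x => sin x + x) (fun x => cos x + 1) x.
  rewrite -subr_ge0 opprK; apply: H => [|y _|//].
    by rewrite sin0 addr0.
  by rewrite -lerBlDr sub0r cos_geN1.
have H := @deriv_ge0_ge0 (fun x => x - sin x) (fun x => 1 - cos x) x.
rewrite -subr_ge0; apply: H => [|y _|//].
  by rewrite sin0 subr0.
by rewrite subr_ge0 cos_le1.
Qed.

Lemma continuous_cos_aff (u th : R) : continuous (fun x : R => cos (u * x + th)).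
Proof.
have h (x : R) : is_derive x 1 (fun x => u * x + th) u.
  by apply: is_derive_ext (derive_affine u 0 th x) => // y; rewrite subr0.
exact: is_derive_continuous (fun x => derive_cos_fun (h x)).
Qed.

Lemma cos_half (x : R) : cos x = 1 - 2 * sin (x / 2) ^+ 2.
Proof.
rewrite [in LHS](_ : x = (x / 2) *+ 2); last by rewrite mulr2n; field.
by rewrite cos_mulr2n cos2sin2; ring.
Qed.

Lemma cos_ge (x : R) : 1 - x ^+ 2 / 2 <= cos x.
Proof.
have := ler_norm_sin (x / 2); rewrite cos_half -ler_sqr ?nnegrE//.
rewrite !real_normK ?num_real// => h.
have -> : x ^+ 2 / 2 = 2 * (x / 2) ^+ 2 by field.
lra.
Qed.

Lemma sin_ge (x : R) : 0 <= x -> x - x ^+ 3 / 6 <= sin x.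
Proof.
move=> x0; rewrite -subr_ge0.
have H := @deriv_ge0_ge0 (fun x => sin x - (x - x ^+ 3 / 6)) (fun x => cos x - (1 - x ^+ 2 / 2)) x.
apply: H => [y||y _|//].
- apply: deriveD_fun; apply: deriveN_fun; apply: deriveD_fun.
  apply: deriveN_fun.
  have d := deriveM_fun (deriveM_fun (is_derive_id y 1) (deriveM_fun (is_derive_id y 1) (is_derive_id y 1))) (is_derive_cst (6^-1 : R) y 1).
  by apply: is_derive_ext d => [z|]; rewrite ?mulr0 ?add0r /cst; [rewrite !exprS expr0 mulr1|field].
- by rewrite sin0 expr0n/= mul0r !subr0.
- by rewrite subr_ge0 cos_ge.
Qed.

Lemma expR_le_inv (t : R) : 0 <= t -> expR (- t) <= (1 + t)^-1.
Proof.
move=> t0; rewrite expRN lef_pV2 ?posrE ?expR_gt0 ?expR_ge1Dx//.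
by rewrite ltr_wpDr.
Qed.

(** Difference quotients along the steps [y / (n + 1)], the form that sequential dominated
    convergence consumes. The case [y = 0] is separate because the derivative is a limit along
    punctured neighbourhoods. *)
Lemma derive_seq f (a y : R) : is_derive (0 : R) 1 f a ->
  n.+1%:R * (f (y / n.+1%:R) - f 0) @[n --> \oo] --> a * y.
Proof.
move=> df; have [->|y0] := eqVneq y 0.
  by rewrite mulr0; under eq_fun do rewrite mul0r subrr mulr0; exact: cvg_cst.
have [dd dv] := df.
have c0 : (y / n.+1%:R : R) @[n --> \oo] --> (0 : R)^'.
  have c1 : (y / n.+1%:R : R) @[n --> \oo] --> (0 : R).
    by rewrite -(mulr0 y); apply: cvgM; [exact: cvg_cst|exact: cvg_harmonic].
  move=> A hA; have hA' : nbhs (0 : R) [set z : R | z != 0 -> A z] := hA.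
  have h2 : \forall n \near \oo, (y / n.+1%:R != 0 -> A (y / n.+1%:R)) := c1 _ hA'.
  apply: (filterS _ h2) => n; apply.
  by rewrite mulf_neq0// invr_eq0 pnatr_eq0.
have dv2 : h^-1 *: (f (h *: (1 : R) + 0) - f 0) @[h --> (0 : R)^'] --> a.
  by rewrite -dv; exact: dd.
have H := cvg_comp _ _ c0 dv2.
suff : (fun n => y * ((y / n.+1%:R)^-1 *: (f ((y / n.+1%:R) *: (1 : R) + 0) - f 0))) @ \oo --> y * a.
  rewrite mulrC; apply: cvg_trans; apply: near_eq_cvg; apply: nearW => n /=.
  rewrite [X in f (X + 0)](_ : _ = y / n.+1%:R) ?addr0; last by rewrite /GRing.scale/= mulr1.
  by rewrite /GRing.scale/= invf_div mulrA mulrCA mulfV// mulr1.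
by apply: cvgM; [exact: cvg_cst|exact: H].
Qed.

End Calculus.

(** * Centred Gaussian variables *)

Section NormalLaw.
Variable R : realType.
Local Notation mu := (@lebesgue_measure R).

(** The density is identified almost everywhere with the Radon-Nikodym derivative, by comparing
    integrals over measurable sets. *)
Lemma integral_normal_prob (m s : R) (f : R -> R) :
  measurable_fun setT f -> (normal_prob m s).-integrable setT (EFin \o f) ->
  (\int[normal_prob m s]_x (f x)%:E = \int[mu]_x (f x * normal_pdf m s x)%:E)%E.
Proof.
move=> mf finf; have hd := @normal_prob_dominates R m s.
rewrite -(Radon_Nikodym_change_of_variables hd)//=.
apply: ae_eq_integral => //.
- apply: emeasurable_funM; first exact/measurable_EFinP.
  apply: (measurable_int mu); apply: (integrableS _ _ (@subsetT _ _)) => //=.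
  by apply: Radon_Nikodym_integrable; exact: hd.
- by apply/measurable_EFinP/measurable_funM => //; exact: measurable_normal_pdf.
- under [X in ae_eq _ _ _ X]eq_fun do rewrite EFinM.
  apply: ae_eqe_mul2l => /=.
  rewrite Radon_NikodymE//=.
  case: cid => /= h [h1 h2 h3].
  apply: integral_ae_eq => //=.
  + by apply/measurable_EFinP; exact: measurable_normal_pdf.
  + by move=> E _ mE; rewrite -h3.
Qed.

Lemma expectation_gaussian d (T : measurableType d) (P : probability T R)
    (Z : {RV P >-> R}) (m s : R) (f : R -> R) (M : R) :
  s != 0 ->
  (forall B : set R, measurable B -> P (Z @^-1` B) = normal_prob m s B) ->
  measurable_fun setT f -> (forall x, `|f x| <= M) ->
  Rintegral P setT (f \o Z) = Rintegral mu setT (fun x => f x * normal_pdf m s x).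
Proof.
move=> s0 hZ mf fM.
have i1 : (normal_prob m s).-integrable setT (EFin \o f).
  exact: (@intg_bounded _ _ _ (normal_prob m s) f M).
rewrite /Rintegral -integral_normal_prob//; congr fine.
have mZ : measurable_fun setT (Z : T -> measurableTypeR R).
  by have mZ := measurable_funPT Z; exact mZ.
have i2 : P.-integrable (Z @^-1` setT) ((EFin \o f) \o Z).
  rewrite preimage_setT; apply: (@intg_bounded _ _ _ P (f \o Z) M) => //.
    exact: measurableT_comp.
  by move=> x; exact: fM.
have mf' : measurable_fun [set: measurableTypeR R] (EFin \o f) by exact/measurable_EFinP.
have := @integral_pushforward _ _ T (measurableTypeR R) R Z mZ P setT (EFin \o f) mf' i2 measurableT.
rewrite preimage_setT => <-.
by apply: eq_measure_integral => A mA _; exact: hZ.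
Qed.

(* [theta = 0] gives the cosine transform, [theta = - pi / 2] the sine one. *)
Lemma normal_pdf_cos (m s u th : R) : 0 < s ->
  Rintegral mu setT (fun x => cos (u * (x - m) + th) * normal_pdf m s x) =
  cos th * expR (- (u ^+ 2 * s ^+ 2 / 2)).
Proof.
move=> s0; have sn0 : s != 0 by rewrite gt_eqF.
pose g := normal_pdf m s.
have mg : measurable_fun setT g by exact: measurable_normal_pdf.
have ig : mu.-integrable setT (EFin \o g) by exact: integrable_normal_pdf.
have g0 x : 0 <= g x by exact: normal_pdf_ge0.
(* [K] is chosen so that [G], a multiple of the density at twice the standard deviation, dominates
   [|x - m| g x]: the wider tail absorbs the linear factor. *)
pose K := 2 * s * normal_peak s / normal_peak (2 * s).
have p0 : 0 < normal_peak s by exact: normal_peak_gt0.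
have s20 : 2 * s != 0 by rewrite mulf_neq0// pnatr_eq0.
pose G x := K * normal_pdf m (2 * s) x.
have iG : mu.-integrable setT (EFin \o G).
  by apply: intgZ => //; exact: integrable_normal_pdf.
have gE x : g x = normal_peak s * expR (- (x - m) ^+ 2 / (s ^+ 2 *+ 2)).
  by rewrite /g normal_pdfE.
have xg x : `|x - m| * g x <= G x.
  rewrite gE /G normal_pdfE// /normal_fun /K.
  have -> : 2 * s * normal_peak s / normal_peak (2 * s) *
      (normal_peak (2 * s) * expR (- (x - m) ^+ 2 / ((2 * s) ^+ 2 *+ 2))) =
      normal_peak s * (2 * s * expR (- (x - m) ^+ 2 / ((2 * s) ^+ 2 *+ 2))).
    by field; rewrite gt_eqF// normal_peak_gt0.
  rewrite mulrCA ler_wpM2l ?normal_peak_ge0//.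
  set y := x - m.
  have -> : - y ^+ 2 / (s ^+ 2 *+ 2) = - y ^+ 2 / ((2 * s) ^+ 2 *+ 2) - 3 * y ^+ 2 / ((2 * s) ^+ 2 *+ 2).
    by field.
  rewrite expRD mulrCA [X in _ <= X]mulrC ler_wpM2l ?expR_ge0//.
  rewrite -ler_pdivlMr ?expR_gt0// -expRN opprK.
  apply: (@le_trans _ _ (2 * s * (1 + 3 * y ^+ 2 / ((2 * s) ^+ 2 *+ 2)))); last first.
    by rewrite ler_pM2l ?expR_ge1Dx// mulr_gt0.
  have -> : 2 * s * (1 + 3 * y ^+ 2 / ((2 * s) ^+ 2 *+ 2)) = (8 * s ^+ 2 + 3 * `|y| ^+ 2) / (4 * s).
    by rewrite real_normK ?num_real//; field.
  rewrite ler_pdivlMr ?mulr_gt0//; have := sqr_ge0 (`|y| - 2 * s); nra.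
pose f (v x : R) := cos (v * (x - m) + th) * g x.
have cg : continuous g by exact: continuous_normal_pdf.
have daff (v x : R) : is_derive (x : R) 1 (fun x => v * (x - m) + th) v by exact: derive_affine.
have daff2 (v y : R) : is_derive v 1 (fun v => v * y + th) y.
  apply: is_derive_ext (derive_affine y 0 th v) => // w.
  by rewrite subr0 mulrC.
have ccos (v : R) : continuous (fun x => cos (v * (x - m) + th)).
  exact: is_derive_continuous (fun x => derive_cos_fun (daff v x)).
have csin (v : R) : continuous (fun x => sin (v * (x - m) + th)).
  exact: is_derive_continuous (fun x => derive_sin_fun (daff v x)).
have cos1 (x : R) : `|cos x| <= 1 by rewrite ler_norml cos_geN1 cos_le1.
have sin1 (x : R) : `|sin x| <= 1 by rewrite ler_norml sin_geN1 sin_le1.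
have iF (v : R) : mu.-integrable setT (EFin \o f v).
  apply: intg_le ig => //.
    by apply: measurable_funM => //; exact: continuous_measurable_fun.
  by move=> x _; rewrite normrM (ger0_norm (g0 x)) ler_piMl.
pose S (v x : R) := sin (v * (x - m) + th) * ((x - m) * g x).
have my : measurable_fun setT (fun x : R => (x - m) * g x).
  by apply: measurable_funM => //; exact: measurable_funB.
have iS (v : R) : mu.-integrable setT (EFin \o S v).
  apply: intg_le iG => //.
    by apply: measurable_funM => //; exact: continuous_measurable_fun.
  move=> x _; rewrite normrM (le_trans _ (xg x))// normrM (ger0_norm (g0 x)).
  by rewrite ler_piMl// mulr_ge0.
have dg (x : R) : is_derive x 1 g (- ((x - m) / s ^+ 2) * g x).
  have -> : g = fun x => normal_peak s * expR (- (x - m) ^+ 2 / (s ^+ 2 *+ 2)).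
    by apply/funext => z; rewrite gE.
  have d1 : is_derive x 1 (fun x => 1 * (x - m) + 0) 1 := derive_affine 1 m 0 x.
  have d2 := deriveM_fun (deriveN_fun (deriveM_fun d1 d1)) (is_derive_cst (s ^+ 2 *+ 2)^-1 x 1).
  have d3 := derive_expR_fun d2.
  have d4 := deriveM_fun (is_derive_cst (normal_peak s) x 1) d3.
  apply: is_derive_ext d4; first by move=> z; rewrite mul1r addr0 expr2.
  by rewrite /cst !mul1r !addr0 !mulr0 ?add0r ?addr0 [(x - m) ^+ 2]expr2; field.
(* Integration by parts: [D] is the derivative of [sin (v (x - m) + th) g x], which decays fast
   enough for its integral to vanish. *)
have key (v : R) : v * Rintegral mu setT (f v) = Rintegral mu setT (S v) / s ^+ 2.
  pose D (x : R) := v * f v x - (s ^+ 2)^-1 * S v x.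
  have D0 : Rintegral mu setT D = 0.
    pose F (x : R) := sin (v * (x - m) + th) * g x.
    apply: (@Rintegral_deriv0 _ D F (normal_peak s * (1 + `|m|) + K * normal_peak (2 * s))).
    - move=> x; apply: cvgB; apply: cvgM.
      + exact: cvg_cst.
      + by apply: cvgM; [exact: ccos|exact: cg].
      + exact: cvg_cst.
      + apply: cvgM; first exact: csin.
        by apply: cvgM; [apply: cvgB; [exact: cvg_id|exact: cvg_cst]|exact: cg].
    - move=> x.
      have d1 := deriveM_fun (derive_sin_fun (daff v x)) (dg x).
      apply: is_derive_ext d1; first by [].
      by rewrite /D /f /S /=; field.
    - by apply: intgB => //; apply: intgZ.
    - move=> x; apply: (@le_trans _ _ (g x * (1 + `|x|))).
        rewrite ler_wpM2r ?addr_ge0// /F normrM (ger0_norm (g0 x)) ler_piMl//.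
      have xm : `|x| <= `|m| + `|x - m|.
        by rewrite addrC (le_trans _ (ler_normD _ _))// subrK.
      have := xg x; have gp : g x <= normal_peak s by exact: normal_pdf_ub.
      have Gp : G x <= K * normal_peak (2 * s).
        rewrite /G ler_wpM2l ?normal_pdf_ub// /K.
        by rewrite !mulr_ge0 ?invr_ge0 ?normal_peak_ge0// ltW.
      have := g0 x; have := normr_ge0 m; have := normr_ge0 (x - m); nra.
  move: D0; rewrite RintegralB//; [|exact: intgZ..].
  by rewrite !RintegralZl// => /eqP; rewrite subr_eq0 => /eqP ->; rewrite mulrC.
pose Phi (v : R) := Rintegral mu setT (f v).
have p1 (v x : R) : partial1of2 f v x = - S v x.
  rewrite partial1of2E /S /f.
  have d1 := deriveM_fun (derive_cos_fun (daff2 v (x - m))) (is_derive_cst (g x) v 1).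
  have -> := @derive_val _ _ _ _ _ _ _ d1.
  by rewrite mulr0 add0r /=; ring.
(* Differentiation under the integral, dominated by [G], and [key] give the linear equation
   [Phi' = - s^2 v Phi]. *)
have dPhi (v : R) : is_derive v 1 Phi (- (s ^+ 2 * v * Phi v)).
  have Iv : `]v - 1, v + 1[%classic v by rewrite /= in_itv/= ltrBlDr ltrDl ltr01.
  have H1 : forall (x y : R), `]v - 1, v + 1[%classic x -> setT y -> derivable (f^~ y) x 1.
    move=> w x _ _.
    by have [] := deriveM_fun (derive_cos_fun (daff2 w (x - m))) (is_derive_cst (g x) w 1).
  have G0 y : 0 <= G y by apply: le_trans (xg y); rewrite mulr_ge0.
  have H2 : forall (x y : R), `]v - 1, v + 1[%classic x -> setT y -> `|partial1of2 f x y| <= G y.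
    move=> w x _ _; rewrite p1 normrN normrM (le_trans _ (xg x))// normrM (ger0_norm (g0 x)).
    by rewrite ler_piMl// mulr_ge0.
  have H3 : forall x : R, `]v - 1, v + 1[%classic x -> mu.-integrable setT (EFin \o f x) by move=> w _; exact: iF.
  have d1 := @derivable_under_integral _ _ _ mu f setT measurableT v _ _ Iv H3 H1 G G0 iG H2.
  have d2 := @differentiation_under_integral _ _ _ mu f setT measurableT v _ _ Iv H3 H1 G G0 iG H2.
  apply: DeriveDef => //; rewrite -derive1E d2.
  rewrite (@eq_Rintegral _ _ _ mu setT (fun x => -1 * S v x)).
    rewrite RintegralZl// /Phi -(mulrA (s ^+ 2)) key; field.
    by [].
  by move=> x _; rewrite p1 mulN1r.
(* The integrating factor: [Phi E] has zero derivative, hence equals its value [cos th] at zero. *)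
pose E (v : R) := expR (v * v * (s ^+ 2 / 2)).
have dH (v : R) : is_derive v 1 (fun v => Phi v * E v) 0.
  have d1 := deriveM_fun (deriveM_fun (is_derive_id v 1) (is_derive_id v 1)) (is_derive_cst (s ^+ 2 / 2) v 1).
  have d2 := deriveM_fun (dPhi v) (derive_expR_fun d1).
  apply: is_derive_ext d2; first by [].
  by rewrite /E /=; field.
have := is_derive_0_is_cst u 0 dH.
rewrite /E !mul0r expR0 mulr1 => h0.
have -> : Rintegral mu setT (fun x => cos (u * (x - m) + th) * normal_pdf m s x) = Phi u by [].
have Phi0 : Phi 0 = cos th.
  rewrite /Phi (@eq_Rintegral _ _ _ mu setT (fun x => cos th * g x)).
    rewrite RintegralZl// [Rintegral _ _ _](_ : _ = 1) ?mulr1//.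
    by rewrite /Rintegral integral_normal_pdf.
  by move=> x _; rewrite /f mul0r add0r.
by rewrite -Phi0 -h0 -[X in _ = X]mulrA -expRD [X in expR X](_ : _ = 0) ?expR0 ?mulr1//; field.
Qed.

End NormalLaw.

Section CenteredGaussian.
Context d (T : measurableType d) (R : realType) (P : probability T R).
Implicit Types (Z : T -> R) (v : R).
Local Notation E f := (Rintegral P setT f).
Local Notation intg f := (P.-integrable setT (EFin \o f)).

(* The phase [th] packs the cosine and the sine transforms together. *)
Definition cgauss Z v := measurable_fun setT Z /\
  forall u th, E (fun w => cos (u * Z w + th)) = cos th * expR (- (u ^+ 2 * v / 2)).

Lemma measurable_cos_aff Z (u th : R) : measurable_fun setT Z ->
  measurable_fun setT (fun w => cos (u * Z w + th)).
Proof.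
move=> mZ; apply: (measurableT_comp (f := cos)).
  by apply: continuous_measurable_fun; exact: continuous_cos.
by apply: measurable_funD => //; apply: measurable_funM.
Qed.

Lemma intg_cos_aff Z (u th : R) : measurable_fun setT Z ->
  intg (fun w => cos (u * Z w + th)).
Proof.
move=> mZ; apply: (@intg_bounded _ _ _ P _ 1) => [|w]; last exact: cos_max.
exact: measurable_cos_aff.
Qed.

(** Since cosines are bounded by one, the defining transform passes to pointwise limits by dominated
    convergence, and degenerate limits are included. *)
Lemma cgauss_cvg (Z_ : nat -> T -> R) (v_ : nat -> R) Z v :
  (forall n, cgauss (Z_ n) (v_ n)) ->
  (forall w, Z_ ^~ w @ \oo --> Z w) -> v_ @ \oo --> v -> cgauss Z v.
Proof.
move=> hZ ZZ vv.
have mZ : measurable_fun setT Z.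
  by apply: (measurable_fun_cvg (h := Z_)) => [n|w _]; [have [] := hZ n|exact: ZZ].
split=> // u th.
have l1 : E (fun w => cos (u * Z_ n w + th)) @[n --> \oo] --> E (fun w => cos (u * Z w + th)).
  apply: (@dominated_Rintegral _ _ _ P setT measurableT _ _ (fun=> 1)).
  - by move=> n; apply: measurable_cos_aff; have [] := hZ n.
  - by apply: (@intg_bounded _ _ _ P _ 1) => // w; rewrite normr1.
  - move=> w _; apply: (@continuous_cvg _ _ _ _ _ _ (fun y => cos (u * y + th))); last exact: ZZ.
    exact: continuous_cos_aff.
  - by move=> n w _; exact: cos_max.
have l2 : E (fun w => cos (u * Z_ n w + th)) @[n --> \oo] --> cos th * expR (- (u ^+ 2 * v / 2)).
  under eq_fun do rewrite (hZ _).2.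
  apply: cvgM; first exact: cvg_cst.
  apply: (@continuous_cvg _ _ _ _ _ _ expR); first exact: continuous_expR.
  apply: cvgN; apply: cvgM; last exact: cvg_cst.
  by apply: cvgM => //; exact: cvg_cst.
by have := cvg_unique _ l1 l2; apply.
Qed.

(** The second moment is not assumed finite. The bounded variables [F n = 2 N^2 (1 - cos (Z / N))]
    have known expectations, lie below [Z^2] and tend to it: Fatou gives integrability and one
    inequality, [F n <= Z^2] the other. *)
Lemma cgauss_sqr Z v : cgauss Z v ->
  intg (fun w => Z w ^+ 2) /\ E (fun w => Z w ^+ 2) = v.
Proof.
move=> [mZ hZ].
pose N (n : nat) : R := n.+1%:R.
have Ngt n : 0 < N n by rewrite ltr0n.
have N0 n : N n != 0 by rewrite gt_eqF.
pose F n w := (2 * N n * sin (Z w / (2 * N n))) ^+ 2.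
have FE n w : F n w = 2 * N n ^+ 2 - 2 * N n ^+ 2 * cos ((N n)^-1 * Z w + 0).
  rewrite /F addr0 (cos_half (_ * _)) exprMn.
  have -> : (N n)^-1 * Z w / 2 = Z w / (2 * N n) by field.
  ring.
have iF n : intg (F n).
  apply: (@eq_integrable _ _ _ P setT measurableT (EFin \o (fun w => 2 * N n ^+ 2 - 2 * N n ^+ 2 * cos ((N n)^-1 * Z w + 0)))).
    by move=> w _; rewrite /= FE.
  apply: intgB => //; last by apply: intgZ => //; exact: intg_cos_aff.
  by apply: (@intg_bounded _ _ _ P _ `|2 * N n ^+ 2|).
have EF n : E (F n) = 2 * N n ^+ 2 * (1 - expR (- (v / (2 * N n ^+ 2)))).
  have i1 := intg_cos_aff (N n)^-1 0 mZ.
  rewrite (@eq_Rintegral _ _ _ P setT (fun w => 2 * N n ^+ 2 - 2 * N n ^+ 2 * cos ((N n)^-1 * Z w + 0))).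
    have i2 : intg (fun=> 2 * N n ^+ 2) by apply: (@intg_bounded _ _ _ P _ `|2 * N n ^+ 2|).
    rewrite (RintegralB measurableT i2 (intgZ measurableT _ i1)).
    rewrite (RintegralZl _ measurableT i1) hZ cos0 mul1r.
    rewrite [X in X - _](_ : _ = 2 * N n ^+ 2); last exact: Rintegral_prob_cst.
    have -> : (N n)^-1 ^+ 2 * v / 2 = v / (2 * N n ^+ 2) by field.
    by ring.
  by move=> w _; exact: FE.
have FZ w : F n w @[n --> \oo] --> Z w ^+ 2.
  have h := @derive_seq _ sin _ (Z w / 2) (is_derive_sin 0).
  have h2 : 2 * (N n * (sin (Z w / 2 / N n) - sin 0)) @[n --> \oo] --> 2 * (cos 0 * (Z w / 2)).
    by apply: cvgM => //; exact: cvg_cst.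
  have -> : Z w ^+ 2 = (2 * (cos 0 * (Z w / 2))) ^+ 2 by rewrite cos0; field.
  rewrite /F; under eq_fun => n.
    rewrite -[2 * _ * sin _]mulrA -[sin _]subr0 -sin0 [X in sin X - _](_ : _ = Z w / 2 / N n); last by field.
    over.
  by under eq_fun do rewrite expr2; rewrite expr2; exact: cvgM.
have Fle n w : F n w <= Z w ^+ 2.
  have p : 0 < 2 * N n :> R by rewrite mulr_gt0.
  rewrite /F -ler_sqrt ?sqr_ge0// !sqrtr_sqr normrM (gtr0_norm p).
  rewrite -ler_pdivlMl// (le_trans (ler_norm_sin _))// normrM mulrC.
  by rewrite ler_wpM2r// normfV gtr0_norm.
have EFle n : E (F n) <= v.
  rewrite EF; have p : 0 < 2 * N n ^+ 2 :> R by rewrite mulr_gt0// exprn_gt0.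
  rewrite -ler_pdivlMl// [X in _ <= X]mulrC.
  by set t := v / _; have := expR_ge1Dx (- t); lra.
have [iZ Zv] := fatou_Rintegral measurableT iF (fun n w _ => sqr_ge0 _) (fun w _ => FZ w) EFle (cvg_cst v).
have v0 : 0 <= v by apply: le_trans (EFle 0%N); apply: Rintegral_ge0 => w _; exact: sqr_ge0.
split => //; apply/eqP; rewrite eq_le Zv/=.
(* From [expR (- t) <= 1 / (1 + t)] at [t = v / (2 N^2)], loosened by [N <= N^2] so that a harmonic
   sequence governs the limit. *)
have lb n : v * (1 + v / 2 * (N n)^-1)^-1 <= E (fun w => Z w ^+ 2).
  apply: (@le_trans _ _ (E (F n))); last by apply: (le_Rintegral measurableT (iF n) iZ) => w _; exact: Fle.
  have n1 : 1 <= N n :> R by rewrite ler1n.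
  have t0 : 0 <= v / (2 * N n ^+ 2) by rewrite divr_ge0// mulr_ge0// sqr_ge0.
  rewrite EF; apply: (@le_trans _ _ (2 * N n ^+ 2 * (1 - (1 + v / (2 * N n ^+ 2))^-1))); last first.
    by rewrite ler_pM2l ?mulr_gt0 ?exprn_gt0// lerB// expR_le_inv.
  have -> : 2 * N n ^+ 2 * (1 - (1 + v / (2 * N n ^+ 2))^-1) = v * (1 + v / (2 * N n ^+ 2))^-1.
    field; rewrite gt_eqF//= gt_eqF//.
    by have := sqr_ge0 (N n); nra.
  rewrite ler_wpM2l// lef_pV2 ?posrE ?ltr_wpDr// ?mulr_ge0 ?invr_ge0 ?ler0n//.
  rewrite lerD2l invfM mulrA ler_wpM2l ?divr_ge0// lef_pV2 ?posrE ?exprn_gt0//.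
  by rewrite expr2 ler_peMr// ltW.
have l0 : v / 2 * (N n)^-1 @[n --> \oo] --> (0 : R).
  by rewrite -(mulr0 (v / 2)); apply: cvgM; [exact: cvg_cst|exact: cvg_harmonic].
have l1 : 1 + v / 2 * (N n)^-1 @[n --> \oo] --> (1 + 0 : R).
  by apply: cvgD => //; exact: cvg_cst.
have lc : v * (1 + v / 2 * (N n)^-1)^-1 @[n --> \oo] --> (v * (1 + 0)^-1 : R).
  apply: cvgM; first exact: cvg_cst.
  by apply: cvgV => //; rewrite addr0 oner_neq0.
rewrite addr0 invr1 mulr1 in lc.
rewrite -(cvg_lim _ lc)//; apply: limr_le; first by apply/cvg_ex; eexists; exact: lc.
by apply: nearW.
Qed.

End CenteredGaussian.

Lemma discriminant_le0 (R : realType) (a b c : R) : 0 <= a ->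
  (forall t, 0 <= t ^+ 2 * a + 2 * t * b + c) -> b ^+ 2 <= a * c.
Proof.
move=> a_ge0 H; have [a0|a0] := eqVneq a 0.
  rewrite a0 mul0r; have [->|b0] := eqVneq b 0; first by rewrite expr0n.
  (* With [a = 0] and [b != 0] the polynomial is affine and takes the value [-1] at this point. *)
  have := H (- (c + 1) / (2 * b)).
  by rewrite a0 mulr0 add0r [2 * _ * b](_ : _ = - (c + 1)); [lra|field].
have ap : 0 < a by rewrite lt_def a0.
have := H (- b / a).
have -> : (- b / a) ^+ 2 * a + 2 * (- b / a) * b + c = (a * c - b ^+ 2) / a by field.
by rewrite pmulr_lge0 ?invr_gt0// subr_ge0.
Qed.

Section SquareIntegrable.
Context d (T : measurableType d) (R : realType).
Variables (mu : {measure set T -> \bar R}) (D : set T) (mD : measurable D).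
Implicit Types f g : T -> R.
Local Notation intg f := (mu.-integrable D (EFin \o f)).
Local Notation E f := (Rintegral mu D f).

Definition sqi f := measurable_fun D f /\ intg (fun x => f x ^+ 2).

Lemma sqi_mul f g : sqi f -> sqi g -> intg (fun x => f x * g x).
Proof.
move=> [mf hf] [mg hg].
apply: (intg_le mD (g := fun x => f x ^+ 2 + g x ^+ 2)) (intgD mD hf hg).
  exact: measurable_funM.
by move=> x _; rewrite ler_norml; apply/andP; split; nra.
Qed.

Lemma sqi_lin f g a : sqi f -> sqi g -> sqi (fun x => a * f x + g x).
Proof.
move=> hf hg; have [mf if2] := hf; have [mg ig2] := hg; split.
  by apply: measurable_funD => //; exact: measurable_funM.
have h := intgD mD (intgZ mD (a ^+ 2) if2) (intgD mD (intgZ mD (2 * a) (sqi_mul hf hg)) ig2).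
by apply: eq_integrable h => // x _ /=; congr EFin; ring.
Qed.

Lemma E_sqr_lin f g a : sqi f -> sqi g ->
  E (fun x => (a * f x + g x) ^+ 2) =
  a ^+ 2 * E (fun x => f x ^+ 2) + 2 * a * E (fun x => f x * g x) + E (fun x => g x ^+ 2).
Proof.
move=> hf hg; have [_ if2] := hf; have [_ ig2] := hg; have ifg := sqi_mul hf hg.
rewrite -!RintegralZl// -!RintegralD//; first last.
- exact: intgZ.
- exact: intgZ.
- exact: (intgD mD (intgZ mD (a ^+ 2) if2) (intgZ mD (2 * a) ifg)).
by apply: eq_Rintegral => x _; ring.
Qed.

Lemma E_mul_linl f g h a : sqi f -> sqi g -> sqi h ->
  E (fun x => (a * f x + g x) * h x) = a * E (fun x => f x * h x) + E (fun x => g x * h x).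
Proof.
move=> hf hg hh; rewrite -RintegralZl ?(sqi_mul hf hh)// -RintegralD ?(sqi_mul hg hh)//.
  by apply: eq_Rintegral => x _; ring.
by apply: intgZ => //; exact: sqi_mul.
Qed.

Lemma E_sqr_ge0 f : 0 <= E (fun x => f x ^+ 2).
Proof. by apply: Rintegral_ge0 => x _; exact: sqr_ge0. Qed.

Lemma E_Cauchy f g : sqi f -> sqi g ->
  E (fun x => f x * g x) ^+ 2 <= E (fun x => f x ^+ 2) * E (fun x => g x ^+ 2).
Proof.
by move=> hf hg; apply: discriminant_le0 => [|t]; rewrite -?E_sqr_lin// E_sqr_ge0.
Qed.

End SquareIntegrable.

Section GaussianSpace.
Context d (T : measurableType d) (R : realType) (P : probability T R).
Implicit Types (Z e L : T -> R).
Local Notation E f := (Rintegral P setT f).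
Local Notation intg f := (P.-integrable setT (EFin \o f)).

Definition linspace (H : set (T -> R)) := forall a Z Z', H Z -> H Z' ->
  H (fun w => a * Z w + Z' w).

(** Joint normality is encoded by linearity: every linear combination of members is again a centred
    normal variable. *)
Definition gaussian_space (H : set (T -> R)) :=
  (forall Z, H Z -> exists v, cgauss P Z v) /\ linspace H.

Lemma sqi_intg Z : sqi P setT Z -> intg Z.
Proof.
move=> [mZ iZ]; apply: (intg_le measurableT (g := fun w => 1 + Z w ^+ 2)) => //.
  by move=> w _; rewrite ler_norml; apply/andP; split; nra.
by apply: intgD => //; apply: (@intg_bounded _ _ _ P _ 1) => // w; rewrite normr1.
Qed.

Variables (H : set (T -> R)) (gH : gaussian_space H).

Lemma gspace_sqi Z : H Z -> sqi P setT Z.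
Proof. by case: gH => h _ /h[v hv]; split; [case: hv|have [] := cgauss_sqr hv]. Qed.

Lemma gspace_cos Z th : H Z ->
  E (fun w => cos (Z w + th)) = cos th * expR (- (E (fun w => Z w ^+ 2) / 2)).
Proof.
case: gH => h _ /h[v hv]; have [_ ->] := cgauss_sqr hv.
case: hv => _ /(_ 1 th); rewrite expr1n mul1r => <-.
by apply: eq_Rintegral => w _; rewrite mul1r.
Qed.

Lemma gspace_sin Z th : H Z ->
  E (fun w => sin (Z w + th)) = sin th * expR (- (E (fun w => Z w ^+ 2) / 2)).
Proof.
move=> hZ; rewrite -(cosBpihalf th) -gspace_cos//.
by apply: eq_Rintegral => w _; rewrite addrA cosBpihalf.
Qed.

(* Gaussian integration by parts, obtained by differentiating
   [E sin (u e + L + th)] at [u = 0]. *)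
Lemma gspace_stein e L th : H e -> H L ->
  E (fun w => e w * cos (L w + th)) =
  - E (fun w => e w * L w) * E (fun w => sin (L w + th)).
Proof.
move=> he hL; have [_ lH] := gH.
have se := gspace_sqi he; have sL := gspace_sqi hL.
set a := E (fun w => e w ^+ 2); set c := E (fun w => e w * L w).
set b := E (fun w => L w ^+ 2).
pose N (n : nat) : R := n.+1%:R.
have Ngt n : 0 < N n by rewrite ltr0n.
have N0 n : N n != 0 by rewrite gt_eqF.
have Esin u : E (fun w => sin (u * e w + L w + th)) =
    sin th * expR (- ((u ^+ 2 * a + 2 * u * c + b) / 2)).
  by rewrite (@gspace_sin (fun w => u * e w + L w)) ?E_sqr_lin//; exact: lH.
have me : measurable_fun setT e by case: se.
have mL : measurable_fun setT L by case: sL.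
have mcos (Z : T -> R) : measurable_fun setT Z -> measurable_fun setT (fun w => cos (Z w)).
  by apply: (measurableT_comp (f := cos)); apply: continuous_measurable_fun; exact: continuous_cos.
have msin (Z : T -> R) : measurable_fun setT Z -> measurable_fun setT (fun w => sin (Z w)).
  by apply: (measurableT_comp (f := sin)); apply: continuous_measurable_fun; exact: continuous_sin.
have isin (Z : T -> R) : measurable_fun setT Z -> intg (fun w => sin (Z w)).
  by move=> mZ; apply: (@intg_bounded _ _ _ P _ 1) => [|w]; [exact: msin|exact: sin_max].
(* This is the symmetric difference quotient of [sin (u e + L + th)] at [u = 0] with step [1 / N];
   in product form it is visibly dominated by [|e|]. *)
pose F n w := N n * sin (e w / N n) * cos (L w + th).
have mF n : measurable_fun setT (F n).
  apply: measurable_funM; last by apply: mcos; exact: measurable_funD.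
  by apply: measurable_funM => //; apply: msin; exact: measurable_funM.
have EF n : E (F n) = sin th * expR (- (b / 2)) * expR (- (a / 2 * (N n)^-1 ^+ 2)) *
    ((N n * (expR (- c / N n) - expR 0) - N n * (expR (c / N n) - expR 0)) / 2).
  pose s1 w := sin ((N n)^-1 * e w + L w + th).
  pose s2 w := sin (- (N n)^-1 * e w + L w + th).
  have i1 : intg s1 by apply: isin; do 2 apply: measurable_funD => //; exact: measurable_funM.
  have i2 : intg s2 by apply: isin; do 2 apply: measurable_funD => //; exact: measurable_funM.
  rewrite (@eq_Rintegral _ _ _ P setT (fun w => N n / 2 * (s1 w - s2 w))); last first.
    move=> w _; rewrite /F /s1 /s2 -!addrA !sinD mulNr sinN cosN (mulrC _ (e w)).
    by field.
  rewrite (RintegralZl _ measurableT (intgB measurableT i1 i2)) (RintegralB measurableT i1 i2).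
  rewrite /s1 /s2 !Esin.
  have -> : - (((N n)^-1 ^+ 2 * a + 2 * (N n)^-1 * c + b) / 2) =
     - (b / 2) + (- (a / 2 * (N n)^-1 ^+ 2) + - c / N n) by field.
  have -> : - (((- (N n)^-1) ^+ 2 * a + 2 * - (N n)^-1 * c + b) / 2) =
     - (b / 2) + (- (a / 2 * (N n)^-1 ^+ 2) + c / N n) by field.
  by rewrite !expRD; field.
have l1 : E (F n) @[n --> \oo] --> E (fun w => e w * cos (L w + th)).
  apply: (@dominated_Rintegral _ _ _ P setT measurableT _ _ (fun w => `|e w|)) => //.
  - by apply: intg_norm => //; exact: sqi_intg.
  - move=> w _; apply: cvgM; last exact: cvg_cst.
    have := @derive_seq _ sin _ (e w) (is_derive_sin 0).
    by rewrite cos0 mul1r; under eq_fun do rewrite sin0 subr0.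
  - move=> n w _; apply: (@le_trans _ _ `|N n * sin (e w / N n)|).
      by rewrite normrM ler_piMr// cos_max.
    rewrite normrM (gtr0_norm (Ngt n)) -ler_pdivlMl// (le_trans (ler_norm_sin _))//.
    by rewrite normrM normfV (gtr0_norm (Ngt n)) mulrC.
have d0 := is_derive_expR (0 : R); rewrite expR0 in d0.
have l2 := @derive_seq _ expR 1 (- c) d0.
have l3 := @derive_seq _ expR 1 c d0.
have h1 : (N n)^-1 @[n --> \oo] --> (0 : R) by exact: cvg_harmonic.
have h2 : - (a / 2 * ((N n)^-1 * (N n)^-1)) @[n --> \oo] --> (- (a / 2 * (0 * 0)) : R).
  by apply: cvgN; apply: cvgM; [exact: cvg_cst|exact: cvgM].
have l4 : expR (- (a / 2 * (N n)^-1 ^+ 2)) @[n --> \oo] --> (1 : R).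
  rewrite -[X in _ --> X]expR0; apply: (@continuous_cvg _ _ _ _ _ _ expR); first exact: continuous_expR.
  rewrite !mulr0 oppr0 in h2; apply: cvg_trans h2; apply: near_eq_cvg.
  by apply: nearW => n; rewrite expr2.
have l5 : E (F n) @[n --> \oo] --> sin th * expR (- (b / 2)) * 1 * ((1 * - c - 1 * c) / 2).
  under eq_fun do rewrite EF.
  apply: cvgM; first by apply: cvgM => //; exact: cvg_cst.
  by apply: cvgM; [exact: cvgB|exact: cvg_cst].
have -> : E (fun w => e w * cos (L w + th)) =
    sin th * expR (- (b / 2)) * 1 * ((1 * - c - 1 * c) / 2).
  by have := cvg_unique _ l1 l5; apply.
by rewrite gspace_sin// -/b; field.
Qed.

End GaussianSpace.

(** * Projection in Gaussian spaces *)

Section BoundedFunctions.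
Context d (T : measurableType d) (R : realType) (P : probability T R).
Implicit Types (f g : T -> R).
Local Notation E f := (Rintegral P setT f).

Definition bdm f := measurable_fun setT f /\ exists M : R, forall w, `|f w| <= M.

Lemma bdm_sqi f : bdm f -> sqi P setT f.
Proof.
move=> [mf [M fM]]; split => //; apply: (@intg_bounded _ _ _ P _ (M ^+ 2)).
  exact: measurable_funX.
by move=> w; rewrite normrX ler_sqr ?nnegrE// (le_trans _ (fM w)).
Qed.

Lemma bdm_lin a f g : bdm f -> bdm g -> bdm (fun w => a * f w + g w).
Proof.
move=> [mf [M fM]] [mg [N gN]]; split.
  by apply: measurable_funD => //; exact: measurable_funM.
exists (`|a| * M + N) => w; rewrite (le_trans (ler_normD _ _))// lerD// normrM.
by rewrite ler_wpM2l.
Qed.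

Lemma bdm_mul f g : bdm f -> bdm g -> bdm (fun w => f w * g w).
Proof.
move=> [mf [M fM]] [mg [N gN]]; split; first exact: measurable_funM.
by exists (M * N) => w; rewrite normrM ler_pM.
Qed.

Lemma E_sqr_split f g h : sqi P setT f -> sqi P setT g -> sqi P setT h ->
  E (fun w => (f w - h w) ^+ 2) <=
  2 * E (fun w => (f w - g w) ^+ 2) + 2 * E (fun w => (g w - h w) ^+ 2).
Proof.
have B u v : sqi P setT u -> sqi P setT v -> P.-integrable setT (EFin \o (fun w => (u w - v w) ^+ 2)).
  move=> hu hv; have [_] := sqi_lin measurableT (-1) hv hu.
  by apply: eq_integrable => // w _ /=; congr EFin; ring.
move=> hf hg hh.
have ifg := B _ _ hf hg; have igh := B _ _ hg hh; have ifh := B _ _ hf hh.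
rewrite -!RintegralZl// -RintegralD//; [|exact: intgZ..].
apply: le_Rintegral => //; first by apply: intgD => //; exact: intgZ.
move=> w _; set x := f w; set y := g w; set z := h w.
have := sqr_ge0 (x - y - (y - z)); nra.
Qed.

Lemma bounded_cvg_sqr (F : nat -> T -> R) f M :
  (forall n, measurable_fun setT (F n)) -> (forall n w, `|F n w| <= M) ->
  (forall w, F ^~ w @ \oo --> f w) ->
  bdm f /\ E (fun w => (f w - F n w) ^+ 2) @[n --> \oo] --> 0.
Proof.
move=> mF FM Ff.
have mf : measurable_fun setT f by apply: (measurable_fun_cvg (h := F)) => // w _; exact: Ff.
have fM w : `|f w| <= M.
  have h : `|F n w| @[n --> \oo] --> `|f w| by apply: cvg_norm; exact: Ff.
  rewrite -(cvg_lim _ h)//; apply: limr_le; first by apply/cvg_ex; eexists; exact: h.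
  by apply: nearW => n; exact: FM.
split; first by split=> //; exists M.
have -> : 0 = E (fun=> 0) by rewrite Rintegral_prob_cst.
apply: (@dominated_Rintegral _ _ _ P setT measurableT _ _ (fun=> (2 * M) ^+ 2)).
- by move=> n; apply: measurable_funX; exact: measurable_funB.
- by apply: (@intg_bounded _ _ _ P _ `|(2 * M) ^+ 2|).
- move=> w _; have h : f w - F n w @[n --> \oo] --> f w - f w.
    by apply: cvgB; [exact: cvg_cst|exact: Ff].
  rewrite subrr in h; under eq_fun do rewrite expr2.
  by rewrite -(mulr0 0); exact: cvgM.
- move=> n w _; rewrite normrX ler_sqr ?nnegrE//; last first.
    by rewrite mulr_ge0// (le_trans _ (fM w)).
  by rewrite (le_trans (ler_normB _ _))// mulr_natl mulr2n lerD.
Qed.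

(** In this range the sum is the integer part of [y], counted level by level. *)
Lemma layercake_count (n : nat) (y : R) : 0 <= y <= n%:R ->
  0 <= y - \sum_(k < n) (k.+1%:R <= y)%R%:R <= 1.
Proof.
elim: n => [|n IHn] /andP[y0 yn].
  by rewrite big_ord0 subr0 y0/= (le_trans yn)// ler01.
rewrite big_ord_recr/=; case: (leP y n%:R) => [yn'|ny].
  case: (leP n.+1%:R y) => [h|_]; last by rewrite addr0 IHn// y0.
  by have := le_trans h yn'; rewrite ler_nat ltnn.
have -> : \sum_(i < n) (i.+1%:R <= y)%R%:R = n%:R :> R.
  rewrite (eq_bigr (fun=> 1)) ?sumr_const ?card_ord// => i _.
  by rewrite (le_trans _ (ltW ny))// ler_nat.
case: (leP n.+1%:R y) => [h|h].
  have -> : y = n.+1%:R by apply/eqP; rewrite eq_le yn h.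
  by rewrite -natr1 subrr lexx ler01.
by rewrite addr0 subr_ge0 (ltW ny)/= lerBlDl natr1 ltW.
Qed.

(** Quantisation of [f] in steps of [2 M / (n + 1)], written with indicators of upper level sets, so
    that a statement about sets extends to bounded functions by uniform convergence. *)
Definition layercake (f : T -> R) (M : R) (n : nat) (w : T) : R :=
  2 * M / n.+1%:R * (\sum_(k < n.+1) \1_[set w | k.+1%:R <= (f w + M) * n.+1%:R / (2 * M)] w) - M.

Lemma layercake_near f M n w : 0 < M -> `|f w| <= M ->
  `|f w - layercake f M n w| <= 2 * M / n.+1%:R.
Proof.
move=> M0 fM; have n0 : 0 < n.+1%:R :> R by rewrite ltr0n.
have c0 : 0 < 2 * M / n.+1%:R by rewrite divr_gt0// mulr_gt0.
set y := (f w + M) * n.+1%:R / (2 * M).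
have fE : f w = 2 * M / n.+1%:R * y - M by rewrite /y; field; rewrite !gt_eqF.
rewrite /layercake {1}fE.
have -> : \sum_(k < n.+1) \1_[set w | k.+1%:R <= (f w + M) * n.+1%:R / (2 * M)] w =
    \sum_(k < n.+1) (k.+1%:R <= y)%R%:R :> R.
  apply: eq_bigr => k _; rewrite indicE -/y; case: (leP k.+1%:R y) => h.
    by rewrite mem_set.
  by rewrite memNset//= -/y => h'; move: (lt_le_trans h h'); rewrite ltxx.
have /layercake_count/andP[h1 h2] : 0 <= y <= n.+1%:R.
  move: fM; rewrite ler_norml /y => /andP[a b].
  have p : 0 <= f w + M by lra.
  have q : f w + M <= 2 * M by lra.
  apply/andP; split; first by apply: divr_ge0; [exact: mulr_ge0 p (ltW n0)|lra].
  by rewrite ler_pdivrMr ?mulr_gt0// mulrC ler_pM2l.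
set s := \sum_(k < _) _ in h1 h2 *.
have -> : 2 * M / n.+1%:R * y - M - (2 * M / n.+1%:R * s - M) = 2 * M / n.+1%:R * (y - s) by ring.
by rewrite normrM (gtr0_norm c0) ler_piMr ?(ltW c0)// (ger0_norm h1).
Qed.

Lemma layercake_cvg f M w : 0 < M -> `|f w| <= M ->
  layercake f M n w @[n --> \oo] --> f w.
Proof.
move=> M0 fM; apply/subr_cvg0/norm_cvg0P.
apply: (@squeeze_cvgr _ _ _ _ (cst 0) (fun n => 2 * M * n.+1%:R^-1)).
- apply: nearW => n; rewrite normr_ge0/= distrC; exact: layercake_near.
- exact: cvg_cst.
- by rewrite -(mulr0 (2 * M)); apply: cvgM; [exact: cvg_cst|exact: cvg_harmonic].
Qed.

End BoundedFunctions.

Section SignIteration.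
Variable R : realType.

(** A polynomial map of [[-1, 1]] into itself with attracting fixed points [1] and [-1] and a
    repelling one at [0]: its iterates approximate the sign by algebra operations alone. *)
Definition smooth_step (y : R) : R := (3 / 2) * y - (1 / 2) * y ^+ 3.

Lemma smooth_step_norm_le1 (y : R) : `|y| <= 1 -> `|smooth_step y| <= 1.
Proof.
rewrite !ler_norml /smooth_step => /andP[a b]; apply/andP; split.
  have := mulr_ge0 (sqr_ge0 (y + 1)) (_ : 0 <= 2 - y); nra.
have := mulr_ge0 (sqr_ge0 (y - 1)) (_ : 0 <= 2 + y); nra.
Qed.

Lemma smooth_stepN (y : R) : smooth_step (- y) = - smooth_step y.
Proof. by rewrite /smooth_step; ring. Qed.

Lemma iter_smooth_step_cvg (y : R) : `|y| <= 1 ->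
  iter n smooth_step y @[n --> \oo] --> Num.sg y.
Proof.
wlog y0 : y / 0 <= y.
  move=> H y1; case: (leP 0 y) => [/H|y0]; first exact.
  have iN n : iter n smooth_step y = - iter n smooth_step (- y).
    elim: n => [|n IH]; first by rewrite /= opprK.
    by rewrite !iterS IH smooth_stepN.
  rewrite -[Num.sg y]opprK -sgrN; under eq_fun do rewrite iN.
  by apply: cvgN; apply: H; rewrite ?normrN// oppr_ge0 ltW.
rewrite (ger0_norm y0) => y1; have [->|yn0] := eqVneq y 0.
  rewrite sgr0; have i0 n : iter n smooth_step (0 : R) = 0.
    by elim: n => // n IH; rewrite iterS IH /smooth_step; ring.
  by under eq_fun do rewrite i0; exact: cvg_cst.
have yp : 0 < y by rewrite lt_def yn0.
rewrite gtr0_sg//.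
(* The iterates increase, hence stay above [y], and [1 - smooth_step z = (1 - z) (1 - z / 2 - z^2 /
   2)] shrinks the distance to [1] by at least the factor [1 - y / 2]. *)
have B n : [/\ y <= iter n smooth_step y, iter n smooth_step y <= 1 &
    1 - iter n smooth_step y <= (1 - y / 2) ^+ n].
  elim: n => [|n [h1 h2 h3]].
    by split; rewrite //= expr0 lerBlDr lerDl.
  rewrite iterS; move: h1 h2 h3; set z := iter n _ _ => h1 h2 h3.
  have z0 : 0 <= z by exact: le_trans h1.
  have e1 : smooth_step z - z = z * (1 - z) * (1 + z) / 2 by rewrite /smooth_step; field.
  have e2 : 1 - smooth_step z = (1 - z) * (1 - z / 2 - z ^+ 2 / 2) by rewrite /smooth_step; field.
  have d1 : 0 <= smooth_step z - z by rewrite e1 !mulr_ge0 ?subr_ge0 ?addr_ge0// invr_ge0.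
  split; first lra.
    by have := smooth_step_norm_le1 (_ : `|z| <= 1); rewrite ger0_norm// => /(_ h2); apply: le_trans; exact: ler_norm.
  rewrite e2 [_ ^+ n.+1]exprS mulrC; apply: ler_pM => //; [nra|lra|].
  have := sqr_ge0 z; nra.
apply: (@squeeze_cvgr _ _ _ _ (fun n => 1 - (1 - y / 2) ^+ n) (cst 1)).
- by apply: nearW => n; have [_ h2 h3] := B n; rewrite h2 andbT; lra.
- rewrite -[X in _ --> X]subr0; apply: cvgB; first exact: cvg_cst.
  by apply: cvg_expr; rewrite ger0_norm; lra.
- exact: cvg_cst.
Qed.

End SignIteration.

(** * Trigonometric polynomials in a Gaussian space, and the functions they approximate *)

Section TrigPolynomials.
Context d (T : measurableType d) (R : realType) (P : probability T R).
Implicit Types (f g Z e : T -> R).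
Local Notation E f := (Rintegral P setT f).
Variables (H L : set (T -> R)) (gH : gaussian_space P H).
Hypotheses (LH : L `<=` H) (linL : linspace L) (L0 : L (fun=> 0)).

(** As [L] is linear, the product formula for cosines closes the class under multiplication; sines
    and constants arise from the phase. *)
Inductive tpoly : (T -> R) -> Prop :=
| tpoly_cos Z th : L Z -> tpoly (fun w => cos (Z w + th))
| tpoly_lin a f g : tpoly f -> tpoly g -> tpoly (fun w => a * f w + g w).

Lemma LZ a Z : L Z -> L (fun w => a * Z w).
Proof. by move=> hZ; have := linL a hZ L0; under eq_fun do rewrite addr0. Qed.

Lemma LD Z Z' : L Z -> L Z' -> L (fun w => Z w + Z' w).
Proof. by move=> hZ hZ'; have := linL 1 hZ hZ'; under eq_fun do rewrite mul1r. Qed.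

Lemma Lmeas Z : L Z -> measurable_fun setT Z.
Proof. by move=> /LH /(gspace_sqi gH)[]. Qed.

Lemma tpoly_cst c : tpoly (fun=> c).
Proof.
have h := tpoly_lin (c - 1) (tpoly_cos 0 L0) (tpoly_cos 0 L0).
by move: h; congr tpoly; apply/funext => w; rewrite add0r cos0; ring.
Qed.

Lemma tpolyZ a f : tpoly f -> tpoly (fun w => a * f w).
Proof. by move=> hf; have := tpoly_lin a hf (tpoly_cst 0); under eq_fun do rewrite addr0. Qed.

Lemma tpoly_bdm f : tpoly f -> bdm f.
Proof.
elim=> [Z th hZ|a {}f g _ hf _ hg]; last exact: bdm_lin.
split; last by exists 1 => w; exact: cos_max.
apply: (measurableT_comp (f := cos)); first by apply: continuous_measurable_fun; exact: continuous_cos.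
by apply: measurable_funD => //; exact: Lmeas.
Qed.

Lemma tpoly_mul f g : tpoly f -> tpoly g -> tpoly (fun w => f w * g w).
Proof.
move=> hf hg; elim: hf => [Z th hZ|a f1 f2 _ h1 _ h2]; last first.
  have := tpoly_lin a h1 h2; congr tpoly; apply/funext => w; ring.
elim: hg => [Z' th' hZ'|a g1 g2 _ h1 _ h2]; last first.
  have := tpoly_lin a h1 h2; congr tpoly; apply/funext => w; ring.
have p := tpoly_cos (th + th') (LD hZ hZ').
have q := tpoly_cos (th - th') (LD hZ (LZ (-1) hZ')).
have := tpoly_lin (1 / 2) p (tpolyZ (1 / 2) q); congr tpoly; apply/funext => w.
have -> : Z w + Z' w + (th + th') = (Z w + th) + (Z' w + th') by ring.
have -> : Z w + -1 * Z' w + (th - th') = (Z w + th) - (Z' w + th') by ring.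
by rewrite cosD cosB; field.
Qed.

(* The orthogonal projection of a trigonometric polynomial on [L], as seen by
   the Gaussian space: Stein's formula makes it explicit. *)
Lemma tpoly_proj f : tpoly f ->
  exists2 Z, L Z & forall e, H e -> E (fun w => e w * f w) = E (fun w => e w * Z w).
Proof.
elim=> [Z th hZ|a {}f g hf [Zf Lf Ef] hg [Zg Lg Eg]].
  exists (fun w => - E (fun w => sin (Z w + th)) * Z w); first exact: LZ.
  move=> e he; rewrite (gspace_stein gH)//; last exact: LH.
  have i := sqi_mul measurableT (gspace_sqi gH he) (gspace_sqi gH (LH hZ)).
  rewrite mulNr mulrC -mulNr -(RintegralZl _ measurableT i).
  by apply: eq_Rintegral => w _; ring.
exists (fun w => a * Zf w + Zg w); first exact: linL.
move=> e he; have se := gspace_sqi gH he.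
have C u v : E (fun w => u w * v w) = E (fun w => v w * u w).
  by apply: eq_Rintegral => w _; rewrite mulrC.
have sf := bdm_sqi P (tpoly_bdm hf); have sg := bdm_sqi P (tpoly_bdm hg).
have tf := gspace_sqi gH (LH Lf); have tg := gspace_sqi gH (LH Lg).
by rewrite [LHS]C [RHS]C !E_mul_linl// -!(C e) Ef// Eg.
Qed.

(** The pairing with [e] sees only the projection [Z] of [f], and [E Z^2 = E (Z f)] makes [Z] no
    longer than [f] by Cauchy-Schwarz. *)
Lemma tpoly_near_orthogonal e de f : H e -> 0 <= de ->
  (forall Z, L Z -> E (fun w => e w * Z w) ^+ 2 <= de * E (fun w => Z w ^+ 2)) ->
  tpoly f -> E (fun w => e w * f w) ^+ 2 <= de * E (fun w => f w ^+ 2).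
Proof.
move=> he de0 hde hf; have [Z LZ EZ] := tpoly_proj hf.
rewrite EZ//; apply: (le_trans (hde _ LZ)); rewrite ler_wpM2l//.
have sf := bdm_sqi P (tpoly_bdm hf); have sZ := gspace_sqi gH (LH LZ).
have := E_Cauchy measurableT sZ sf; rewrite EZ; last exact: LH.
have -> : E (fun w => Z w * Z w) = E (fun w => Z w ^+ 2).
  by apply: eq_Rintegral => w _; rewrite expr2.
set a := E _; set b := E _ => h.
have a0 : 0 <= a by exact: E_sqr_ge0.
have b0 : 0 <= b by exact: E_sqr_ge0.
have [->//|an0] := eqVneq a 0.
by rewrite -(@ler_pM2l _ a) ?lt_def ?an0// -expr2.
Qed.

End TrigPolynomials.

Section TrigClosure.
Context d (T : measurableType d) (R : realType) (P : probability T R).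
Implicit Types (f g Z e : T -> R).
Local Notation E f := (Rintegral P setT f).
Variables (H L : set (T -> R)) (gH : gaussian_space P H).
Hypotheses (LH : L `<=` H) (linL : linspace L) (L0 : L (fun=> 0)).
Local Notation tp := (tpoly L).
Local Notation dist2 f g := (E (fun w => (f w - g w) ^+ 2)).

Let tbd f : tp f -> bdm f. Proof. exact: (tpoly_bdm gH LH). Qed.

Let sqi_dist f g : sqi P setT f -> sqi P setT g ->
  P.-integrable setT (EFin \o (fun w => (f w - g w) ^+ 2)).
Proof.
move=> hf hg; have [_] := sqi_lin measurableT (-1) hg hf.
by apply: eq_integrable => // w _ /=; congr EFin; ring.
Qed.

(* Multiplying by a trigonometric polynomial keeps [f] in the L2-closure of the
   trigonometric polynomials; this makes the class an algebra. *)
Definition tclos f := bdm f /\ forall t, tp t -> forall eta, 0 < eta ->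
  exists2 g, tp g & E (fun w => (f w * t w - g w) ^+ 2) <= eta.

Lemma tclos_tpoly f : tp f -> tclos f.
Proof.
move=> hf; split; first exact: tbd.
move=> t ht eta eta0; exists (fun w => f w * t w); first exact: tpoly_mul.
rewrite (@eq_Rintegral _ _ _ P setT (fun=> 0)) ?Rintegral_prob_cst ?ltW//.
by move=> w _; rewrite subrr expr0n.
Qed.

Lemma tclos_lin a f g : tclos f -> tclos g -> tclos (fun w => a * f w + g w).
Proof.
move=> [bf hf] [bg hg]; split; first exact: bdm_lin.
move=> t ht eta eta0; have bt := tbd ht.
have a0 : 0 < 4 * (a ^+ 2 + 1) by have := sqr_ge0 a; lra.
have [f' tf' hf'] := hf t ht (eta / (4 * (a ^+ 2 + 1))) (divr_gt0 eta0 a0).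
have [g' tg' hg'] := hg t ht (eta / 4) (divr_gt0 eta0 (ltr0n _ 4)).
exists (fun w => a * f' w + g' w); first exact: tpoly_lin.
have b1 : bdm (fun w => f w * t w) by exact: bdm_mul.
have b2 : bdm (fun w => g w * t w) by exact: bdm_mul.
have bf' := tbd tf'; have bg' := tbd tg'.
have s1 : sqi P setT (fun w => a * (f w * t w) + g w * t w) by apply: bdm_sqi; exact: bdm_lin.
have s2 : sqi P setT (fun w => a * f' w + g w * t w) by apply: bdm_sqi; exact: bdm_lin.
have s3 : sqi P setT (fun w => a * f' w + g' w) by apply: bdm_sqi; exact: bdm_lin.
rewrite (@eq_Rintegral _ _ _ P setT (fun w => (a * (f w * t w) + g w * t w - (a * f' w + g' w)) ^+ 2)); last first.
  by move=> w _; ring.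
apply: (le_trans (E_sqr_split s1 s2 s3)).
rewrite (@eq_Rintegral _ _ _ P setT (fun w => a ^+ 2 * (f w * t w - f' w) ^+ 2)); last first.
  by move=> w _; ring.
rewrite RintegralZl//; last by apply: sqi_dist; exact: bdm_sqi.
rewrite [X in _ + 2 * X](@eq_Rintegral _ _ _ P setT (fun w => (g w * t w - g' w) ^+ 2)); last first.
  by move=> w _; ring.
have h : a ^+ 2 * E (fun w => (f w * t w - f' w) ^+ 2) <= eta / 4.
  apply: (@le_trans _ _ (a ^+ 2 * (eta / (4 * (a ^+ 2 + 1))))).
    by rewrite ler_wpM2l ?sqr_ge0.
  rewrite mulrA ler_pdivrMr//.
  have -> : eta / 4 * (4 * (a ^+ 2 + 1)) = eta * (a ^+ 2 + 1) by field.
  by rewrite mulrC ler_pM2l// lerDl ler01.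
lra.
Qed.

(** Approximation in two stages: [g t] by a trigonometric polynomial [g'], which costs the squared
    bound [M ^ 2] of [f], then [f g'], with [g'] in the role of the multiplier. *)
Lemma tclosM f g : tclos f -> tclos g -> tclos (fun w => f w * g w).
Proof.
move=> [bf hf] [bg hg]; split; first exact: bdm_mul.
move=> t ht eta eta0; have bt := tbd ht; have [mf [M fM]] := bf.
have a0 : 0 < 4 * (M ^+ 2 + 1) by have := sqr_ge0 M; lra.
have [g' tg' hg'] := hg t ht (eta / (4 * (M ^+ 2 + 1))) (divr_gt0 eta0 a0).
have [f' tf' hf'] := hf g' tg' (eta / 4) (divr_gt0 eta0 (ltr0n _ 4)).
exists f' => //; have bf' := tbd tf'; have bg' := tbd tg'.
have s1 : sqi P setT (fun w => f w * g w * t w) by apply: bdm_sqi; do 2 apply: bdm_mul => //.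
have s2 : sqi P setT (fun w => f w * g' w) by apply: bdm_sqi; exact: bdm_mul.
have s3 : sqi P setT f' by exact: bdm_sqi.
have s4 : sqi P setT (fun w => g w * t w) by apply: bdm_sqi; exact: bdm_mul.
apply: (le_trans (E_sqr_split s1 s2 s3)).
have h : E (fun w => (f w * g w * t w - f w * g' w) ^+ 2) <= eta / 4.
  apply: (@le_trans _ _ (E (fun w => M ^+ 2 * (g w * t w - g' w) ^+ 2))).
    apply: le_Rintegral => //; first exact: sqi_dist.
      by apply: intgZ => //; apply: sqi_dist => //; exact: bdm_sqi.
    move=> w _; have -> : f w * g w * t w - f w * g' w = f w * (g w * t w - g' w) by ring.
    rewrite exprMn ler_wpM2r ?sqr_ge0// -(real_normK (num_real (f w))).
    by rewrite ler_sqr ?nnegrE// (le_trans _ (fM w)).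
  rewrite RintegralZl//; last by apply: sqi_dist => //; exact: bdm_sqi.
  apply: (@le_trans _ _ (M ^+ 2 * (eta / (4 * (M ^+ 2 + 1))))).
    by rewrite ler_wpM2l ?sqr_ge0.
  rewrite mulrA ler_pdivrMr//.
  have -> : eta / 4 * (4 * (M ^+ 2 + 1)) = eta * (M ^+ 2 + 1) by field.
  by rewrite mulrC ler_pM2l// lerDl ler01.
lra.
Qed.

Lemma tclos_cvg (F : nat -> T -> R) f M :
  (forall n, tclos (F n)) -> (forall n w, `|F n w| <= M) ->
  (forall w, F ^~ w @ \oo --> f w) -> tclos f.
Proof.
move=> hF FM Ff.
have mF n : measurable_fun setT (F n) by have [[]] := hF n.
have [bf _] := bounded_cvg_sqr P mF FM Ff; split => // t ht eta eta0.
have bt := tbd ht; have [mt [N tN]] := bt.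
have [_ c] := @bounded_cvg_sqr _ _ _ P (fun n w => F n w * t w) (fun w => f w * t w) (M * N)
  (fun n => measurable_funM (mF n) mt)
  (fun n w => ltac:(rewrite normrM; exact: ler_pM))
  (fun w => ltac:(apply: cvgM; [exact: Ff|exact: cvg_cst])).
have /cvgrPdist_lt/(_ (eta / 4) (divr_gt0 eta0 (ltr0n _ 4)))[n _ /(_ n (leqnn n))] := c.
rewrite /= sub0r normrN ger0_norm ?E_sqr_ge0// => hn.
have [g tg hg] := (hF n).2 t ht (eta / 4) (divr_gt0 eta0 (ltr0n _ 4)).
exists g => //; have bFn := (hF n).1.
have s1 : sqi P setT (fun w => f w * t w) by apply: bdm_sqi; exact: bdm_mul.
have s2 : sqi P setT (fun w => F n w * t w) by apply: bdm_sqi; exact: bdm_mul.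
have s3 : sqi P setT g by apply: bdm_sqi; exact: tbd.
apply: (le_trans (E_sqr_split s1 s2 s3)); lra.
Qed.

Lemma tclos_cst c : tclos (fun=> c).
Proof. by apply: tclos_tpoly; exact: tpoly_cst. Qed.

Lemma tclosZ a f : tclos f -> tclos (fun w => a * f w).
Proof. by move=> hf; have := tclos_lin a hf (tclos_cst 0); under eq_fun do rewrite addr0. Qed.

Lemma tclosD f g : tclos f -> tclos g -> tclos (fun w => f w + g w).
Proof. by move=> hf hg; have := tclos_lin 1 hf hg; under eq_fun do rewrite mul1r. Qed.

Lemma tclos_sg f : tclos f -> tclos (fun w => Num.sg (f w)).
Proof.
move=> hf; have [_ [M fM]] := hf.1.
(* Scaling into [[-1, 1]], where the iteration is stable, leaves the sign unchanged. *)
pose f1 w := (`|M| + 1)^-1 * f w.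
have M1 : 0 < `|M| + 1 by rewrite ltr_wpDl.
have f11 w : `|f1 w| <= 1.
  rewrite normrM gtr0_norm ?invr_gt0// -ler_pdivlMl ?invr_gt0// invrK mulr1.
  by rewrite (le_trans (fM w))// (le_trans (ler_norm M))// lerDl.
pose F n w := iter n (@smooth_step R) (f1 w).
have F1 n w : `|F n w| <= 1.
  by elim: n => [|n IH]; [exact: f11|rewrite /F iterS; exact: smooth_step_norm_le1].
apply: (tclos_cvg (F := F) (M := 1)) => //.
  elim=> [|n IH]; first exact: tclosZ.
  have h3 := tclosM IH (tclosM IH IH).
  have := tclos_lin (3 / 2) IH (tclosZ (- (1 / 2)) h3).
  congr tclos; apply/funext => w; rewrite /F iterS /smooth_step !exprS expr0; ring.
move=> w; have := iter_smooth_step_cvg (f11 w).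
by rewrite /f1 sgrM gtr0_sg ?invr_gt0// mul1r.
Qed.

Lemma tclos_pos f : tclos f -> tclos (\1_[set w | 0 < f w]).
Proof.
move=> /tclos_sg h; have := tclosZ (1 / 2) (tclosD (tclosM h h) h).
congr tclos; apply/funext => w; rewrite indicE.
case: (ltgtP 0 (f w)) => [fw|fw|fw].
- by rewrite mem_set// gtr0_sg//=; field.
- by rewrite memNset/= ?ltr0_sg//; [ring|rewrite ltNge ltW].
- by rewrite memNset/= -?fw ?sgr0 ?ltxx//; ring.
Qed.

Definition tclos_sets : set (set T) := [set A | tclos (\1_A)].

Lemma tclos_sets_sigma : sigma_algebra setT tclos_sets.
Proof.
have C A : tclos_sets A -> tclos_sets (~` A).
  rewrite /tclos_sets/= => h; have := tclos_lin (-1) h (tclos_cst 1).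
  by congr tclos; apply/funext => w; rewrite !indicE in_setC; case: (w \in A) => /=; ring.
split.
- by rewrite /tclos_sets/= indic0; exact: tclos_cst.
- by move=> A hA; rewrite setTD; exact: C.
- move=> F hF.
  pose G n : set T := \big[setI/setT]_(k < n) ~` (F k).
  have GP n : G n = \bigcap_(k < n) ~` (F k) by rewrite bigcap_mkord.
  have GE n : tclos_sets (G n).
    elim: n => [|n IH].
      by rewrite /G big_ord0 /tclos_sets/= indicT; exact: tclos_cst.
    rewrite /G big_ord_recr/= -/(G n) /tclos_sets/= indicI.
    exact: tclosM IH (C _ (hF n)).
  apply: (tclos_cvg (F := fun n => \1_(~` G n)) (M := 1)).
  + by move=> n; exact: C.
  + by move=> n w; rewrite indicE; case: (_ \in _); rewrite ?normr1 ?normr0.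
  + move=> w; case: (pselect ((\bigcup_k F k) w)) => [[k _ Fk]|nF].
      rewrite [X in _ --> X](_ : _ = 1); last by rewrite indicE mem_set//; exists k.
      apply: cvg_near_cst; exists k.+1 => //= n kn.
      by rewrite indicE mem_set// GP => h; exact: (h k kn).
    rewrite [X in _ --> X](_ : _ = 0); last by rewrite indicE memNset.
    apply: cvg_near_cst; apply: nearW => n.
    rewrite indicE memNset// GP => h; apply: h => k _ Fk; apply: nF; by exists k.
Qed.

(** The sets [Z > c] suffice. As [Z] is unbounded, the sign of [Z - c] is read off the trigonometric
    polynomial [sin ((Z - c) / (n + 1))], correctly once the argument is below [pi] in absolute
    value. *)
Lemma tclos_sets_preimage Z (B : set R) : L Z -> measurable B -> tclos_sets (Z @^-1` B).
Proof.
move=> hZ mB.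
pose F c n w := \1_[set w | 0 < sin ((Z w - c) / n.+1%:R)] w : R.
have F1 c n w : `|F c n w| <= 1.
  by rewrite /F indicE; case: (_ \in _); rewrite ?normr1 ?normr0.
have gt c : tclos_sets (Z @^-1` `]c, +oo[).
  apply: (tclos_cvg (F := F c) (M := 1)) => //.
  - move=> n; apply: tclos_pos; apply: tclos_tpoly.
    have := tpoly_cos (- c / n.+1%:R - pi / 2) (LZ linL L0 n.+1%:R^-1 hZ).
    by congr tpoly; apply/funext => w; rewrite addrA cosBpihalf; congr sin; ring.
  - move=> w; apply: cvg_near_cst.
    near=> n.
    have n0 : 0 < n.+1%:R :> R by rewrite ltr0n.
    have hn : `|(Z w - c) / n.+1%:R| < pi.
      rewrite normrM normfV (gtr0_norm n0) ltr_pdivrMr//.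
      rewrite mulrC -ltr_pdivrMr ?pi_gt0//.
      near: n; apply: filterS (nbhs_infty_gtr (`|Z w - c| / pi)) => n hn.
      by rewrite (lt_trans hn)// ltr_nat.
    set y := (Z w - c) / _ in hn.
    have yE : (c < Z w) = (0 < y) by rewrite /y pmulr_lgt0 ?invr_gt0// subr_gt0.
    have -> : \1_(Z @^-1` `]c, +oo[) w = (0 < y)%R%:R :> R.
      rewrite -yE indicE; case: (ltP c (Z w)) => h.
        by rewrite mem_set//= in_itv/= h.
      by rewrite memNset//= in_itv/= andbT; move/(le_lt_trans h); rewrite ltxx.
    rewrite /F indicE -/y; case: (ltgtP 0 y) => h.
    + by rewrite mem_set//= -/y sin_gt0_pi// h/= (le_lt_trans (ler_norm _) hn).
    + rewrite memNset//= -/y => h'.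
      have := sin_gt0_pi (_ : 0 < - y < pi); rewrite sinN oppr_gt0.
      rewrite h/= (le_lt_trans (ler_norm _))// ?normrN// => /(_ isT).
      by rewrite oppr_gt0 => /(lt_trans h'); rewrite ltxx.
    + by rewrite memNset//= -/y -h sin0 ltxx.
pose T' := g_sigma_algebraType tclos_sets.
have mZ : measurable_fun setT (Z : T' -> R).
  apply: (measurability _ (RGenOInfty.measurableE R)) => _ [_ [c ->] <-].
  by rewrite setTI; apply: sub_sigma_algebra; exact: gt.
have := mZ measurableT B mB; rewrite setTI.
by apply: smallest_sub => //; exact: tclos_sets_sigma.
Unshelve. all: end_near. Qed.

End TrigClosure.

Section L2Convergence.
Context d (T : measurableType d) (R : realType) (P : probability T R).
Implicit Types (f g e : T -> R).
Local Notation E f := (Rintegral P setT f).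

Lemma cvg_sqr0 (x : nat -> R) : x n ^+ 2 @[n --> \oo] --> 0 -> x @ \oo --> 0.
Proof.
move=> h; apply/norm_cvg0P.
have h2 : Num.sqrt (x n ^+ 2) @[n --> \oo] --> Num.sqrt (0 : R).
  by apply: (@continuous_cvg _ _ _ _ _ _ (@Num.sqrt R)) => //; exact: sqrt_continuous.
by rewrite sqrtr0 in h2; under eq_fun do rewrite -sqrtr_sqr.
Qed.

Lemma L2cvg_mul e f (g : nat -> T -> R) : sqi P setT e -> sqi P setT f ->
  (forall n, sqi P setT (g n)) ->
  E (fun w => (g n w - f w) ^+ 2) @[n --> \oo] --> 0 ->
  E (fun w => e w * g n w) @[n --> \oo] --> E (fun w => e w * f w).
Proof.
move=> se sf sg h; apply/subr_cvg0; apply: cvg_sqr0.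
apply: (@squeeze_cvgr _ _ _ _ (cst 0) (fun n => E (fun w => e w ^+ 2) * E (fun w => (g n w - f w) ^+ 2))).
- apply: nearW => n; rewrite sqr_ge0/=.
  have s1 : sqi P setT (fun w => g n w - f w).
    have [m i] := sqi_lin measurableT (-1) sf (sg n).
    have e1 : (fun w => -1 * f w + g n w) = (fun w => g n w - f w) by apply/funext => w; ring.
    by rewrite e1 in m; split => //; apply: eq_integrable i => // w _ /=; congr EFin; ring.
  rewrite -RintegralB//; [|exact: sqi_mul..].
  rewrite (@eq_Rintegral _ _ _ P setT (fun w => e w * (g n w - f w))); first exact: E_Cauchy.
  by move=> w _; ring.
- exact: cvg_cst.
- by rewrite -(mulr0 (E (fun w => e w ^+ 2))); apply: cvgM => //; exact: cvg_cst.
Qed.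

Lemma L2cvg_sqr f (g : nat -> T -> R) : sqi P setT f ->
  (forall n, sqi P setT (g n)) ->
  E (fun w => (g n w - f w) ^+ 2) @[n --> \oo] --> 0 ->
  E (fun w => g n w ^+ 2) @[n --> \oo] --> E (fun w => f w ^+ 2).
Proof.
move=> sf sg h; have h2 := L2cvg_mul sf sf sg h.
have EE n : E (fun w => g n w ^+ 2) = E (fun w => (g n w - f w) ^+ 2) +
    2 * E (fun w => f w * g n w) - E (fun w => f w ^+ 2).
  have := E_sqr_lin measurableT (-1) sf (sg n).
  have -> : E (fun w => (-1 * f w + g n w) ^+ 2) = E (fun w => (g n w - f w) ^+ 2).
    by apply: eq_Rintegral => w _; ring.
  by move=> ->; ring.
have h3 : E (fun w => (g n w - f w) ^+ 2) + 2 * E (fun w => f w * g n w) -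
    E (fun w => f w ^+ 2) @[n --> \oo] -->
    0 + 2 * E (fun w => f w * f w) - E (fun w => f w ^+ 2).
  apply: cvgB; last exact: cvg_cst.
  by apply: cvgD => //; apply: cvgM => //; exact: cvg_cst.
have e1 : 0 + 2 * E (fun w => f w * f w) - E (fun w => f w ^+ 2) = E (fun w => f w ^+ 2).
  have -> : E (fun w => f w * f w) = E (fun w => f w ^+ 2).
    by apply: eq_Rintegral => w _; rewrite expr2.
  by ring.
rewrite e1 in h3; apply: cvg_trans h3; apply: near_eq_cvg; apply: nearW => n.
by rewrite EE.
Qed.

End L2Convergence.

Section GaussianProjection.
Context d (T : measurableType d) (R : realType) (P : probability T R).
Implicit Types (f g Z e : T -> R).
Local Notation E f := (Rintegral P setT f).
Variables (H L : set (T -> R)) (gH : gaussian_space P H).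
Hypotheses (LH : L `<=` H) (linL : linspace L) (L0 : L (fun=> 0)).
Variable F : set (set T).
Hypotheses (sF : sigma_algebra setT F) (Fm : F `<=` measurable).
(** This places [F] inside the sigma-algebra generated by [L], in the form of an induction
    principle. *)
Hypothesis FL : forall S : set (set T), sigma_algebra setT S ->
  (forall Z (B : set R), L Z -> measurable B -> S (Z @^-1` B)) -> F `<=` S.

Definition smeas (G : set (set T)) f :=
  forall B : set R, measurable B -> G (f @^-1` B).

Lemma smeas_mfun f : smeas F f <->
  measurable_fun [set: g_sigma_algebraType F] (f : g_sigma_algebraType F -> R).
Proof.
split=> [hf _ B mB|hf B mB].
  by rewrite setTI; apply: sub_sigma_algebra; exact: hf.
have := hf measurableT B mB; rewrite setTI.
by apply: smallest_sub.
Qed.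

Lemma smeas_meas f : smeas F f -> measurable_fun setT f.
Proof. by move=> hf _ B mB; rewrite setTI; apply: Fm; exact: hf. Qed.

Hypothesis LF : forall Z, L Z -> smeas F Z.

(** By [FL] the indicators of all sets of [F] lie in [tclos], hence so do the layer-cake sums of
    [f], which stay bounded and converge to it. *)
Lemma smeas_tclos f M : smeas F f -> (forall w, `|f w| <= M) -> tclos P L f.
Proof.
move=> hf fM0; pose N := `|M| + 1.
have N0 : 0 < N by rewrite ltr_wpDl.
have fM w : `|f w| <= N.
  by rewrite (le_trans (fM0 w))// (le_trans (ler_norm M))// lerDl.
apply: (tclos_cvg gH LH (F := layercake f N) (M := 3 * N)).
- move=> n; rewrite /layercake.
  pose A k := [set w | (k : nat).+1%:R <= (f w + N) * n.+1%:R / (2 * N)].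
  have FA k : F (A k).
    have -> : A k = f @^-1` `[(k.+1%:R * (2 * N) / n.+1%:R - N), +oo[%classic.
      apply/seteqP; split => w; rewrite /A/= in_itv/= andbT lerBlDr ler_pdivrMr ?ltr0n//.
        by rewrite ler_pdivlMr ?mulr_gt0.
      by rewrite ler_pdivlMr ?mulr_gt0.
    exact: hf.
  have hA k : tclos P L (\1_(A k)).
    have := FL (tclos_sets_sigma gH LH linL L0) _ (FA k); apply.
    by move=> Z B hZ mB; exact: (tclos_sets_preimage gH LH linL L0 hZ mB).
  have hS m : tclos P L (fun w => \sum_(k < m) \1_(A k) w).
    elim: m => [|m IH].
      have := tclos_cst gH LH linL L0 0; congr tclos; apply/funext => w.
      by rewrite big_ord0.
    have := tclosD gH LH IH (hA m); congr tclos; apply/funext => w.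
    by rewrite big_ord_recr.
  have := tclos_lin gH LH (2 * N / n.+1%:R) (hS n.+1) (tclos_cst gH LH linL L0 (- N)).
  by [].
- move=> n w; have := layercake_near n N0 (fM w).
  have : 2 * N / n.+1%:R <= 2 * N.
    by rewrite ler_pdivrMr ?ltr0n// ler_peMr ?ler1n// mulr_ge0// ltW.
  have := fM w => h1 h2 h3; rewrite -[layercake f N n w](subKr (f w)).
  apply: (le_trans (ler_normB _ _)); apply: (le_trans (lerD h1 (le_trans h3 h2))); lra.
- by move=> w; exact: layercake_cvg.
Qed.

Lemma smeas_near_orthogonal e de f M : H e -> 0 <= de ->
  (forall Z, L Z -> E (fun w => e w * Z w) ^+ 2 <= de * E (fun w => Z w ^+ 2)) ->
  smeas F f -> (forall w, `|f w| <= M) ->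
  E (fun w => e w * f w) ^+ 2 <= de * E (fun w => f w ^+ 2).
Proof.
move=> he de0 hde hf fM; have [bf cf] := smeas_tclos hf fM.
have ex n : exists g, tpoly L g /\ E (fun w => (g w - f w) ^+ 2) <= n.+1%:R^-1.
  have p : 0 < n.+1%:R^-1 :> R by rewrite invr_gt0 ltr0n.
  have [g tg hg] := cf _ (tpoly_cst L0 1) _ p; exists g; split => //.
  apply: le_trans hg; rewrite le_eqVlt; apply/orP; left; apply/eqP.
  by apply: eq_Rintegral => w _; ring.
pose g n := projT1 (cid (ex n)).
have tg n : tpoly L (g n) by have [] := projT2 (cid (ex n)).
have hg n : E (fun w => (g n w - f w) ^+ 2) <= n.+1%:R^-1 by have [] := projT2 (cid (ex n)).
have c : E (fun w => (g n w - f w) ^+ 2) @[n --> \oo] --> 0.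
  apply: (@squeeze_cvgr _ _ _ _ (cst 0) (fun n => n.+1%:R^-1)).
  - by apply: nearW => n; rewrite E_sqr_ge0/=.
  - exact: cvg_cst.
  - exact: cvg_harmonic.
have sf := bdm_sqi P bf; have se := gspace_sqi gH he.
have sg n : sqi P setT (g n) by apply: bdm_sqi; exact: (tpoly_bdm gH LH).
have c1 := L2cvg_mul se sf sg c; have c2 := L2cvg_sqr sf sg c.
have c3 : E (fun w => e w * g n w) ^+ 2 @[n --> \oo] --> E (fun w => e w * f w) ^+ 2.
  by under eq_fun do rewrite expr2; rewrite expr2; exact: cvgM.
have c4 : de * E (fun w => g n w ^+ 2) @[n --> \oo] --> de * E (fun w => f w ^+ 2).
  by apply: cvgM => //; exact: cvg_cst.
rewrite -(cvg_lim _ c3)// -(cvg_lim _ c4)//; apply: ler_lim.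
- by apply/cvg_ex; eexists; exact: c3.
- by apply/cvg_ex; eexists; exact: c4.
- apply: nearW => n; exact: (tpoly_near_orthogonal gH LH linL L0 he de0 hde (tg n)).
Qed.

(** The defining property over sets of [F] extends to bounded multipliers through layer-cake sums;
    integrability of [xi] and [eta] is enough for domination. *)
Lemma cond_exp_bounded (xi eta phi : T -> R) M :
  P.-integrable setT (EFin \o xi) -> is_cond_exp P F xi eta ->
  smeas F phi -> (forall w, `|phi w| <= M) ->
  E (fun w => eta w * phi w) = E (fun w => xi w * phi w).
Proof.
move=> ixi [Feta ieta heta] hphi phiM0; pose N := `|M| + 1.
have N0 : 0 < N by rewrite ltr_wpDl.
have phiM w : `|phi w| <= N.
  by rewrite (le_trans (phiM0 w))// (le_trans (ler_norm M))// lerDl.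
pose A n k := [set w | (k : nat).+1%:R <= (phi w + N) * n.+1%:R / (2 * N)].
have FA n k : F (A n k).
  have -> : A n k = phi @^-1` `[(k.+1%:R * (2 * N) / n.+1%:R - N), +oo[%classic.
    apply/seteqP; split => w; rewrite /A/= in_itv/= andbT lerBlDr ler_pdivrMr ?ltr0n//.
      by rewrite ler_pdivlMr ?mulr_gt0.
    by rewrite ler_pdivlMr ?mulr_gt0.
  exact: hphi.
have mA n k : measurable (A n k) by apply: Fm.
have i1 f B : P.-integrable setT (EFin \o f) -> measurable B ->
    P.-integrable setT (EFin \o (fun w => f w * \1_B w)).
  move=> hf mB; apply: intg_le (intg_norm measurableT hf) => //.
    by apply: measurable_funM => //; exact: intg_meas hf.
  by move=> w _; rewrite normrM ler_piMr// indicE; case: (_ \in _); rewrite ?normr1 ?normr0.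
have EA f B : measurable B -> Rintegral P B f = E (fun w => f w * \1_B w).
  move=> mB; rewrite Rintegral_mkcond; apply: eq_Rintegral => w _.
  by rewrite patchE indicE; case: (_ \in _); rewrite ?mulr1 ?mulr0.
have e1 n k : E (fun w => eta w * \1_(A n k) w) = E (fun w => xi w * \1_(A n k) w).
  by rewrite -!EA// /Rintegral heta.
have El f n : P.-integrable setT (EFin \o f) ->
   E (fun w => f w * layercake phi N n w) =
   2 * N / n.+1%:R * \sum_(k < n.+1) E (fun w => f w * \1_(A n k) w) - N * E f.
  move=> hf; rewrite -Rintegral_sum//; last by move=> k; exact: i1.
  have iS : P.-integrable setT (EFin \o (fun w => \sum_(k < n.+1) f w * \1_(A n k) w)).
    by apply: intg_sum => // k; exact: i1.
  rewrite -!RintegralZl// -RintegralB//; [|exact: intgZ..].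
  apply: eq_Rintegral => w _; rewrite /layercake -mulr_sumr -/(A n _); ring.
have cl f : P.-integrable setT (EFin \o f) ->
    E (fun w => f w * layercake phi N n w) @[n --> \oo] --> E (fun w => f w * phi w).
  move=> hf; apply: (@dominated_Rintegral _ _ _ P setT measurableT _ _ (fun w => 3 * N * `|f w|)).
  - move=> n; apply: measurable_funM; first exact: intg_meas hf.
    apply: measurable_funB => //; apply: measurable_funM => //.
    by apply: measurable_sum => k; apply: measurable_indic; exact: mA.
  - by apply: intgZ => //; exact: intg_norm.
  - by move=> w _; apply: cvgM; [exact: cvg_cst|exact: layercake_cvg].
  - move=> n w _; rewrite normrM mulrC ler_wpM2r//.
    have := layercake_near n N0 (phiM w).
    have : 2 * N / n.+1%:R <= 2 * N.
      by rewrite ler_pdivrMr ?ltr0n// ler_peMr ?ler1n// mulr_ge0// ltW.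
    have := phiM w => h1 h2 h3; rewrite -[layercake phi N n w](subKr (phi w)).
    apply: (le_trans (ler_normB _ _)); apply: (le_trans (lerD h1 (le_trans h3 h2))); lra.
have e2 : E eta = E xi.
  by rewrite /Rintegral heta//; have [h1 h2 _] := sF; rewrite -(setD0 setT); exact: h2.
have c1 := cl _ ieta; have c2 := cl _ ixi.
have e3 n : E (fun w => eta w * layercake phi N n w) = E (fun w => xi w * layercake phi N n w).
  by rewrite !El// e2; congr (_ * _ - _); apply: eq_bigr => k _; exact: e1.
have c3 : E (fun w => eta w * layercake phi N n w) @[n --> \oo] --> E (fun w => xi w * phi w).
  by apply: cvg_trans c2; apply: near_eq_cvg; apply: nearW => n; rewrite e3.
by have := cvg_unique _ c1 c3; apply.
Qed.

End GaussianProjection.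

Section ProjectionTheorem.
Context d (T : measurableType d) (R : realType) (P : probability T R).
Implicit Types (f g Z e : T -> R).
Local Notation E f := (Rintegral P setT f).
Variables (H L : set (T -> R)) (gH : gaussian_space P H).
Hypotheses (LH : L `<=` H) (linL : linspace L) (L0 : L (fun=> 0)).
Variable F : set (set T).
Hypotheses (sF : sigma_algebra setT F) (Fm : F `<=` measurable).
Hypothesis FL : forall S : set (set T), sigma_algebra setT S ->
  (forall Z (B : set R), L Z -> measurable B -> S (Z @^-1` B)) -> F `<=` S.
Hypothesis LF : forall Z, L Z -> smeas F Z.

(** As [eta] is only known to be integrable, the residual [g = eta - Z] is truncated at level
    [n + 1]. Each truncation is an admissible test variable with [phi^2 <= g phi], so
    near-orthogonality yields [E phi^2 <= de], and Fatou removes the truncation. *)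
Lemma cond_exp_close xi eta Z de : H xi -> is_cond_exp P F xi eta -> L Z -> 0 <= de ->
  (forall Z', L Z' -> E (fun w => (xi w - Z w) * Z' w) ^+ 2 <= de * E (fun w => Z' w ^+ 2)) ->
  sqi P setT (fun w => eta w - Z w) /\ E (fun w => (eta w - Z w) ^+ 2) <= de.
Proof.
move=> hxi hce hZ de0 hde; have [Feta ieta heta] := hce.
have [_ linH] := gH.
have sZ := gspace_sqi gH (LH hZ); have sxi := gspace_sqi gH hxi.
have ixi : P.-integrable setT (EFin \o xi) by exact: sqi_intg.
have iZ : P.-integrable setT (EFin \o Z) by exact: sqi_intg.
have he : H (fun w => xi w - Z w).
  have := linH (-1) _ _ (LH hZ) hxi; congr H; apply/funext => w; ring.
pose g w := eta w - Z w.
pose phi n w := Order.max (- n.+1%:R) (Order.min (g w) n.+1%:R).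
have Fg : smeas F g.
  apply/(smeas_mfun sF); apply: measurable_funB; apply/(smeas_mfun sF) => //; last exact: LF.
  by move=> B mB; have := Feta (eta @^-1` B); apply; exists B => //; rewrite setTI.
have Fphi n : smeas F (phi n).
  apply/(smeas_mfun sF); apply: measurable_maxr => //; apply: measurable_minr => //.
  exact/(smeas_mfun sF).
have n0 n : 0 < n.+1%:R :> R by rewrite ltr0n.
have phiM n w : `|phi n w| <= n.+1%:R.
  rewrite ler_norml /phi le_max lexx/= ge_max ge_min lexx orbT andbT.
  by rewrite (le_trans _ (ltW (n0 n)))// oppr_le0 ltW.
have mphi n := smeas_meas Fm (Fphi n).
have iphi n f : P.-integrable setT (EFin \o f) -> P.-integrable setT (EFin \o (fun w => f w * phi n w)).
  move=> hf; apply: (intg_le measurableT (g := fun w => n.+1%:R * `|f w|)).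
  - by apply: measurable_funM => //; exact: intg_meas hf.
  - by move=> w _; rewrite normrM mulrC ler_wpM2r.
  - by apply: intgZ => //; exact: intg_norm.
have sphi n : sqi P setT (phi n) by apply: bdm_sqi; split => //; exists n.+1%:R.
have phig n w : phi n w ^+ 2 <= g w * phi n w.
  have := n0 n; rewrite /phi; move: (g w) (n.+1%:R : R) => x M M0.
  by case: (leP x M) => h1; case: (leP (- M) _) => h2; nra.
have Ephi n : E (fun w => phi n w ^+ 2) <= de.
  set a := E _; have a0 : 0 <= a by exact: E_sqr_ge0.
  have h1 : a <= E (fun w => (xi w - Z w) * phi n w).
    apply: (@le_trans _ _ (E (fun w => g w * phi n w))).
      by apply: le_Rintegral => //; [case: (sphi n)|apply: iphi; exact: intgB].
    have e1 : E (fun w => g w * phi n w) = E (fun w => eta w * phi n w) - E (fun w => Z w * phi n w).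
      by rewrite -RintegralB//; [apply: eq_Rintegral => w _; rewrite /g; ring|exact: iphi..].
    have e2 : E (fun w => (xi w - Z w) * phi n w) = E (fun w => xi w * phi n w) - E (fun w => Z w * phi n w).
      by rewrite -RintegralB//; [apply: eq_Rintegral => w _; ring|exact: iphi..].
    by rewrite e1 e2 (cond_exp_bounded sF Fm ixi hce (Fphi n) (phiM n)).
  have h2 := smeas_near_orthogonal gH LH linL L0 FL he de0 hde (Fphi n) (phiM n).
  rewrite -/a in h2; have [->//|an0] := eqVneq a 0.
  rewrite -(@ler_pM2l _ a) ?lt_def ?an0// -expr2 mulrC; apply: le_trans h2.
  by rewrite ler_sqr ?nnegrE// (le_trans a0).
have c w : phi n w ^+ 2 @[n --> \oo] --> g w ^+ 2.
  apply: cvg_near_cst; apply: filterS (nbhs_infty_ger `|g w|) => n hn.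
  have := le_trans hn (_ : n%:R <= n.+1%:R); rewrite ler_nat leqnSn => /(_ isT).
  rewrite ler_norml /phi => /andP[h1 h2].
  by congr (_ ^+ 2); rewrite (min_idPl h2) (max_idPr h1).
have [i le] := fatou_Rintegral measurableT (fun n => (sphi n).2) (fun n w _ => sqr_ge0 _) (fun w _ => c w) Ephi (cvg_cst de).
by split => //; split => //; exact: smeas_meas Fg.
Qed.

(* An almost optimal [Z] leaves a residual almost orthogonal to [L], hence by
   Stein's formula to the trigonometric polynomials in [L], which are dense in
   the bounded [F]-measurable functions. *)
Theorem gaussian_projection xi eta : H xi -> is_cond_exp P F xi eta ->
  E (fun w => (xi w - eta w) ^+ 2) = inf [set E (fun w => (xi w - Z w) ^+ 2) | Z in L].
Proof.
move=> hxi hce; set S := [set _ | _ in _]; set m := inf S; set X := E _.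
have [_ linH] := gH; have sxi := gspace_sqi gH hxi.
have S0 : has_inf S.
  split; first by exists (E (fun w => (xi w - 0) ^+ 2)); exists (fun=> 0).
  by exists 0 => _ [Z _ <-]; exact: E_sqr_ge0.
have mle Z : L Z -> m <= E (fun w => (xi w - Z w) ^+ 2).
  by move=> hZ; apply: ge_inf; [case: S0|exists Z].
have m0 : 0 <= m by apply: lb_le_inf; [case: S0|move=> _ [Z _ <-]; exact: E_sqr_ge0].
suff key s : 0 < s -> s <= 1 -> `|X - m| <= s * (m + 4).
  apply/eqP; rewrite -subr_eq0 -normr_le0; apply/ler_addgt0Pr => eps eps0; rewrite add0r.
  pose s := Num.min 1 (eps / (m + 4)).
  have m4 : 0 < m + 4 by rewrite ltr_wpDl.
  have s0 : 0 < s by rewrite lt_min ltr01 divr_gt0.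
  apply: (le_trans (key s s0 _)); first by rewrite ge_min lexx.
  by rewrite -ler_pdivlMr// ge_min lexx orbT.
move=> s0 s1; have [_ [Z hZ <-] hA] := inf_adherent (exprn_gt0 2 s0) S0.
rewrite -/m in hA; set A := E _ in hA.
have he : H (fun w => xi w - Z w).
  have := linH (-1) _ _ (LH hZ) hxi; congr H; apply/funext => w; ring.
have se := gspace_sqi gH he.
have mA : m <= A by exact: mle.
have [sg Eg] : sqi P setT (fun w => eta w - Z w) /\ E (fun w => (eta w - Z w) ^+ 2) <= s ^+ 2.
  apply: (cond_exp_close hxi hce hZ (sqr_ge0 s)) => Z' hZ'.
  have sZ' := gspace_sqi gH (LH hZ').
  set C := E _; set B := E _; have B0 : 0 <= B by exact: E_sqr_ge0.
  (* Moving [Z] along [Z'] cannot bring the error below [m], while [A < m + s^2]: the quadratic in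
     [t] is nonnegative, and its discriminant is the near-orthogonality sought. *)
  have q t : 0 <= t ^+ 2 * B + 2 * t * C + s ^+ 2.
    have h1 := E_sqr_lin measurableT t sZ' se.
    have CE : E (fun w => Z' w * (xi w - Z w)) = C.
      by apply: eq_Rintegral => w _; rewrite mulrC.
    rewrite CE -/A -/B in h1.
    have h2 := mle _ (linL (- t) hZ' hZ).
    have h3 : E (fun w => (xi w - (- t * Z' w + Z w)) ^+ 2) = t ^+ 2 * B + 2 * t * C + A.
      by rewrite -h1; apply: eq_Rintegral => w _; ring.
    by rewrite h3 in h2; lra.
  have [b0|b0] := eqVneq B 0.
    rewrite b0 mulr0; have [->|c0] := eqVneq C 0; first by rewrite expr0n.
    have := q (- (s ^+ 2 + 1) / (2 * C)).
    by rewrite b0 mulr0 add0r [2 * _ * C](_ : _ = - (s ^+ 2 + 1)); [lra|field].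
  have bp : 0 < B by rewrite lt_def b0.
  have := q (- C / B).
  have -> : (- C / B) ^+ 2 * B + 2 * (- C / B) * C + s ^+ 2 = (s ^+ 2 * B - C ^+ 2) / B by field.
  by rewrite pmulr_lge0 ?invr_gt0// subr_ge0.
have XE := E_sqr_lin measurableT (-1) sg se.
have E1 : E (fun w => (-1 * (eta w - Z w) + (xi w - Z w)) ^+ 2) = X.
  by apply: eq_Rintegral => w _; ring.
rewrite E1 -/A in XE; set c := E (fun w => (eta w - Z w) * (xi w - Z w)) in XE.
have hc : c ^+ 2 <= s ^+ 2 * A.
  apply: (le_trans (E_Cauchy measurableT sg se)).
  by rewrite ler_wpM2r// (le_trans m0).
have A0 : 0 <= A by exact: le_trans m0 mA.
have h0 : 0 <= E (fun w => (eta w - Z w) ^+ 2) by exact: E_sqr_ge0.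
have c2 : `|2 * c| <= s * (A + 1).
  rewrite -ler_sqr ?nnegrE ?mulr_ge0 ?addr_ge0 ?(ltW s0)// real_normK ?num_real//.
  have -> : (2 * c) ^+ 2 = 4 * c ^+ 2 by ring.
  have : 0 <= s ^+ 2 * (A - 1) ^+ 2 by rewrite mulr_ge0 ?sqr_ge0.
  nra.
move: c2; rewrite !ler_norml XE => /andP[c2 c3].
have ss : s ^+ 2 <= s by rewrite expr2 ler_piMr// ltW.
have sA : s * A <= s * m + s.
  apply: (@le_trans _ _ (s * (m + s ^+ 2))); first by rewrite ler_wpM2l ?(ltW s0)// ltW.
  have : s * s ^+ 2 <= s by rewrite ler_piMr ?(ltW s0)// (le_trans ss).
  lra.
apply/andP; split; nra.
Qed.

End ProjectionTheorem.

(** * Existence of conditional expectations *)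

Section ConditionalExpectation.
Context d (T : measurableType d) (R : realType) (P : probability T R).
Variable F : set (set T).
Hypotheses (sF : sigma_algebra setT F) (Fm : F `<=` measurable).

(** Restriction to [F] is realised as pushforward along the identity to [T'], the same space with
    the smaller sigma-algebra; a Radon-Nikodym derivative taken there is automatically
    [F]-measurable. *)
Lemma cond_exp_exists (xi : T -> R) : P.-integrable setT (EFin \o xi) ->
  exists eta, is_cond_exp P F xi eta.
Proof.
move=> ixi; pose T' := g_sigma_algebraType F.
pose h : T -> T' := idfun.
have FE (A : set T) : (@measurable _ T' A) -> F A by move=> mA; apply: (smallest_sub sF (@subset_refl _ F)).
have mh : measurable_fun setT h by move=> _ A mA; rewrite setTI; apply: Fm; exact: FE.
pose hM : isMeasurableFun _ _ T T' h := isMeasurableFun.Build _ _ _ _ h mh.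
pose hf : {mfun T >-> T'} := HB.pack h hM.
pose nu0 : {charge set T -> \bar R} := induced_charge ixi.
have dom : nu0 `<< P.
  apply/null_content_dominatesP => A mA PA; rewrite /nu0/= /induced_charge.
  by apply: null_set_integral => //; apply: measurable_funTS; exact: (measurable_int P).
pose mu' : probability T' R := distribution P hf.
pose nu_ : {charge set T' -> \bar R} := pushforward nu0 hf.
pose nu : {charge set T' -> \bar R} := nu_ mh.
have dom' : nu `<< mu'.
  apply/null_content_dominatesP => A mA PA.
  by move/null_content_dominatesP : dom => /(_ (h @^-1` A)); apply => //; apply: Fm; exact: FE.
pose g := Radon_Nikodym nu mu'.
have ig : mu'.-integrable setT g by exact: Radon_Nikodym_integrable.
have gfin x : g x \is a fin_num by exact: Radon_Nikodym_fin_num.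
have gE A : F A -> (\int[P]_(w in A) (xi w)%:E = \int[mu']_(x in A) g x)%E.
  move=> FA; rewrite /g -Radon_Nikodym_integral//.
  exact: sub_sigma_algebra.
pose eta (w : T) := fine (g w).
have geta : g = EFin \o eta by apply/funext => x; rewrite /= /eta fineK.
have meta : measurable_fun [set: T'] (eta : T' -> R).
  by apply/measurable_EFinP; rewrite -geta; exact: (measurable_int mu').
have ieta : P.-integrable setT (EFin \o eta).
  apply/integrableP; split.
    apply/measurable_EFinP => _ B mB; rewrite setTI; apply: Fm; apply: FE.
    by have := meta measurableT B mB; rewrite setTI.
  move/integrableP : ig => [_]; rewrite (@ge0_integral_pushforward _ _ T T' R hf mh P setT (abse \o g))//.
  + by rewrite geta.
  + by apply: measurableT_comp => //; rewrite geta; exact/measurable_EFinP.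
  + by move=> y _; exact: abse_ge0.
exists eta; split => //.
- move=> _ [B mB <-]; rewrite setTI; apply: FE.
  by have := meta measurableT B mB; rewrite setTI.
- move=> A FA; rewrite gE// geta.
  have mA : measurable (A : set T') by exact: sub_sigma_algebra.
  have iA : P.-integrable (hf @^-1` A) ((EFin \o eta) \o hf).
    by apply: (integrableS measurableT) => //; exact: Fm.
  have me : measurable_fun [set: T'] (EFin \o (eta : T' -> R)) by apply/measurable_EFinP.
  by rewrite (@integral_pushforward _ _ T T' R hf mh P A (EFin \o eta) me iA mA).
Qed.

End ConditionalExpectation.

(** * Spectral integrals of fractional Brownian motion *)

Section HalfLine.
Variable R : realType.
Local Notation mu := (@lebesgue_measure R).
Local Notation D := (`]0, +oo[%classic : set R).
Implicit Types f F : R -> R.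

Lemma halflineP (x : R) : D x = (0 < x) :> Prop.
Proof. by rewrite /= in_itv/= andbT. Qed.

Lemma measurable_halfline : measurable (D : set (measurableTypeR R)).
Proof. exact: measurable_itv. Qed.

Lemma FTC2_pos f F (a b : R) : 0 < a -> a < b ->
  (forall x : R, 0 < x -> {for x, continuous f}) ->
  (forall x : R, 0 < x -> is_derive x 1 F (f x)) ->
  mu.-integrable `[a, b] (EFin \o f) /\ Rintegral mu `[a, b] f = F b - F a.
Proof.
move=> a0 ab cf dF.
have cF (x : R) : 0 < x -> {for x, continuous F}.
  by move=> x0; apply: differentiable_continuous; apply/derivable1_diffP; have [] := dF x x0.
have wf : {within `[a, b], continuous f}.
  by apply: continuous_in_subspaceT => x; rewrite inE/= in_itv/= => /andP[ax _]; exact: cf (lt_le_trans a0 ax).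
split.
  by apply: continuous_compact_integrable => //; exact: segment_compact.
rewrite /Rintegral (@continuous_FTC2 _ f F)//.
- split.
  + by move=> x; rewrite in_itv/= => /andP[ax _]; have [] := dF x (lt_trans a0 ax).
  + by apply: cvg_at_right_filter; exact: cF.
  + by apply: cvg_at_left_filter; exact: cF (lt_trans a0 ab).
- move=> x; rewrite in_itv/= => /andP[ax _]; rewrite derive1E.
  by have dFx := dF x (lt_trans a0 ax); rewrite derive_val.
Qed.

(** A bounded primitive bounds the integrals over the segments [[1 / (n + 1), n + 2]], which exhaust
    the half line and are nondegenerate already at [n = 0]; Fatou concludes. *)
Lemma intg_of_primitive f F (M : R) : (forall x, 0 < x -> 0 <= f x) ->
  (forall x : R, 0 < x -> {for x, continuous f}) ->
  (forall x : R, 0 < x -> is_derive x 1 F (f x)) ->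
  (forall x, 0 < x -> 0 <= F x <= M) ->
  mu.-integrable D (EFin \o f).
Proof.
move=> f0 cf dF FM; have mD := measurable_halfline.
pose a n : R := n.+1%:R^-1; pose b n : R := n.+2%:R.
have a0 n : 0 < a n by rewrite invr_gt0.
have ab n : a n < b n by rewrite (@le_lt_trans _ _ 1)// ?invf_le1 ?ler1n ?ltr1n.
pose I n : set R := `[a n, b n]%classic.
have ID n : D `&` I n = I n.
  apply/setIidPr => x; rewrite /I/= !in_itv/= andbT => /andP[ax _].
  exact: lt_le_trans ax.
have mI n : measurable (I n : set (measurableTypeR R)) by exact: measurable_itv.
have E n := FTC2_pos (a0 n) (ab n) cf dF.
have iF n : mu.-integrable D (EFin \o (f \_ (I n))).
  have := (@integrable_restrict _ _ _ mu _ (mI n) _ mD (EFin \o f)).1.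
  by rewrite ID restrict_EFin; apply; have [] := E n.
apply: (@fatou_Rintegral _ _ _ mu D mD (fun n => f \_ (I n)) f (fun=> M) M _ _ _ _ (cvg_cst M)).1 => //.
- move=> n x; rewrite halflineP => x0; rewrite patchE; case: ifP => // _; exact: f0.
- move=> x; rewrite halflineP => x0; apply: cvg_near_cst.
  near=> n; rewrite patchE mem_set// /I/= in_itv/=; apply/andP; split.
    rewrite /a -[leRHS]invrK lef_pV2 ?posrE ?invr_gt0//.
    near: n; apply: filterS (nbhs_infty_ger x^-1) => n hn.
    by rewrite (le_trans hn)// ler_nat.
  near: n; apply: filterS (nbhs_infty_ger x) => n hn.
  by rewrite (le_trans hn)// ler_nat -addn2 leq_addr.
- move=> n; rewrite -Rintegral_mkcondr ID (E n).2.
  have /andP[_ h1] := FM (b n) (lt_trans (a0 n) (ab n)).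
  have /andP[h2 _] := FM (a n) (a0 n); lra.
Unshelve. all: end_near. Qed.

Lemma derive_powR (p x : R) : 0 < x -> is_derive x 1 (fun x => x `^ p) (p * x `^ (p - 1)).
Proof.
move=> x0; have xi : x \in `]0, +oo[ by rewrite in_itv/= x0.
by apply: DeriveDef; [exact: derivable_powR|rewrite -derive1E powR_derive1].
Qed.

Lemma continuous_powR_pos (p x : R) : 0 < x -> {for x, continuous (fun x : R => x `^ p)}.
Proof.
move=> x0; apply: differentiable_continuous; apply/derivable1_diffP.
by have [] := derive_powR p x0.
Qed.

Lemma continuous_shift_powR (p x : R) : 0 < x -> {for x, continuous (fun x : R => (1 + x) `^ p)}.
Proof.
move=> x0; apply: (@continuous_comp _ _ _ (fun x : R => 1 + x) (fun x => x `^ p)).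
  by apply: cvgD; [exact: cvg_cst|exact: cvg_id].
by apply: continuous_powR_pos; rewrite ltr_wpDl.
Qed.

Lemma derive_shift_powR (p x : R) : 0 < x -> is_derive x 1 (fun x => (1 + x) `^ p) (p * (1 + x) `^ (p - 1)).
Proof.
move=> x0; have x1 : 0 < 1 + x by rewrite ltr_wpDl.
have d1 : is_derive x 1 (fun x : R => 1 + x) 1.
  by apply: is_derive_ext (derive_affine 1 0 1 x) => // y; rewrite subr0 mul1r addrC.
have d2 := @is_derive1_comp _ (fun x => x `^ p) (fun x : R => 1 + x) x _ _ (derive_powR p x1) d1.
by apply: is_derive_ext d2 => //; rewrite mulr1.
Qed.

Lemma powR_split (p x : R) : 0 < x -> x `^ p = x `^ (p - 1) * x.
Proof.
move=> x0; rewrite -[in RHS](powRr1 (ltW x0)) -powRrM mul1r -powRD ?subrK//.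
by rewrite (gt_eqF x0) implybT.
Qed.

(* The primitives are [(x / (1 + x)) ^ (2 - 2 H)] for [H >= 1/2] and
   [- (1 + x) ^ (- 2 H)] for [H <= 1/2]. *)
Lemma integrable_weight (H : R) : 0 < H < 1 ->
  mu.-integrable D (EFin \o (fun x => (1 + x) ^- 2 * x `^ (1 - 2 * H))).
Proof.
move=> /andP[H0 H1]; have mD := measurable_halfline.
have mw : measurable_fun D (fun x : R => (1 + x) ^- 2 * x `^ (1 - 2 * H)).
  apply: measurable_funM; last by apply: measurable_funTS; exact: measurable_powR.
  apply: open_continuous_measurable_fun; first exact: interval_open.
  move=> x; rewrite inE halflineP => x0.
  have h : {for x, continuous (fun x : R => (1 + x) ^+ 2)}.
    apply: (@continuous_comp _ _ _ (fun x : R => 1 + x) (fun x => x ^+ 2)); last exact: exprn_continuous.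
    by apply: cvgD; [exact: cvg_cst|exact: cvg_id].
  by apply: cvgV => //; rewrite expf_neq0// gt_eqF// ltr_wpDl.
have pow2 (x : R) : 0 < x -> (1 + x) ^- 2 = (1 + x) `^ (- 2).
  by move=> x0; rewrite powR_invn// addr_ge0// ltW.
have [H2|/ltW H2] := leP (2^-1) H.
  pose a := 2 - 2 * H.
  have a0 : 0 < a by rewrite /a; lra.
  have a1 : a <= 1 by rewrite /a; lra.
  have dF (x : R) : 0 < x -> is_derive x 1 (fun x => x `^ a * (1 + x) `^ (- a))
      (a * (x `^ (a - 1) * (1 + x) `^ (- a - 1))).
    move=> x0; have x1 : 0 < 1 + x by rewrite ltr_wpDl.
    have d := deriveM_fun (derive_powR a x0) (derive_shift_powR (- a) x0).
    apply: is_derive_ext d => //.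
    by rewrite (powR_split a x0) [(1 + x) `^ (- a)](powR_split _ x1); ring.
  have i1 : mu.-integrable D (EFin \o (fun x => a * (x `^ (a - 1) * (1 + x) `^ (- a - 1)))).
    apply: (intg_of_primitive _ _ dF (M := 1)).
    - by move=> x x0; rewrite !mulr_ge0 ?powR_ge0// ltW.
    - move=> x x0; apply: cvgM; first exact: cvg_cst.
      by apply: cvgM; [exact: continuous_powR_pos|exact: continuous_shift_powR].
    - move=> x x0; rewrite mulr_ge0 ?powR_ge0//= powRN ler_pdivrMr ?powR_gt0 ?ltr_wpDl// mul1r.
      by apply: ge0_ler_powR; rewrite ?nnegrE ?(ltW a0) ?addr_ge0 ?(ltW x0)// lerDr.
  apply: (intg_le mD mw _ (intgZ mD a^-1 i1)) => x; rewrite halflineP => x0.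
  have x1 : 0 < 1 + x by rewrite ltr_wpDl.
  rewrite ger0_norm ?mulr_ge0 ?powR_ge0 ?invr_ge0 ?sqr_ge0//.
  rewrite mulrA mulVf ?gt_eqF// mul1r mulrC (_ : a - 1 = 1 - 2 * H); last by rewrite /a; ring.
  rewrite ler_wpM2l ?powR_ge0// pow2//; apply: ler_powR; first by rewrite lerDl ltW.
  by rewrite /a; lra.
have dF (x : R) : 0 < x -> is_derive x 1 (fun x => 1 - (1 + x) `^ (- (2 * H)))
    ((2 * H) * (1 + x) `^ (- (2 * H) - 1)).
  move=> x0; have d := deriveD_fun (is_derive_cst (1 : R) x 1) (deriveN_fun (derive_shift_powR (- (2 * H)) x0)).
  by apply: is_derive_ext d => //; ring.
have i1 : mu.-integrable D (EFin \o (fun x => (2 * H) * (1 + x) `^ (- (2 * H) - 1))).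
  apply: (intg_of_primitive _ _ dF (M := 1)).
  - by move=> x x0; rewrite !mulr_ge0 ?powR_ge0// ltW.
  - by move=> x x0; apply: cvgM; [exact: cvg_cst|exact: continuous_shift_powR].
  - move=> x x0; rewrite subr_ge0 lerBlDr lerDl powR_ge0 andbT.
    rewrite powRN invf_le1 ?powR_gt0 ?ltr_wpDl//.
    rewrite -[leLHS](@powRr0 _ (1 + x)); apply: ler_powR; first by rewrite lerDl ltW.
    by rewrite mulr_ge0// ltW.
apply: (intg_le mD mw _ (intgZ mD (2 * H)^-1 i1)) => x; rewrite halflineP => x0.
have x1 : 0 < 1 + x by rewrite ltr_wpDl.
rewrite ger0_norm ?mulr_ge0 ?powR_ge0 ?invr_ge0 ?sqr_ge0//.
rewrite mulrA mulVf ?mul1r; last by rewrite mulf_neq0// gt_eqF.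
rewrite (_ : - (2 * H) - 1 = - 2 + (1 - 2 * H)); last by ring.
have -> : (1 + x) `^ (- 2 + (1 - 2 * H)) = (1 + x) `^ (- 2) * (1 + x) `^ (1 - 2 * H).
  by apply: powRD; rewrite (gt_eqF x1) implybT.
rewrite pow2// ler_wpM2l ?powR_ge0//.
by apply: ge0_ler_powR; rewrite ?nnegrE ?(ltW x0) ?(ltW x1) ?lerDr//; lra.
Qed.

End HalfLine.

Section WeightedIntegral.
Variable R : realType.
Local Notation mu := (@lebesgue_measure R).
Local Notation D := (`]0, +oo[%classic : set R).
Implicit Types f g : R -> R.

(** The comparison function controls both ends of the half line. Order two is integrable against
    [x ^ (1 - 2 H)] for every [H] in the unit interval, so products of two kernels of order one
    are. *)
Definition decays (k : nat) f := measurable_fun D f /\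
  exists C : R, forall x, 0 < x -> `|f x| <= C * (1 + x) ^- k.

(** The weight is, up to a constant, the spectral density of fractional noise of exponent [H],
    restricted to positive frequencies by symmetry. *)
Definition wint (H : R) f := Rintegral mu D (fun x => f x * x `^ (1 - 2 * H)).

Lemma decaysM j k f g : decays j f -> decays k g -> decays (j + k) (fun x => f x * g x).
Proof.
move=> [mf [A hA]] [mg [B hB]]; split; first exact: measurable_funM.
exists (A * B) => x x0; rewrite normrM exprD invfM mulrACA.
by apply: ler_pM => //; [exact: hA|exact: hB].
Qed.

Lemma decays_lin k a f g : decays k f -> decays k g -> decays k (fun x => a * f x + g x).
Proof.
move=> [mf [A hA]] [mg [B hB]]; split.
  by apply: measurable_funD => //; exact: measurable_funM.
exists (`|a| * A + B) => x x0; rewrite (le_trans (ler_normD _ _))// mulrDl lerD//; last exact: hB.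
by rewrite normrM -mulrA ler_wpM2l// hA.
Qed.

Lemma decays0 k : decays k (fun=> 0).
Proof. by split; [exact: measurable_cst|exists 0 => x x0; rewrite normr0 mul0r]. Qed.

Lemma decaysZ k a f : decays k f -> decays k (fun x => a * f x).
Proof. by move=> hf; have := decays_lin a hf (decays0 k); under eq_fun do rewrite addr0. Qed.

Lemma decaysD k f g : decays k f -> decays k g -> decays k (fun x => f x + g x).
Proof. by move=> hf hg; have := decays_lin 1 hf hg; under eq_fun do rewrite mul1r. Qed.

Lemma decaysB k f g : decays k f -> decays k g -> decays k (fun x => f x - g x).
Proof.
move=> hf hg; have := decays_lin (-1) hg hf; congr decays; apply/funext => x; ring.
Qed.

Lemma decays_bounded k f g (M : R) : decays k f -> measurable_fun D g ->
  (forall x, 0 < x -> `|g x| <= M) -> decays k (fun x => g x * f x).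
Proof.
move=> [mf [A hA]] mg gM; split; first exact: measurable_funM.
exists (M * A) => x x0; rewrite normrM -mulrA.
by apply: ler_pM => //; [exact: gM|exact: hA].
Qed.

Section Weight.
Variables (H : R) (hH : 0 < H < 1).
Let mD : measurable (D : set (measurableTypeR R)) := @measurable_halfline R.
Let w (x : R) := x `^ (1 - 2 * H).

Lemma decays_intg f : decays 2 f -> mu.-integrable D (EFin \o (fun x => f x * w x)).
Proof.
move=> [mf [C hC]]; apply: (intg_le mD _ _ (intgZ mD C (integrable_weight hH))).
  by apply: measurable_funM => //; apply: measurable_funTS; exact: measurable_powR.
move=> x; rewrite halflineP => x0; rewrite normrM (ger0_norm (powR_ge0 _ _)) mulrA.
by rewrite ler_wpM2r ?powR_ge0// hC.
Qed.

Lemma eq_wint f g : (forall x, 0 < x -> f x = g x) -> wint H f = wint H g.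
Proof. by move=> fg; apply: eq_Rintegral => x; rewrite inE halflineP => x0; rewrite fg. Qed.

Lemma wint_lin a f g : decays 2 f -> decays 2 g ->
  wint H (fun x => a * f x + g x) = a * wint H f + wint H g.
Proof.
move=> hf hg; have i1 := decays_intg hf; have i2 := decays_intg hg.
rewrite /wint -(RintegralZl _ mD i1) -(RintegralD mD (intgZ mD _ i1) i2).
by apply: eq_Rintegral => x _; rewrite /w; ring.
Qed.

Lemma wint0 : wint H (fun=> 0) = 0.
Proof.
have h := @wint_lin (-1) _ _ (decays0 2) (decays0 2).
have e : wint H (fun x : R => -1 * 0 + 0) = wint H (fun=> 0) by apply: eq_wint => x _; ring.
by rewrite e in h; lra.
Qed.

Lemma wintZ a f : decays 2 f -> wint H (fun x => a * f x) = a * wint H f.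
Proof.
move=> hf; rewrite -[RHS]addr0 -wint0 -wint_lin//; last exact: decays0.
by apply: eq_wint => x _; rewrite addr0.
Qed.

Lemma wintD f g : decays 2 f -> decays 2 g ->
  wint H (fun x => f x + g x) = wint H f + wint H g.
Proof.
move=> hf hg; rewrite -[wint H f]mul1r -wint_lin//.
by apply: eq_wint => x _; rewrite mul1r.
Qed.

Lemma wintB f g : decays 2 f -> decays 2 g ->
  wint H (fun x => f x - g x) = wint H f - wint H g.
Proof.
move=> hf hg; have := wint_lin (-1) hg hf; rewrite mulN1r addrC => <-.
by apply: eq_wint => x _; ring.
Qed.

Lemma wint_le f g : decays 2 f -> decays 2 g ->
  (forall x, 0 < x -> f x <= g x) -> wint H f <= wint H g.
Proof.
move=> hf hg fg; apply: le_Rintegral => //; [exact: decays_intg..|].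
by move=> x; rewrite halflineP => x0; rewrite ler_wpM2r ?powR_ge0// fg.
Qed.

Lemma wint_ge0 f : (forall x, 0 < x -> 0 <= f x) -> 0 <= wint H f.
Proof.
move=> f0; apply: Rintegral_ge0 => x; rewrite halflineP => x0.
by rewrite mulr_ge0 ?powR_ge0// f0.
Qed.

Lemma wint_cvg (F : nat -> R -> R) f (C : R) :
  (forall n, measurable_fun D (F n)) ->
  (forall n x, 0 < x -> `|F n x| <= C * (1 + x) ^- 2) ->
  (forall x, 0 < x -> F ^~ x @ \oo --> f x) ->
  decays 2 f /\ wint H (F n) @[n --> \oo] --> wint H f.
Proof.
move=> mF FC Ff; split.
  split; first by apply: measurable_fun_cvg => [|x]; [exact: mF|rewrite halflineP; exact: Ff].
  exists C => x x0; have h : `|F n x| @[n --> \oo] --> `|f x| by apply: cvg_norm; exact: Ff.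
  rewrite -(cvg_lim _ h)//; apply: limr_le; first by apply/cvg_ex; eexists; exact: h.
  by apply: nearW => n; exact: FC.
apply: (@dominated_Rintegral _ _ _ mu D mD _ _ (fun x => C * ((1 + x) ^- 2 * w x))).
- move=> n; apply: measurable_funM; first exact: mF.
  by apply: measurable_funTS; exact: measurable_powR.
- by apply: intgZ => //; exact: integrable_weight.
- move=> x; rewrite halflineP => x0; apply: cvgM; [exact: Ff|exact: cvg_cst].
- move=> n x; rewrite halflineP => x0; rewrite normrM (ger0_norm (powR_ge0 _ _)) mulrA.
  by rewrite ler_wpM2r ?powR_ge0// FC.
Qed.

End Weight.

Lemma lebesgue_measure_scale (c : R) (A : set R) : 0 < c -> measurable A ->
  (c%:E * pushforward mu ( *%R c : _ -> measurableTypeR R) A = mu A)%E.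
Proof.
move=> c0 mA; pose cp := NngNum (ltW c0).
have mc : measurable_fun [set: measurableTypeR R] ( *%R c : _ -> measurableTypeR R).
  exact: (measurable_funM (measurable_cst c) (@measurable_id _ _ _)).
apply/esym; have := @lebesgue_measure_unique R (mscale cp (pushforward mu ( *%R c : _ -> measurableTypeR R))).
apply => // _ [[a b]] _ <-.
change (mu `]a, b] = c%:E * mu ( *%R c @^-1` `]a, b]))%E.
have -> : *%R c @^-1` `]a, b] = `](c^-1 * a), (c^-1 * b)]%classic.
  apply/seteqP; split => x; rewrite /= !in_itv/= ltr_pdivrMl// ler_pdivlMl//.
rewrite !lebesgue_measure_itv/= !lte_fin ltr_pM2l ?invr_gt0//.
case: ifP => _; last by rewrite mule0.
by rewrite -!EFinD -EFinM mulrBr !mulrA mulfV ?gt_eqF// !mul1r.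
Qed.

Lemma ge0_integral_scale (c : R) (f : R -> R) : 0 < c ->
  measurable_fun D f -> (forall x, 0 < x -> 0 <= f x) ->
  (\int[mu]_(x in D) (f x)%:E = c%:E * \int[mu]_(x in D) (f (c * x))%:E)%E.
Proof.
move=> c0 mf f0; pose cp := NngNum (ltW c0).
have mD := @measurable_halfline R.
have mc : measurable_fun [set: measurableTypeR R] ( *%R c : _ -> measurableTypeR R).
  exact: (measurable_funM (measurable_cst c) (@measurable_id _ _ _)).
pose nu_ : {measure set (measurableTypeR R) -> \bar R} :=
  pushforward mu ( *%R c : _ -> measurableTypeR R).
pose nu : {measure set (measurableTypeR R) -> \bar R} := nu_ mc.
have e1 : (\int[mu]_(x in D) (f x)%:E = \int[mscale cp nu]_(x in D) (f x)%:E)%E.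
  apply: eq_measure_integral => A mA _; apply/esym.
  exact: (lebesgue_measure_scale c0 mA).
rewrite e1 ge0_integral_mscale//; last 2 first.
- exact/measurable_EFinP.
- by move=> x; rewrite halflineP => x0; rewrite lee_fin f0.
congr (_ * _)%E; rewrite ge0_integral_pushforward//; first last.
- by move=> x; rewrite inE halflineP => x0; rewrite lee_fin f0.
- exact/measurable_EFinP.
- congr integral; apply/seteqP; split => x; rewrite /= !in_itv/= !andbT pmulr_rgt0//.
Qed.

End WeightedIntegral.

Section WeightedScaling.
Variable R : realType.
Local Notation mu := (@lebesgue_measure R).
Local Notation D := (`]0, +oo[%classic : set R).
Implicit Types f g : R -> R.

Lemma decays_scale k (c : R) f : 0 < c -> decays k f -> decays k (fun x => f (c * x)).
Proof.
move=> c0 [mf [C hC]]; split.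
  have mc : measurable_fun D (fun x : R => c * x) by apply: measurable_funM.
  apply: (measurable_comp (F := D)) mf mc; first exact: measurable_halfline.
  by move=> _ [x + <-]; rewrite !halflineP => x0; rewrite mulr_gt0.
(* Both [m >= 1] and [m c >= 1], hence [1 + x <= m (1 + c x)]. *)
pose m := Num.max 1 c^-1.
have m0 : 0 < m by rewrite lt_max ltr01.
exists (`|C| * m ^+ k) => x x0; apply: (le_trans (hC _ (mulr_gt0 c0 x0))).
apply: (@le_trans _ _ (`|C| * (1 + c * x) ^- k)).
  by rewrite ler_wpM2r ?ler_norm// invr_ge0 exprn_ge0// addr_ge0// mulr_ge0// ltW.
rewrite -mulrA ler_wpM2l// -!exprVn -exprMn.
have p1 : 0 < 1 + c * x by rewrite ltr_wpDl// mulr_gt0.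
have p2 : 0 < 1 + x by rewrite ltr_wpDl.
have h : (1 + c * x)^-1 <= m * (1 + x)^-1.
  rewrite -[leLHS]mul1r ler_pdivrMr// mulrAC ler_pdivlMr// mul1r.
  have m1 : 1 <= m by rewrite le_max lexx.
  have m2 : 1 <= m * c by rewrite -ler_pdivrMr// mul1r le_max lexx orbT.
  nra.
have q1 : 0 <= (1 + c * x)^-1 by rewrite invr_ge0 ltW.
by apply: lerXn2r => //; rewrite nnegrE (le_trans q1).
Qed.

Lemma decays_dom k (C : R) : decays k (fun x : R => C * (1 + x) ^- k).
Proof.
split; last first.
  exists `|C| => x x0; rewrite normrM ler_wpM2l// ger0_norm// invr_ge0 exprn_ge0//.
  by rewrite addr_ge0// ltW.
apply: measurable_funM => //.
apply: open_continuous_measurable_fun; first exact: interval_open.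
move=> x; rewrite inE halflineP => x0.
have h : {for x, continuous (fun x : R => (1 + x) ^+ k)}.
  apply: (@continuous_comp _ _ _ (fun x : R => 1 + x) (fun x => x ^+ k)); last exact: exprn_continuous.
  by apply: cvgD; [exact: cvg_cst|exact: cvg_id].
by apply: cvgV => //; rewrite expf_neq0// gt_eqF// ltr_wpDl.
Qed.

Lemma wint_scale (H c : R) f : 0 < H < 1 -> 0 < c -> decays 2 f ->
  wint H (fun x => f (c * x)) = c `^ (2 * H - 2) * wint H f.
Proof.
move=> hH c0; have mD := @measurable_halfline R.
have pos g : decays 2 g -> (forall x, 0 < x -> 0 <= g x) ->
    wint H (fun x => g (c * x)) = c `^ (2 * H - 2) * wint H g.
  move=> hg g0; have hgc := decays_scale c0 hg.
  have i1 := decays_intg hH hg; have i2 := decays_intg hH hgc.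
  have mg : measurable_fun D (fun x => g x * x `^ (1 - 2 * H)) by exact: intg_meas i1.
  have := ge0_integral_scale c0 mg (fun x x0 => mulr_ge0 (g0 x x0) (powR_ge0 _ _)).
  have -> : (\int[mu]_(x in D) (g (c * x)%R * (c * x)%R `^ (1 - 2 * H))%:E =
      (c `^ (1 - 2 * H))%:E * \int[mu]_(x in D) (g (c * x)%R * x `^ (1 - 2 * H))%:E)%E.
    rewrite -(integralZl mD i2); apply: eq_integral => x; rewrite inE halflineP => x0.
    by rewrite -EFinM powRM ?ltW//; congr EFin; ring.
  move=> /(congr1 fine); rewrite muleA -EFinM fineM//; last exact: integrable_fin_num i2.
  rewrite -/(Rintegral _ _ _) -/(Rintegral mu D (fun x => g (c * x) * x `^ (1 - 2 * H))) -!/(wint H _) => ->.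
  have pD r s : c `^ (r + s) = c `^ r * c `^ s by apply: powRD; rewrite (gt_eqF c0) implybT.
  have cc : c `^ (2 * H - 2) * (c * c `^ (1 - 2 * H)) = 1.
    rewrite -[X in _ * (X * _)](powRr1 (ltW c0)) -!pD (_ : _ + _ = 0) ?powRr0//; ring.
  by rewrite mulrA cc mul1r.
(* The sign condition is removed by adding the majorant [h] given by the decay of [f] and
   subtracting its own scaling relation. *)
move=> hf; have [_ [C hC]] := hf.
pose h (x : R) := `|C| * (1 + x) ^- 2.
have hh : decays 2 h by exact: decays_dom.
have h0 x : 0 < x -> 0 <= h x.
  by move=> x0; rewrite mulr_ge0// invr_ge0 exprn_ge0// addr_ge0// ltW.
have fh x : 0 < x -> 0 <= f x + h x.
  move=> x0; have := hC x x0; rewrite ler_norml => /andP[h1 _].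
  have : C * (1 + x) ^- 2 <= h x by rewrite ler_wpM2r ?ler_norm// invr_ge0 exprn_ge0// addr_ge0// ltW.
  lra.
have hfh := decaysD hf hh.
have e1 := pos _ hfh fh; have e2 := pos _ hh h0.
have l := wintD hH (decays_scale c0 hf) (decays_scale c0 hh).
have r := wintD hH hf hh.
move: e1; rewrite l r e2; lra.
Qed.

End WeightedScaling.

(** * Kernels of the process and of its time integral *)

Section SpectralKernels.
Variable R : realType.
Local Notation mu := (@lebesgue_measure R).
Local Notation D := (`]0, +oo[%classic : set R).

(* Real ([true]) and imaginary ([false]) parts of [(e^(i x t) - 1) / (i x)] and
   of its integral over [0, t], [((e^(i x t) - 1) / (i x) - t) / (i x)]. *)
Definition vker (k : bool) (t x : R) : R :=
  if k then sin (x * t) / x else (1 - cos (x * t)) / x.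
Definition uker (k : bool) (t x : R) : R :=
  if k then (1 - cos (x * t)) / x / x else (t - sin (x * t) / x) / x.

Lemma measurable_div_halfline (g : R -> R) : measurable_fun D g ->
  measurable_fun D (fun x => g x / x).
Proof.
move=> mg; apply: measurable_funM => //.
apply: open_continuous_measurable_fun; first exact: interval_open.
move=> x; rewrite inE halflineP => x0.
by apply: cvgV; [rewrite gt_eqF|exact: cvg_id].
Qed.

Lemma measurable_cos_halfline (t : R) : measurable_fun D (fun x => cos (x * t)).
Proof.
apply: measurable_funTS; apply: continuous_measurable_fun.
rewrite (_ : (fun x => _) = fun x => cos (t * x + 0)); first exact: continuous_cos_aff.
by apply/funext => x; rewrite addr0 mulrC.
Qed.

Lemma measurable_sin_halfline (t : R) : measurable_fun D (fun x => sin (x * t)).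
Proof.
apply: measurable_funTS; apply: continuous_measurable_fun.
rewrite (_ : (fun x => _) = fun x => cos (t * x - pi / 2)); first exact: continuous_cos_aff.
by apply/funext => x; rewrite cosBpihalf mulrC.
Qed.

Lemma measurable_vker k t : measurable_fun D (vker k t).
Proof.
case: k; apply: measurable_div_halfline; first exact: measurable_sin_halfline.
by apply: measurable_funB => //; exact: measurable_cos_halfline.
Qed.

Lemma measurable_uker k t : measurable_fun D (uker k t).
Proof.
case: k; apply: measurable_div_halfline; first exact: (measurable_vker false).
by apply: measurable_funB => //; exact: (measurable_vker true).
Qed.

Lemma derive_uker k (s x : R) : 0 < x -> is_derive s 1 (fun t => uker k t x) (vker k s x).
Proof.
move=> x0; have xn : x != 0 by rewrite gt_eqF.
have da : is_derive s 1 (fun t : R => x * t) x.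
  by apply: is_derive_ext (derive_affine x 0 0 s) => // y; rewrite subr0 addr0.
case: k; rewrite /uker /vker.
  have d := deriveM_fun (deriveD_fun (is_derive_cst (1 : R) s 1) (deriveN_fun (derive_cos_fun da))) (is_derive_cst (x^-1 * x^-1) s 1).
  apply: is_derive_ext d => [t|]; first by rewrite /cst mulrA.
  by rewrite mulr0 !add0r mulNr opprK /cst; field.
have d := deriveM_fun (deriveD_fun (is_derive_id s 1) (deriveN_fun (deriveM_fun (derive_sin_fun da) (is_derive_cst x^-1 s 1)))) (is_derive_cst x^-1 s 1).
apply: is_derive_ext d => [t|]; first by [].
by rewrite /cst !mulr0 !add0r; field.
Qed.

Lemma one_sub_cos_ge0 (y : R) : 0 <= 1 - cos y.
Proof. by rewrite subr_ge0 cos_le1. Qed.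

Lemma one_sub_cos_le (y : R) : 1 - cos y <= `|y|.
Proof.
have h := ler_norm_sin (y / 2); have s1 := sin_max (y / 2).
rewrite cos_half opprB addrC subrK -(real_normK (num_real (sin _))).
rewrite normrM (gtr0_norm (_ : 0 < 2^-1 :> R)) ?invr_gt0// in h.
have := normr_ge0 (sin (y / 2)); nra.
Qed.

Lemma sub_sin_bound (y : R) : 0 <= y -> 0 <= y - sin y <= y ^+ 2 / 2.
Proof.
move=> y0; apply/andP; split.
  by rewrite subr_ge0 (le_trans (ler_norm _))// (le_trans (ler_norm_sin _))// ger0_norm.
have H := @deriv_ge0_ge0 R (fun x => x * x / 2 - (x - sin x)) (fun x => x - (1 - cos x)) y.
rewrite -subr_ge0 expr2; apply: H => //.
- move=> x.
  have d := deriveD_fun (deriveM_fun (deriveM_fun (is_derive_id x 1) (is_derive_id x 1)) (is_derive_cst (2^-1 : R) x 1)) (deriveN_fun (deriveD_fun (is_derive_id x 1) (deriveN_fun (is_derive_sin x)))).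
  by apply: is_derive_ext d => //; rewrite /cst; field.
- by rewrite sin0; ring.
- by move=> x x0; rewrite subr_ge0 (le_trans (one_sub_cos_le x))// ger0_norm.
Qed.

(** The kernel is at most [t] and at most [2 / x]; the two bounds add up after multiplication by
    [1 + x]. Uniformity in [t <= T] is what dominates Riemann sums in the time variable. *)
Lemma vker_bound k (t T x : R) : 0 <= t <= T -> 0 < x ->
  `|vker k t x| <= (T + 2) * (1 + x)^-1.
Proof.
move=> /andP[t0 tT] x0; have x1 : 0 < 1 + x by rewrite ltr_wpDl.
have xt : 0 <= x * t by rewrite mulr_ge0// ltW.
rewrite ler_pdivlMr//; suff [h1 h2] : `|vker k t x| <= t /\ `|vker k t x| * x <= 2.
  by rewrite mulrDr mulr1 lerD// (le_trans h1).
case: k; rewrite /vker normrM normfV (gtr0_norm x0) divfK ?gt_eqF// ler_pdivrMr//.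
  split; last by rewrite (le_trans (sin_max _))// ler1n.
  by rewrite (le_trans (ler_norm_sin _))// ger0_norm// mulrC.
rewrite ger0_norm ?one_sub_cos_ge0//; split.
  by rewrite (le_trans (one_sub_cos_le _))// ger0_norm// mulrC.
by have := cos_geN1 (x * t); lra.
Qed.

Lemma uker_bound k (t T x : R) : 0 <= t <= T -> 0 < x ->
  `|uker k t x| <= (T ^+ 2 + 2 * T) * (1 + x)^-1.
Proof.
move=> /andP[t0 tT] x0; have x1 : 0 < 1 + x by rewrite ltr_wpDl.
have xt : 0 <= x * t by rewrite mulr_ge0// ltW.
have T0 := le_trans t0 tT.
rewrite ler_pdivlMr//; suff [h1 h2] : `|uker k t x| <= t ^+ 2 /\ `|uker k t x| * x <= 2 * t.
  rewrite mulrDr mulr1 lerD//; last by rewrite (le_trans h2)// ler_pM2l.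
  by rewrite (le_trans h1)// ler_sqr// nnegrE.
have xn : x != 0 by rewrite gt_eqF.
case: k; rewrite /uker normrM normfV (gtr0_norm x0) divfK//.
  rewrite normrM normfV (gtr0_norm x0) ger0_norm ?one_sub_cos_ge0//; split.
    rewrite !ler_pdivrMr//; have := cos_ge (x * t); have := sqr_ge0 (x * t); nra.
  rewrite ler_pdivrMr// (le_trans (one_sub_cos_le _))// ger0_norm//; nra.
have /andP[h1 h2] := sub_sin_bound xt.
have e : t - sin (x * t) / x = (x * t - sin (x * t)) / x by field.
rewrite e normrM normfV (gtr0_norm x0) ger0_norm//; split.
  by rewrite !ler_pdivrMr//; have := sqr_ge0 (x * t); nra.
rewrite ler_pdivrMr//; have := ler_norm_sin (x * t); rewrite (ger0_norm xt) ler_norml => /andP[h3 _].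
nra.
Qed.

Lemma decays_vker k t : 0 <= t -> decays 1 (vker k t).
Proof.
move=> t0; split; first exact: measurable_vker.
by exists (t + 2) => x x0; apply: vker_bound; rewrite ?t0/=.
Qed.

Lemma decays_uker k t : 0 <= t -> decays 1 (uker k t).
Proof.
move=> t0; split; first exact: measurable_uker.
by exists (t ^+ 2 + 2 * t) => x x0; apply: uker_bound; rewrite ?t0/=.
Qed.

Lemma decays_indic : decays 2 (\1_(`[1, 2]%classic) : R -> R).
Proof.
split; first by apply: measurable_indic; exact: measurable_itv.
exists 9 => x x0; rewrite indicE; have p : 0 < (1 + x) ^+ 2 by rewrite exprn_gt0// ltr_wpDl.
case: (boolP (x \in _)) => [|_]; last by rewrite normr0 mulr_ge0// invr_ge0 ltW.
rewrite inE/= in_itv/= => /andP[h1 h2]; rewrite normr1 ler_pdivlMr//; nra.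
Qed.

Section Weight.
Variables (H : R) (hH : 0 < H < 1).
Let mD : measurable (D : set (measurableTypeR R)) := @measurable_halfline R.

(** On [[1, 2]] the weight is at least [1 / x], hence [1 / 2], whatever [H]. This window serves to
    show constants positive and, later, to compare the two exponents. *)
Lemma wint_indic_gt0 : 0 < wint H (\1_(`[1, 2]%classic)).
Proof.
have /andP[H0 H1] := hH.
apply: (@lt_le_trans _ _ (Rintegral mu D (fun x => 2^-1 * \1_(`[1, 2]%classic) x))).
  have i1 : mu.-integrable D (EFin \o \1_(`[1, 2]%classic : set R)).
    have := @integrable_indic_itv R 1 2 true false; apply: integrableS => //.
  rewrite RintegralZl// mulr_gt0 ?invr_gt0//.
  rewrite /Rintegral integral_indic//=.
  rewrite (_ : `[1, 2] `&` D = `[1, 2]%classic); last first.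
    by apply/setIidPl => x; rewrite /= !in_itv/= andbT => /andP[h _]; exact: lt_le_trans h.
  by rewrite lebesgue_measure_itv/= lte_fin ltr1n/=; lra.
apply: le_Rintegral => //.
- apply: intgZ => //; have := @integrable_indic_itv R 1 2 true false; exact: integrableS.
- exact: (decays_intg hH decays_indic).
- move=> x _; rewrite indicE; case: (boolP (x \in _)) => [|_]; last by rewrite mulr0 mul0r.
  rewrite inE/= in_itv/= => /andP[h1 h2]; rewrite mulr1 mul1r.
  apply: (@le_trans _ _ (x `^ (-1))); last by apply: ler_powR => //; lra.
  rewrite powR_inv1 ?(le_trans ler01)// lef_pV2 ?posrE//.
  exact: lt_le_trans h1.
Qed.

(** Half the unnormalised spectral variance. Homogeneity makes it [t ^ (2 H)] times the positive
    constant [cosint 1], by which inner products are normalised. *)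
Definition cosint (t : R) := wint H (fun x => (1 - cos (x * t)) / x / x).

Lemma decays_one_sub_cos (t : R) : decays 2 (fun x : R => (1 - cos (x * t)) / x / x).
Proof.
split; first exact: (measurable_uker true).
exists (t ^+ 2 + 4) => x x0; have p : 0 < (1 + x) ^+ 2 by rewrite exprn_gt0// ltr_wpDl.
rewrite ger0_norm ?divr_ge0 ?one_sub_cos_ge0 ?(ltW x0)// ler_pdivlMr//.
have xn : x != 0 by rewrite gt_eqF.
set c := cos _; have h1 := cos_ge (x * t); have h2 := cos_geN1 (x * t).
rewrite (_ : (1 - c) / x / x * (1 + x) ^+ 2 = (1 - c) * (1 + x) ^+ 2 / x ^+ 2); last by field.
rewrite ler_pdivrMr ?exprn_gt0//.
have h3 : 0 <= 1 - c by exact: one_sub_cos_ge0.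
have h4 : (1 - c) * (1 + x) ^+ 2 <= (1 - c) * (2 + 2 * x ^+ 2).
  rewrite ler_wpM2l//; have := sqr_ge0 (1 - x); nra.
apply: (le_trans h4).
have h5 : 2 * (1 - c) <= x ^+ 2 * t ^+ 2 by move: h1; rewrite -/c exprMn; lra.
have h6 : (1 - c) * (2 * x ^+ 2) <= 2 * (2 * x ^+ 2).
  by rewrite ler_wpM2r ?mulr_ge0 ?sqr_ge0//; move: h2; rewrite -/c; lra.
lra.
Qed.

Lemma cosint_gt0 : 0 < cosint 1.
Proof.
apply: (@lt_le_trans _ _ (wint H (fun x => 12^-1 * \1_(`[1, 2]%classic) x))).
  by rewrite (wintZ hH _ decays_indic) mulr_gt0 ?wint_indic_gt0// invr_gt0.
apply: (wint_le hH); [exact: decaysZ decays_indic|exact: decays_one_sub_cos|].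
move=> x x0; rewrite indicE mulr1; case: (boolP (x \in _)) => [|_]; last first.
  by rewrite mulr0 !divr_ge0 ?one_sub_cos_ge0// ltW.
rewrite inE/= in_itv/= => /andP[h1 h2]; rewrite mulr1 !ler_pdivlMr//.
have := @sin_ge R (x / 2); rewrite divr_ge0 ?(ltW x0)// => /(_ isT) hs.
rewrite cos_half; set s := sin _ in hs *.
(* For [y = x / 2] in [[1/2, 1]] one has [y - y^3 / 6 >= 5/12], so
   [1 - cos x = 2 s^2 >= 1/3 >= x^2 / 12]: the origin of the factor [12^-1]. *)
have h3 : 5 / 12 <= s by apply: le_trans hs; nra.
nra.
Qed.

Lemma cosintE (t : R) : 0 <= t -> cosint t = t `^ (2 * H) * cosint 1.
Proof.
have /andP[H0 H1] := hH.
rewrite le_eqVlt => /predU1P[<-|t0].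
  rewrite powR0 ?mulf_neq0 ?gt_eqF// mul0r -[RHS](wint0 hH).
  by apply: eq_wint => x _; rewrite mulr0 cos0 subrr !mul0r.
have e := wint_scale hH t0 (decays_one_sub_cos 1).
have -> : cosint t = t ^+ 2 * wint H (fun x => (1 - cos (t * x * 1)) / (t * x) / (t * x)).
  have d := decays_scale t0 (decays_one_sub_cos 1).
  rewrite -(wintZ hH)//; apply: eq_wint => x x0; rewrite mulr1 [t * x]mulrC.
  by field; rewrite !gt_eqF.
rewrite e mulrA -/(cosint 1); congr (_ * _).
rewrite -powR_mulrn ?(ltW t0)// -powRD; first by congr (_ `^ _); ring.
by rewrite (gt_eqF t0) implybT.
Qed.

(** The real part of [v_s] times the conjugate of [v_t] is [((1 - cos (x s)) + (1 - cos (x t)) - (1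
    - cos (x (s - t)))) / x^2], which integrates to the three terms of the covariance. *)
Lemma fBm_cov_spectral (s t : R) : 0 <= s -> 0 <= t ->
  fBm_cov H s t = (2 * cosint 1)^-1 *
    wint H (fun x => vker true s x * vker true t x + vker false s x * vker false t x).
Proof.
move=> s0 t0; have c0 := cosint_gt0.
have e : cosint `|s - t| = cosint (s - t).
  by apply: eq_wint => x x0; rewrite -(cos_norm (x * (s - t))) normrM (gtr0_norm x0).
have d1 := decays_one_sub_cos s; have d2 := decays_one_sub_cos t.
have d3 := decays_one_sub_cos (s - t).
have h1 : wint H (fun x => (1 - cos (x * s)) / x / x + (1 - cos (x * t)) / x / x -
    (1 - cos (x * (s - t))) / x / x) = cosint s + cosint t - cosint (s - t).
  have e1 := wintB hH (decaysD d1 d2) d3; have e2 := wintD hH d1 d2.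
  by rewrite e1 e2.
have h2 : wint H (fun x => vker true s x * vker true t x + vker false s x * vker false t x) =
    cosint s + cosint t - cosint (s - t).
  rewrite -h1; apply: eq_wint => x x0; rewrite /vker mulrBr cosB.
  have xn : x != 0 by rewrite gt_eqF.
  by field.
rewrite h2 -e (cosintE s0) (cosintE t0) (cosintE (normr_ge0 (s - t))) /fBm_cov.
by move: (cosint 1) c0 => c c0; field; rewrite gt_eqF.
Qed.

End Weight.
End SpectralKernels.

(** * Spectral representation of linear functionals of the noises *)

Section RiemannSums.
Variable R : realType.
Local Notation mu := (@lebesgue_measure R).
Implicit Types g F : R -> R.

Lemma uniform_continuity_segment g (t A eps : R) :
  (forall s : R, 0 <= s -> {for s, continuous g}) -> 0 <= A -> 0 < eps ->
  \forall n \near \oo, forall x, `[0, t]%classic x ->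
    forall y, `|x - y| <= A / n.+1%:R -> `|g x - g y| <= eps.
Proof.
move=> cg A0 eps0.
have /compact_near_coveringP cov := @segment_compact R 0 t.
apply: (cov nat \oo (fun n x => forall y, `|x - y| <= A / n.+1%:R -> `|g x - g y| <= eps)) => x.
rewrite /= in_itv/= => /andP[x0 _].
have e2 : 0 < eps / 2 by rewrite divr_gt0.
have /cvgrPdist_lt/(_ _ e2) /nbhs_ballP[de /= de0 hde] := cg x x0.
have de2 : 0 < de / 2 by rewrite divr_gt0.
exists (ball x (de / 2), [set n : nat | A / n.+1%:R < de / 2]).
  split => /=; first by apply/nbhs_ballP; exists (de / 2).
  apply: filterS (nbhs_infty_gtr (A / (de / 2))) => n hn /=.
  rewrite ltr_pdivrMr ?ltr0n// -ltr_pdivrMl// mulrC (lt_trans hn)// ltr_nat//.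
move=> [x' n] /= [hx' hn] y hy; rewrite -ball_normE /= in hx'.
have h1 : `|g x - g x'| < eps / 2.
  by apply: hde; rewrite -ball_normE /= (lt_trans hx')// ltr_pdivrMr// ltr_pMr// ltr1n.
have h2 : `|g x - g y| < eps / 2.
  apply: hde; rewrite -ball_normE /= (_ : x - y = (x - x') + (x' - y)); last by ring.
  rewrite (le_lt_trans (ler_normD _ _))// [ltRHS](splitr de) ltrD//.
  exact: le_lt_trans hy hn.
rewrite (_ : g x' - g y = (g x - g y) - (g x - g x')); last by ring.
by rewrite (le_trans (ler_normB _ _))// [leRHS](splitr eps) lerD// ltW.
Qed.

Definition riemann_sum g (t : R) (n : nat) : R :=
  t / n.+1%:R * \sum_(j < n.+1) g (t * j%:R / n.+1%:R).

(** Each cell is compared with the increment of the primitive by the mean value theorem. The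
    primitive lives on [s > -1] so that a two-sided derivative exists at the endpoint zero. *)
Lemma riemann_sum_cvg g F (t : R) : 0 <= t ->
  (forall s : R, 0 <= s -> {for s, continuous g}) ->
  (forall s : R, -1 < s -> is_derive s 1 F (g s)) ->
  riemann_sum g t @ \oo --> F t - F 0.
Proof.
move=> t0 cg dF; apply/cvgrPdist_le => eps eps0.
have t1 : 0 < t + 1 by rewrite ltr_wpDl.
have e0 : 0 < eps / (t + 1) by rewrite divr_gt0.
have := @uniform_continuity_segment g t t _ cg t0 e0; apply: filterS => n hn.
pose N : R := n.+1%:R; have N0 : 0 < N by rewrite ltr0n.
have Nn : N != 0 by rewrite gt_eqF.
pose p (j : nat) : R := t * j%:R / N.
have pS j : p j.+1 - p j = t / N by rewrite /p -natr1; field.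
have p0 j : 0 <= p j by rewrite /p !mulr_ge0// invr_ge0 ltW.
have ple (j : 'I_n.+1) : p j <= t.
  by rewrite /p -mulrA ler_piMr// ler_pdivrMr// mul1r ler_nat ltnW.
have tele : F t - F 0 = \sum_(j < n.+1) (F (p j.+1) - F (p j)).
  rewrite -(big_mkord xpredT (fun j => F (p j.+1) - F (p j))) telescope_sumr//.
  by rewrite /p mulr0 mul0r mulfK.
have tN : 0 <= t / N by rewrite divr_ge0// ltW.
have step (j : 'I_n.+1) : `|F (p j.+1) - F (p j) - t / N * g (p j)| <= t / N * (eps / (t + 1)).
  have pp : p j <= p j.+1 by rewrite -subr_ge0 pS.
  have cF : {within `[p j, p j.+1], continuous F}.
    apply: continuous_in_subspaceT => x; rewrite inE/= in_itv/= => /andP[px _].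
    apply: differentiable_continuous; apply/derivable1_diffP.
    by have [] := dF x (lt_le_trans (_ : -1 < 0) (le_trans (p0 j) px)); rewrite // ltrN10.
  have dFp x : x \in `]p j, p j.+1[ -> is_derive x 1 F (g x).
    rewrite in_itv/= => /andP[px _]; apply: dF; apply: lt_trans px.
    by rewrite (lt_le_trans _ (p0 j))// ltrN10.
  have [c] := @MVT_segment _ F g (p j) (p j.+1) pp dFp cF.
  rewrite in_itv/= => /andP[c1 c2]; rewrite pS => ->.
  rewrite [g c * _]mulrC -mulrBr normrM ger0_norm// ler_wpM2l// distrC.
  apply: hn; first by rewrite /= in_itv/= p0 ple.
  by rewrite distrC ger0_norm ?subr_ge0// -/N -(pS j) lerD2r.
rewrite tele /riemann_sum -/N mulr_sumr -sumrB.
apply: (le_trans (ler_norm_sum _ _ _)).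
apply: (@le_trans _ _ (\sum_(j < n.+1) t / N * (eps / (t + 1)))).
  by apply: ler_sum => j _; exact: step.
rewrite sumr_const card_ord -mulr_natr -/N.
rewrite [X in X <= _](_ : _ = eps * (t / (t + 1))); last by rewrite mulrAC (divfK Nn) mulrCA.
by rewrite ler_piMr ?(ltW eps0)// ler_pdivrMr// mul1r lerDl.
Qed.

Lemma primitive_ext g : continuous g ->
  exists F : R -> R, (forall s : R, -1 < s -> is_derive s 1 F (g s)) /\
    forall t, 0 <= t -> F t - F 0 = Rintegral mu `[0, t] g.
Proof.
move=> cg; pose F (x : R) := Rintegral mu `[-1, x] g.
have ig a b : mu.-integrable `[a, b] (EFin \o g).
  by apply: continuous_compact_integrable; [exact: segment_compact|exact: continuous_subspaceT].
exists F; split=> [s s1|t t0].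
  have [d1 d2] := @continuous_FTC1_closed _ g (-1) s (s + 1) (ltr_pwDr ltr01 (lexx s)) (ig _ _) s1 (cg s).
  by apply: DeriveDef => //; rewrite -derive1E.
have h1 : (-1 : R) <= 0 by rewrite lerN10.
rewrite /F (@Rintegral_itvB _ g (BLeft (-1)) (BRight t) 0)//=.
by rewrite Rintegral_itv_obnd_cbnd//; apply: integrableS (ig 0 t) => //; exact: subset_itv_oc_cc.
Qed.

Lemma riemann_sum_integral g (t : R) : 0 <= t -> continuous g ->
  riemann_sum g t @ \oo --> Rintegral mu `[0, t] g.
Proof.
move=> t0 cg; have [F [dF FE]] := primitive_ext cg.
by rewrite -FE//; apply: riemann_sum_cvg => // s _; exact: cg.
Qed.

End RiemannSums.

(** * Products of independent variables, and passage from normal laws to [cgauss] *)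

Section IndependenceAndMoments.
Context d (T : measurableType d) (R : realType) (P : probability T R).
Local Notation E f := (Rintegral P setT f).

(** Independence is expressed through constant conditional expectations, first of an indicator given
    [G1], then of [f] given [G2]; [cond_exp_bounded] supplies the multipliers. *)
Lemma indep_Rintegral (G1 G2 : set (set T)) (f g : T -> R) (M N : R) :
  sigma_algebra setT G1 -> sigma_algebra setT G2 ->
  G1 `<=` measurable -> G2 `<=` measurable ->
  (forall A B, G1 A -> G2 B -> P (A `&` B) = (P A * P B)%E) ->
  smeas G1 f -> smeas G2 g -> (forall w, `|f w| <= M) -> (forall w, `|g w| <= N) ->
  E (fun w => f w * g w) = E f * E g.
Proof.
move=> s1 s2 m1 m2 ind sf sg fM gN.
have cstG (G : set (set T)) (c : R) : sigma_algebra setT G -> preimage_set_system setT (fun _ : T => c) measurable `<=` G.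
  move=> [g0 gC _] _ [B mB <-]; rewrite setTI; case: (pselect (B c)) => Bc.
    rewrite (_ : _ @^-1` _ = setT `\` set0); first exact: gC.
    by rewrite setD0; apply/seteqP; split.
  by rewrite (_ : _ @^-1` _ = set0)//; apply/seteqP; split.
have icst (c : R) : P.-integrable setT (EFin \o (fun=> c)).
  by apply: (@intg_bounded _ _ _ P _ `|c|).
have mf := smeas_meas m1 sf; have mg := smeas_meas m2 sg.
have if_ : P.-integrable setT (EFin \o f) by exact: intg_bounded fM.
have ig : P.-integrable setT (EFin \o g) by exact: intg_bounded gN.
have EA (h : T -> R) B : measurable B -> Rintegral P B h = E (fun w => \1_B w * h w).
  move=> mB; rewrite Rintegral_mkcond; apply: eq_Rintegral => w _.
  by rewrite patchE indicE; case: (_ \in _); rewrite ?mul1r ?mul0r.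
have Pfin B : measurable B -> P B = (fine (P B))%:E by move=> mB; rewrite fineK// fin_num_measure.
have step1 B : G2 B -> E (fun w => \1_B w * f w) = fine (P B) * E f.
  move=> G2B; have mB := m2 _ G2B.
  have i1 : P.-integrable setT (EFin \o \1_B) by exact: integrable_indic.
  have ce : is_cond_exp P G1 (\1_B) (fun=> fine (P B)).
    split; [exact: cstG|exact: icst|move=> A G1A].
    have mA := m1 _ G1A.
    rewrite integral_cst// integral_indic// setIC.
    transitivity (P A * P B)%E; last exact/esym/ind.
    by rewrite (Pfin _ mB) muleC.
  rewrite -(cond_exp_bounded s1 m1 i1 ce sf fM) -RintegralZl//.
have ce2 : is_cond_exp P G2 f (fun=> E f).
  split; [exact: cstG|exact: icst|move=> B G2B].
  have mB := m2 _ G2B.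
  transitivity ((E f)%:E * P B)%E; first exact: integral_cst.
  rewrite (Pfin _ mB) -EFinM mulrC -step1// -EA// fineK//.
  by apply: integrable_fin_num => //; apply: integrableS if_.
by rewrite -(cond_exp_bounded s2 m2 if_ ce2 sg gN) RintegralZl.
Qed.

(** At phase [- pi / 2] the transform gives [E sin (Z / N) = 0]; multiplied by [N], the integrand is
    dominated by [|Z|] and tends to [Z]. *)
Lemma cgauss_mean (Z : T -> R) v : cgauss P Z v -> E Z = 0.
Proof.
move=> hZ; have [i2 _] := cgauss_sqr hZ; have [mZ cZ] := hZ.
pose N (n : nat) : R := n.+1%:R.
have Ngt n : 0 < N n by rewrite ltr0n.
pose F n w := N n * sin (Z w / N n).
have FE n w : F n w = N n * cos ((N n)^-1 * Z w + - (pi / 2)).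
  by rewrite cosBpihalf /F (mulrC (Z w)).
have mF n : measurable_fun setT (F n).
  by rewrite (funext (FE n)); apply: measurable_funM => //; exact: measurable_cos_aff.
have EF n : E (F n) = 0.
  rewrite (funext (FE n)) RintegralZl//; last exact: intg_cos_aff.
  by rewrite cZ cosN cos_pihalf mul0r mulr0.
have c1 : E (F n) @[n --> \oo] --> E Z.
  apply: (@dominated_Rintegral _ _ _ P setT measurableT _ _ (fun w => `|Z w|)) => //.
  - by apply: intg_norm => //; apply: sqi_intg; split.
  - move=> w _; have := @derive_seq _ sin _ (Z w) (is_derive_sin 0).
    by rewrite cos0 mul1r; under eq_fun do rewrite sin0 subr0.
  - move=> n w _; rewrite normrM (gtr0_norm (Ngt n)) -ler_pdivlMl// (le_trans (ler_norm_sin _))//.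
    by rewrite normrM normfV (gtr0_norm (Ngt n)) mulrC.
have c2 : E (F n) @[n --> \oo] --> (0 : R) by under eq_fun do rewrite EF; exact: cvg_cst.
by have := cvg_unique _ c1 c2; apply.
Qed.

(** The transform is computed for [Z - m]; its mean is zero, which forces [m = 0]. The point mass
    [s = 0] is treated as an almost sure constant. *)
Lemma gaussian_cgauss (Z : {RV P >-> R}) : gaussian P Z -> E Z = 0 -> exists v, cgauss P Z v.
Proof.
move=> [m [s [s0 hZ]]] EZ.
have mZ : measurable_fun setT (Z : T -> R) by exact: measurable_funPT.
have mcos (u th : R) : measurable_fun setT (fun x : R => cos (u * (x - m) + th)).
  apply: continuous_measurable_fun; exact: is_derive_continuous (fun x => derive_cos_fun (derive_affine u m th x)).
suff H : cgauss P (fun w => Z w - m) (s ^+ 2).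
  have := cgauss_mean H; rewrite RintegralB//; last 2 first.
  - have i2 := (cgauss_sqr H).1; have mH := H.1.
    have := intgD measurableT (sqi_intg (conj mH i2)) (@intg_bounded _ _ _ P (fun=> m) `|m| (measurable_cst _) (fun=> lexx _)).
    by apply: eq_integrable => // w _ /=; rewrite subrK.
  - by apply: (@intg_bounded _ _ _ P _ `|m|).
  rewrite EZ Rintegral_prob_cst sub0r => /eqP; rewrite oppr_eq0 => /eqP m0.
  exists (s ^+ 2); move: H; rewrite m0; congr cgauss; apply/funext => w; by rewrite subr0.
split; first exact: measurable_funB.
move=> u th; have [s00|sn0] := eqVneq s 0.
  rewrite s00 expr0n/= mulr0 mul0r oppr0 expR0 mulr1.
  have -> : cos th = cos (u * (m - m) + th) by rewrite subrr mulr0 add0r.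
  have hA : P (Z @^-1` [set m]) = 1%E by rewrite hZ// s00 eqxx diracE mem_set.
  rewrite -[RHS](Rintegral_prob_cst P) /Rintegral; congr fine; apply: ae_eq_integral => //=.
  - by apply/measurable_EFinP; exact: (measurable_cos_aff u th (measurable_funB mZ (measurable_cst m))).
  - exists (~` (Z @^-1` [set m])).
    have mA : measurable (Z @^-1` [set m]) by rewrite -[X in measurable X]setTI; apply: mZ.
    split; [exact: measurableC| |].
      transitivity (1 - P (Z @^-1` [set m]))%E; first exact: probability_setC.
      by rewrite hA subee.
    move=> w /= h Zw; apply: h => _; congr (cos (u * (_ - m) + th))%:E; exact: Zw.
have sp : 0 < s by rewrite lt_def sn0.
rewrite -(normal_pdf_cos m u th sp).
have hZ' (B : set R) : measurable B -> P (Z @^-1` B) = normal_prob m s B.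
  by move=> mB; rewrite hZ// (negbTE sn0).
by rewrite -(@expectation_gaussian _ _ _ _ Z m s _ 1 sn0 hZ' (mcos u th))// => x; exact: cos_max.
Qed.

End IndependenceAndMoments.

Section LinearCombinations.
Variable R : realType.

(** A list of pairs, weight and time, indexes both a random variable and its spectral kernel, hence
    the polymorphic [f]. *)
Definition lcomb {A : Type} (f : R -> A -> R) (l : seq (R * R)) (x : A) : R :=
  \sum_(p <- l) p.1 * f p.2 x.

Definition scale_list (a : R) (l : seq (R * R)) := [seq (a * p.1, p.2) | p <- l].

Lemma lcomb_nil A (f : R -> A -> R) x : lcomb f [::] x = 0.
Proof. by rewrite /lcomb big_nil. Qed.

Lemma lcomb_cons A (f : R -> A -> R) p l x : lcomb f (p :: l) x = p.1 * f p.2 x + lcomb f l x.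
Proof. by rewrite /lcomb big_cons. Qed.

Lemma lcomb_cat A (f : R -> A -> R) l l' x : lcomb f (l ++ l') x = lcomb f l x + lcomb f l' x.
Proof. by rewrite /lcomb big_cat. Qed.

Lemma lcomb_scale A (f : R -> A -> R) a l x : lcomb f (scale_list a l) x = a * lcomb f l x.
Proof.
by rewrite /lcomb big_map mulr_sumr; apply: eq_bigr => p _ /=; rewrite mulrA.
Qed.

Lemma lcomb1 A (f : R -> A -> R) a t x : lcomb f [:: (a, t)] x = a * f t x.
Proof. by rewrite lcomb_cons lcomb_nil addr0. Qed.

(** Real part of the Hermitian inner product of the spectral space, normalised so that the kernels
    [vker s] have Gram matrix [fBm_cov]. *)
Definition ninner (H : R) (f g : bool -> R -> R) : R :=
  (2 * cosint H 1)^-1 * wint H (fun x => f true x * g true x + f false x * g false x).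

Definition decays2 (f : bool -> R -> R) := forall k, decays 1 (f k).

Lemma decays_ninner f g : decays2 f -> decays2 g ->
  decays 2 (fun x => f true x * g true x + f false x * g false x).
Proof. by move=> hf hg; apply: decaysD; apply: (@decaysM _ 1 1). Qed.

Lemma decays2_lin a f g : decays2 f -> decays2 g -> decays2 (fun k x => a * f k x + g k x).
Proof. by move=> hf hg k; exact: decays_lin. Qed.

Lemma decays2_lcomb (ker : bool -> R -> R -> R) l :
  (forall k t, 0 <= t -> decays 1 (ker k t)) -> (forall p, p \in l -> 0 <= p.2) ->
  decays2 (fun k => lcomb (ker k) l).
Proof.
move=> hk; elim: l => [|p l IH] hl k.
  rewrite (_ : lcomb _ _ = fun=> 0); first exact: decays0.
  by apply/funext => x; exact: lcomb_nil.
rewrite (_ : lcomb _ _ = fun x => p.1 * ker k p.2 x + lcomb (ker k) l x); last first.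
  by apply/funext => x; exact: lcomb_cons.
apply: decays_lin; first by apply: hk; apply: hl; rewrite inE eqxx.
by apply: (IH _ k) => q hq; apply: hl; rewrite inE hq orbT.
Qed.

Section Inner.
Variables (H : R) (hH : 0 < H < 1).

Lemma eq_ninner f f' g g' : (forall k x, 0 < x -> f k x = f' k x) ->
  (forall k x, 0 < x -> g k x = g' k x) -> ninner H f g = ninner H f' g'.
Proof. by move=> ff gg; congr (_ * _); apply: eq_wint => x x0; rewrite !ff// !gg. Qed.

Lemma ninnerC f g : ninner H f g = ninner H g f.
Proof. by congr (_ * _); apply: eq_wint => x x0; ring. Qed.

Lemma ninner_linl a f f' g : decays2 f -> decays2 f' -> decays2 g ->
  ninner H (fun k x => a * f k x + f' k x) g = a * ninner H f g + ninner H f' g.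
Proof.
move=> hf hf' hg; rewrite /ninner mulrCA -mulrDr -(wint_lin hH); try exact: decays_ninner.
by congr (_ * _); apply: eq_wint => x x0; ring.
Qed.

Lemma ninner_linr a f g g' : decays2 f -> decays2 g -> decays2 g' ->
  ninner H f (fun k x => a * g k x + g' k x) = a * ninner H f g + ninner H f g'.
Proof. by move=> hf hg hg'; rewrite !(ninnerC f) ninner_linl. Qed.

Lemma ninner_ge0 f : 0 <= ninner H f f.
Proof.
rewrite mulr_ge0 ?invr_ge0 ?mulr_ge0 ?(ltW (cosint_gt0 hH))//.
by apply: wint_ge0 => x x0; rewrite -!expr2 addr_ge0 ?sqr_ge0.
Qed.

Lemma ninner_sqr_lin a f g : decays2 f -> decays2 g ->
  ninner H (fun k x => a * f k x + g k x) (fun k x => a * f k x + g k x) =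
  a ^+ 2 * ninner H f f + 2 * a * ninner H f g + ninner H g g.
Proof.
move=> hf hg; have h := decays2_lin a hf hg.
by rewrite ninner_linl// !ninner_linr// (ninnerC g f); ring.
Qed.

Lemma ninner0l g : decays2 g -> ninner H (fun _ _ => 0) g = 0.
Proof.
move=> hg; have h0 : decays2 (fun _ _ => 0 : R) by move=> k; exact: decays0.
have := ninner_linl (-1) h0 h0 hg.
rewrite (@eq_ninner _ (fun _ _ => 0) g g) => [|k x _|//]; first lra.
by ring.
Qed.

Lemma ninner_cvg (F : nat -> bool -> R -> R) f (C : R) :
  (forall n, decays2 (F n)) ->
  (forall n k x, 0 < x -> `|F n k x| <= C * (1 + x)^-1) ->
  (forall k x, 0 < x -> F n k x @[n --> \oo] --> f k x) ->
  decays2 f /\ ninner H (F n) (F n) @[n --> \oo] --> ninner H f f.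
Proof.
move=> mF FC Ff.
have mf k : measurable_fun (`]0, +oo[%classic : set R) (f k).
  apply: (measurable_fun_cvg (h := fun n => F n k)); first by move=> n; case: (mF n k).
  by move=> x; rewrite halflineP; exact: Ff.
have fC k x : 0 < x -> `|f k x| <= C * (1 + x)^-1.
  move=> x0; have h : `|F n k x| @[n --> \oo] --> `|f k x| by apply: cvg_norm; exact: Ff.
  rewrite -(cvg_lim _ h)//; apply: limr_le; first by apply/cvg_ex; eexists; exact: h.
  by apply: nearW => n; exact: FC.
split; first by move=> k; split; [exact: mf|exists C; exact: fC].
apply: cvgM; first exact: cvg_cst.
apply: (@wint_cvg R H hH (fun n x => F n true x * F n true x + F n false x * F n false x)
  (fun x => f true x * f true x + f false x * f false x) (2 * C ^+ 2) _ _ _).2.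
- by move=> n; have [] := decays_ninner (mF n) (mF n).
- move=> n x x0; have S k : `|F n k x * F n k x| <= C ^+ 2 * (1 + x) ^- 2.
    by rewrite normrM -exprVn -exprMn expr2 ler_pM// FC.
  rewrite (le_trans (ler_normD _ _))// (le_trans (lerD (S _) (S _)))//; lra.
- by move=> x x0; apply: cvgD; apply: cvgM; exact: Ff.
Qed.

End Inner.
End LinearCombinations.

Section FractionalMoments.
Context d (T : measurableType d) (R : realType) (P : probability T R).
Local Notation E f := (Rintegral P setT f).
Variables (H : R) (hH : 0 < H < 1) (W : R -> {RV P >-> R}) (hW : fBm H W).
Local Notation Wf := (fun t => (W t : T -> R)).

(** Square integrability is read off the finiteness of the diagonal covariances. *)
Lemma fBm_moments (s t : R) : 0 <= s -> 0 <= t ->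
  [/\ sqi P setT (W s), E (W s) = 0 & E (fun w => W s w * W t w) = fBm_cov H s t].
Proof.
have [_ hE hC _] := hW => s0 t0.
have E0 r : 0 <= r -> fine ('E_P[W r])%E = 0 by move=> r0; rewrite hE.
have mW r : measurable_fun setT (W r : T -> R) by exact: measurable_funPT.
have C r q : 0 <= r -> 0 <= q -> (\int[P]_w (W r w * W q w)%:E = (fBm_cov H r q)%:E)%E.
  move=> r0 q0; rewrite -(hC _ _ r0 q0) covariance.unlock !hE// expectation.unlock.
  apply: eq_integral => w _ /=; by congr EFin; congr (_ * _); apply/esym; exact: subr0.
split.
- split; first exact: mW.
  apply/integrableP; split; first by apply/measurable_EFinP; exact: measurable_funX.
  rewrite (eq_integral (fun w => (W s w * W s w)%:E)) ?C ?ltry// => w _ /=.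
  by rewrite ger0_norm ?sqr_ge0// expr2.
- by have := hE s s0; rewrite expectation.unlock /Rintegral => ->.
- by rewrite /Rintegral C.
Qed.

End FractionalMoments.

(** Paths are constrained at nonnegative times only; clamping the time turns them into continuous
    functions on the whole line, to which the calculus lemmas apply. *)
Lemma continuous_clamp (R : realType) (f : R -> R) :
  {within `[0, +oo[, continuous f} -> continuous (fun s : R => f (Num.max s 0)).
Proof.
move=> /subspace_continuousP cf s.
have cm : Num.max z 0 @[z --> s] --> Num.max s 0.
  have E z : Num.max z 0 = (z + `|z|) / 2 :> R.
    case: (leP 0 z) => z0; first by rewrite ger0_norm//; field.
    by rewrite ltr0_norm// subrr mul0r.
  rewrite E; under eq_fun do rewrite E.
  apply: cvgM; last exact: cvg_cst.
  by apply: cvgD; [exact: cvg_id|apply: cvg_norm; exact: cvg_id].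
have A z : `[0, +oo[%classic (Num.max z 0 : R) by rewrite /= in_itv/= le_max lexx orbT.
have cw : Num.max z 0 @[z --> s] --> within `[0, +oo[%classic (nbhs (Num.max s 0 : R)).
  move=> U hU; have hU' : nbhs (Num.max s 0 : R) [set y | `[0, +oo[%classic y -> U y] := hU.
  have h2 : \forall z \near s, (`[0, +oo[%classic (Num.max z 0 : R) -> U (Num.max z 0)) := cm _ hU'.
  by apply: (filterS _ h2) => z; apply; exact: A.
exact: (cvg_comp _ _ cw (cf _ (A s))).
Qed.

Section SpectralRepresentation.
Context d (T : measurableType d) (R : realType) (P : probability T R).
Local Notation E f := (Rintegral P setT f).

Definition path (W : R -> {RV P >-> R}) (t : R) (w : T) : R := W t w.

Definition nonneg_times (l : seq (R * R)) := forall p, p \in l -> 0 <= p.2.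

Lemma nonneg_times_cons p l : nonneg_times (p :: l) -> 0 <= p.2 /\ nonneg_times l.
Proof.
move=> h; split; first by apply: h; rewrite inE eqxx.
by move=> q hq; apply: h; rewrite inE hq orbT.
Qed.

Lemma nonneg_times_cat l l' : nonneg_times l -> nonneg_times l' -> nonneg_times (l ++ l').
Proof. by move=> h h' p; rewrite mem_cat => /orP[/h|/h']. Qed.

Lemma nonneg_times_scale a l : nonneg_times l -> nonneg_times (scale_list a l).
Proof. by move=> h _ /mapP[p /h hp ->]. Qed.

Definition vcomb (l : seq (R * R)) (k : bool) : R -> R := lcomb (vker k) l.

Lemma decays2_vcomb l : nonneg_times l -> decays2 (vcomb l).
Proof. by move=> h; apply: decays2_lcomb => // k t; exact: decays_vker. Qed.

Section OneProcess.
Variables (H : R) (hH : 0 < H < 1) (W : R -> {RV P >-> R}) (hW : fBm H W).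

Lemma lcomb_path_meas l : measurable_fun setT (lcomb (path W) l).
Proof.
elim: l => [|p l IH].
  by rewrite (_ : lcomb _ _ = fun=> 0)//; apply/funext => w; exact: lcomb_nil.
rewrite (_ : lcomb _ _ = fun w => p.1 * path W p.2 w + lcomb (path W) l w); last first.
  by apply/funext => w; exact: lcomb_cons.
by apply: measurable_funD => //; apply: measurable_funM => //; exact: (@measurable_funPT _ _ _ _ (W p.2)).
Qed.

Lemma lcomb_path_mul s l : 0 <= s -> nonneg_times l ->
  [/\ sqi P setT (lcomb (path W) l), E (lcomb (path W) l) = 0 &
    E (fun w => lcomb (path W) l w * path W s w) =
    ninner H (vcomb l) (fun k => vker k s)].
Proof.
move=> s0; have [sW EW _] := fBm_moments hW s0 s0.
have ds : decays2 (fun k => @vker R k s) by move=> k; exact: decays_vker.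
elim: l => [|p l IH] hl.
  have e : lcomb (path W) [::] = fun=> 0 by apply/funext => w; exact: lcomb_nil.
  split.
  - rewrite e; split => //; apply: (@intg_bounded _ _ _ P _ 0) => // w.
    by rewrite expr0n normr0.
  - by rewrite e Rintegral_prob_cst.
  - rewrite -[RHS](_ : 0 = _); last first.
      rewrite -(ninner0l hH ds); apply: eq_ninner => // k x _.
      by rewrite /vcomb lcomb_nil.
    rewrite -[RHS](Rintegral_prob_cst P); apply: eq_Rintegral => w _.
    by rewrite lcomb_nil mul0r.
have [p0 hl'] := nonneg_times_cons hl; have [sl El Hl] := IH hl'.
have [sp Ep Hp] := fBm_moments hW p0 s0.
have e : lcomb (path W) (p :: l) = fun w => p.1 * path W p.2 w + lcomb (path W) l w.
  by apply/funext => w; exact: lcomb_cons.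
split.
- by rewrite e; exact: sqi_lin.
- have i1 := sqi_intg sp; have i2 := sqi_intg sl.
  rewrite e RintegralD//; last exact: intgZ.
  by rewrite RintegralZl// El Ep mulr0 addr0.
- rewrite e E_mul_linl// Hl (fBm_cov_spectral hH p0 s0) in Hp *.
  rewrite [X in _ * X + _]Hp -/(ninner H (fun k => vker k p.2) (fun k => vker k s)).
  rewrite -ninner_linl//; [|by move=> k; exact: decays_vker|exact: decays2_vcomb].
  by apply: eq_ninner => // k x _; rewrite /vcomb lcomb_cons.
Qed.

Lemma lcomb_path_sqr l : nonneg_times l ->
  E (fun w => lcomb (path W) l w ^+ 2) = ninner H (vcomb l) (vcomb l).
Proof.
move=> hl; have [sl _ _] := lcomb_path_mul (lexx 0) hl.
suff S l' : nonneg_times l' ->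
    E (fun w => lcomb (path W) l' w * lcomb (path W) l w) = ninner H (vcomb l') (vcomb l).
  by rewrite -S//; apply: eq_Rintegral => w _; rewrite expr2.
elim: l' => [|p l' IH] hl'.
  rewrite -[RHS](_ : 0 = _); last first.
    rewrite -(ninner0l hH (decays2_vcomb hl)); apply: eq_ninner => // k x _.
    by rewrite /vcomb lcomb_nil.
  rewrite -[RHS](Rintegral_prob_cst P); apply: eq_Rintegral => w _.
  by rewrite lcomb_nil mul0r.
have [p0 hl''] := nonneg_times_cons hl'.
have [_ _ Hp] := lcomb_path_mul p0 hl.
have [sp _ _] := fBm_moments hW p0 p0; have [sl' _ _] := lcomb_path_mul (lexx 0) hl''.
have e : lcomb (path W) (p :: l') = fun w => p.1 * path W p.2 w + lcomb (path W) l' w.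
  by apply/funext => w; exact: lcomb_cons.
have e2 : E (fun w => path W p.2 w * lcomb (path W) l w) = ninner H (vcomb l) (fun k => vker k p.2).
  by rewrite -Hp; apply: eq_Rintegral => w _; rewrite mulrC.
rewrite e E_mul_linl// IH// e2 (ninnerC _ (vcomb l)).
rewrite -ninner_linl//; [|by move=> k; exact: decays_vker|exact: decays2_vcomb|exact: decays2_vcomb].
by apply: eq_ninner => // k x _; rewrite /vcomb lcomb_cons.
Qed.

Lemma lcomb_path_cgauss l : nonneg_times l ->
  cgauss P (lcomb (path W) l) (ninner H (vcomb l) (vcomb l)).
Proof.
move=> hl; have [gW _ _ _] := hW.
pose Z := lcomb (path W) l; have mZ : measurable_fun setT Z by exact: lcomb_path_meas.
pose ZM := isMeasurableFun.Build _ _ _ _ Z mZ.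
pose Zr : {RV P >-> R} := HB.pack Z ZM.
have [_ EZ _] := lcomb_path_mul (lexx 0) hl.
have gZ : gaussian P Zr.
  have := gW (size l) (fun i => (tnth (in_tuple l) i).2) (fun i => (tnth (in_tuple l) i).1) (fun i => hl _ (mem_tnth i (in_tuple l))).
  congr gaussian; apply/funext => w /=.
  by rewrite /Z /lcomb [in RHS]big_tnth.
have [v hv] := gaussian_cgauss gZ EZ.
have [_ e] := cgauss_sqr hv; move: hv; rewrite -e.
by rewrite -(lcomb_path_sqr hl).
Qed.

(* [f] is the spectral representative of [Z]: covariances of such variables are
   inner products of their representatives. *)
Definition srep (Z : T -> R) (f : bool -> R -> R) :=
  exists (l : nat -> seq (R * R)) (C : R),
  [/\ forall n, nonneg_times (l n),
      forall w, lcomb (path W) (l n) w @[n --> \oo] --> Z w,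
      forall k x, 0 < x -> vcomb (l n) k x @[n --> \oo] --> f k x
    & forall n k x, 0 < x -> `|vcomb (l n) k x| <= C * (1 + x)^-1].

Lemma srep_cgauss Z f : srep Z f -> decays2 f /\ cgauss P Z (ninner H f f).
Proof.
move=> [l [C [hl lZ lf lC]]].
have [df c] := ninner_cvg hH (fun n => decays2_vcomb (hl n)) lC lf.
split => //; apply: cgauss_cvg lZ c => n; exact: lcomb_path_cgauss.
Qed.

Lemma srep_lin a Z f Z' f' : srep Z f -> srep Z' f' ->
  srep (fun w => a * Z w + Z' w) (fun k x => a * f k x + f' k x).
Proof.
move=> [l [C [hl lZ lf lC]]] [l' [C' [hl' lZ' lf' lC']]].
exists (fun n => scale_list a (l n) ++ l' n), (`|a| * C + C'); split.
- by move=> n; apply: nonneg_times_cat => //; exact: nonneg_times_scale.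
- move=> w; rewrite (_ : (fun n => _) = fun n => a * lcomb (path W) (l n) w + lcomb (path W) (l' n) w).
    by apply: cvgD => //; apply: cvgM => //; exact: cvg_cst.
  by apply/funext => n; rewrite lcomb_cat lcomb_scale.
- move=> k x x0; rewrite (_ : (fun n => _) = fun n => a * vcomb (l n) k x + vcomb (l' n) k x).
    by apply: cvgD; [apply: cvgM; [exact: cvg_cst|exact: lf]|exact: lf'].
  by apply/funext => n; rewrite /vcomb lcomb_cat lcomb_scale.
- move=> n k x x0; rewrite /vcomb lcomb_cat lcomb_scale mulrDl.
  rewrite (le_trans (ler_normD _ _))// lerD//; last exact: lC'.
  by rewrite normrM -mulrA ler_wpM2l// lC.
Qed.

Lemma srep_path t : 0 <= t -> srep (path W t) (fun k => vker k t).
Proof.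
move=> t0; exists (fun=> [:: (1, t)]), (t + 2); split.
- by move=> n p; rewrite inE => /eqP ->.
- by move=> w; rewrite lcomb1 mul1r; exact: cvg_cst.
- by move=> k x x0; rewrite /vcomb lcomb1 mul1r; exact: cvg_cst.
- by move=> n k x x0; rewrite /vcomb lcomb1 mul1r; apply: vker_bound; rewrite ?t0/=.
Qed.

Definition riemann_list (t : R) (n : nat) : seq (R * R) :=
  [seq (t / n.+1%:R, t * j%:R / n.+1%:R) | j <- iota 0 n.+1].

Lemma riemann_list_times t n p : 0 <= t -> p \in riemann_list t n -> 0 <= p.2 <= t.
Proof.
move=> t0 /mapP[j]; rewrite mem_iota add0n => /andP[_ jn] -> /=.
rewrite !mulr_ge0 ?invr_ge0//= -mulrA ler_piMr// ler_pdivrMr ?ltr0n// mul1r ler_nat.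
exact: ltnW.
Qed.

Lemma continuous_vker k (x : R) : continuous (fun s => vker k s x).
Proof.
case: k; rewrite /vker.
  have h (s : R) := deriveM_fun (derive_sin_fun (derive_affine x 0 0 s)) (is_derive_cst (x^-1 : R) s 1).
  have := is_derive_continuous h; congr (forall x, _); apply/funext => s.
  by congr (continuous_at _ _); apply/funext => y; rewrite subr0 addr0.
have h (s : R) := deriveM_fun (deriveD_fun (is_derive_cst (1 : R) s 1) (deriveN_fun (derive_cos_fun (derive_affine x 0 0 s)))) (is_derive_cst (x^-1 : R) s 1).
have := is_derive_continuous h; congr (forall x, _); apply/funext => s.
by congr (continuous_at _ _); apply/funext => y; rewrite subr0 addr0.
Qed.

(** A Riemann sum with coefficient [c] is again a finite list of weighted times, so time integrals
    of a process are limits of finite combinations. *)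
Definition weighted_list (c : R -> R) (t : R) (n : nat) : seq (R * R) :=
  [seq (c p.2 * p.1, p.2) | p <- riemann_list t n].

Lemma weighted_list_times c t n : 0 <= t -> nonneg_times (weighted_list c t n).
Proof. by move=> t0 _ /mapP[p hp ->]; have /andP[] := riemann_list_times t0 hp. Qed.

Lemma lcomb_weighted_list A (f : R -> A -> R) c t n x :
  lcomb f (weighted_list c t n) x = riemann_sum (fun s => c s * f s x) t n.
Proof.
rewrite /lcomb /weighted_list /riemann_list -map_comp big_map /riemann_sum mulr_sumr.
rewrite -[iota _ _]/(index_iota 0 n.+1) big_mkord; apply: eq_bigr => j _ /=; ring.
Qed.

Lemma weighted_list_cvg (c : R -> R) (t : R) k x : 0 <= t -> continuous c ->
  vcomb (weighted_list c t n) k x @[n --> \oo] -->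
  Rintegral (@lebesgue_measure R) `[0, t] (fun s => c s * vker k s x).
Proof.
move=> t0 cc; have cv : continuous (fun s => c s * vker k s x).
  by move=> s; apply: cvgM; [exact: cc|exact: continuous_vker].
apply: cvg_trans (riemann_sum_integral t0 cv); apply: near_eq_cvg; apply: nearW => n.
by rewrite /vcomb lcomb_weighted_list.
Qed.

Lemma weighted_list_bound (c : R -> R) (t : R) : 0 <= t -> continuous c ->
  exists C, forall n k x, 0 < x -> `|vcomb (weighted_list c t n) k x| <= C * (1 + x)^-1.
Proof.
move=> t0 cc; have [M [M0 cM]] : exists M, 0 <= M /\ forall s, 0 <= s <= t -> `|c s| <= M.
  have cn : {within `[0, t], continuous (fun s => `|c s|)}.
    by apply: continuous_subspaceT => s; apply: cvg_norm; exact: cc.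
  have [m _ hm] := EVT_max t0 cn.
  by exists `|c m|; split=> // s hs; apply: hm; rewrite in_itv.
exists (t * (M * (t + 2))) => n k x x0; rewrite /vcomb lcomb_weighted_list /riemann_sum.
have N0 : 0 < n.+1%:R :> R by rewrite ltr0n.
have B (j : 'I_n.+1) : `|c (t * j%:R / n.+1%:R) * vker k (t * j%:R / n.+1%:R) x| <= M * (t + 2) * (1 + x)^-1.
  have h : 0 <= t * j%:R / n.+1%:R <= t.
    apply: (@riemann_list_times t n (t / n.+1%:R, t * j%:R / n.+1%:R) t0).
    by apply/mapP; exists (j : nat) => //; rewrite mem_iota/= add0n.
  by rewrite normrM -[leRHS]mulrA ler_pM// ?cM//; exact: vker_bound.
rewrite normrM ger0_norm ?divr_ge0//.
apply: (@le_trans _ _ (t / n.+1%:R * \sum_(j < n.+1) (M * (t + 2) * (1 + x)^-1))).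
  rewrite ler_wpM2l ?divr_ge0// (le_trans (ler_norm_sum _ _ _))//.
  by apply: ler_sum => j _; exact: B.
rewrite sumr_const card_ord -[M * (t + 2) * _ *+ _]mulr_natr.
set a := M * (t + 2) * _; rewrite [X in X <= _](_ : _ = t * a); first by rewrite /a !mulrA.
by field; rewrite gt_eqF.
Qed.

Lemma srep_riemann (c : R -> R) (t : R) (Z : T -> R) : 0 <= t -> continuous c ->
  (forall w, riemann_sum (fun s => c s * path W s w) t @ \oo --> Z w) ->
  srep Z (fun k x => Rintegral (@lebesgue_measure R) `[0, t] (fun s => c s * vker k s x)).
Proof.
move=> t0 cc cZ; have [C hC] := weighted_list_bound t0 cc.
exists (weighted_list c t), C; split => // [n|w|k x x0]; first exact: weighted_list_times.
- by apply: cvg_trans (cZ w); apply: near_eq_cvg; apply: nearW => n; rewrite lcomb_weighted_list.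
- exact: weighted_list_cvg.
Qed.

Lemma srep_ext Z f g : (forall k x, 0 < x -> f k x = g k x) -> srep Z f -> srep Z g.
Proof.
by move=> fg [l [C [h1 h2 h3 h4]]]; exists l, C; split => // k x x0; rewrite -fg//; exact: h3.
Qed.

Lemma int_vker k t (x : R) : 0 <= t -> 0 < x ->
  Rintegral (@lebesgue_measure R) `[0, t] (fun s => vker k s x) = uker k t x.
Proof.
move=> t0 x0; have [->|tn] := eqVneq t 0.
  rewrite set_itv1 Rintegral_set1; case: k; rewrite /uker mulr0 ?cos0 ?sin0 ?subrr ?mul0r//.
  by rewrite subr0 mul0r.
have tp : 0 < t by rewrite lt_def tn.
rewrite (FTC2 tp (@continuous_vker k x) (fun s => derive_uker k s x0)).
have -> : uker k 0 x = 0.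
  by case: (k); rewrite /uker mulr0 ?cos0 ?sin0 ?subrr ?mul0r ?subr0 ?mul0r.
by rewrite subr0.
Qed.

Lemma srep_integral t : 0 <= t ->
  srep (fun w => Rintegral (@lebesgue_measure R) `[0, t] (path W ^~ w)) (fun k => uker k t).
Proof.
move=> t0; have [_ _ _ cW] := hW.
have c1 : continuous (fun _ : R => 1 : R) by move=> s; exact: cvg_cst.
have sr := @srep_riemann (fun=> 1) t (fun w => Rintegral (@lebesgue_measure R) `[0, t] (path W ^~ w)) t0 c1.
refine (srep_ext _ (sr _)) => [k x x0|w].
  transitivity (Rintegral (@lebesgue_measure R) `[0, t] (fun s => vker k s x)).
    by apply: eq_Rintegral => s _; rewrite mul1r.
  exact: int_vker.
have cg := continuous_clamp (cW w).
have -> : Rintegral (@lebesgue_measure R) `[0, t] (path W ^~ w) =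
    Rintegral (@lebesgue_measure R) `[0, t] (fun s => path W (Num.max s 0) w).
  by apply: eq_Rintegral => s; rewrite inE/= in_itv/= => /andP[s0 _]; rewrite max_l.
apply: cvg_trans (riemann_sum_integral t0 cg); apply: near_eq_cvg; apply: nearW => n.
rewrite /riemann_sum; congr (_ * _); apply: eq_bigr => j _.
by rewrite mul1r max_l// !mulr_ge0// invr_ge0.
Qed.

Lemma srep_smeas Z f : srep Z f -> smeas (sigma_process `[0, +oo[%classic W) Z.
Proof.
move=> [l [C [hl lZ _ _]]].
have sF : sigma_algebra setT (sigma_process `[0, +oo[%classic W) by exact: smallest_sigma_algebra.
apply/(smeas_mfun sF).
pose T' := g_sigma_algebraType (sigma_process `[0, +oo[%classic W).
apply: (@measurable_fun_cvg _ T' R setT (fun n => (lcomb (path W) (l n) : T' -> R))) => [n|w _]; last exact: lZ.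
elim: (l n) (hl n) => [_|p q IH /nonneg_times_cons[p0 hq]].
  rewrite (_ : lcomb _ _ = fun=> 0); first exact: measurable_cst.
  by apply/funext => w; exact: lcomb_nil.
rewrite (_ : lcomb _ _ = fun w => p.1 * path W p.2 w + lcomb (path W) q w); last first.
  by apply/funext => w; exact: lcomb_cons.
apply: measurable_funD; last exact: IH.
apply: measurable_funM; first exact: measurable_cst.
apply/(smeas_mfun sF) => B mB; apply: sub_sigma_algebra.
by exists p.2; [rewrite /= in_itv/= p0|exists B => //; rewrite setTI].
Qed.

End OneProcess.
End SpectralRepresentation.

Section MeasurabilityClosure.
Context d (T : measurableType d) (R : realType) (F : set (set T)).
Hypothesis sF : sigma_algebra setT F.
Implicit Types Z : T -> R.

Lemma smeas_lin (a : R) Z Z' : smeas F Z -> smeas F Z' -> smeas F (fun w => a * Z w + Z' w).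
Proof.
move=> /(smeas_mfun sF) h /(smeas_mfun sF) h'; apply/(smeas_mfun sF).
by apply: measurable_funD => //; apply: measurable_funM.
Qed.

Lemma smeas_cst (a : R) : smeas F (fun=> a).
Proof. by apply/(smeas_mfun sF); exact: measurable_cst. Qed.

Lemma smeas_cvg (Z_ : nat -> T -> R) Z : (forall n, smeas F (Z_ n)) ->
  (forall w, Z_ ^~ w @ \oo --> Z w) -> smeas F Z.
Proof.
move=> h hZ; apply/(smeas_mfun sF); pose T' := g_sigma_algebraType F.
apply: (@measurable_fun_cvg _ T' R setT (fun n => (Z_ n : T' -> R))) => [n|w _]; last exact: hZ.
exact/(smeas_mfun sF).
Qed.

Lemma smeas_lcomb (Z : R -> T -> R) l : (forall p, p \in l -> smeas F (Z p.2)) ->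
  smeas F (lcomb Z l).
Proof.
elim: l => [|p l IH] h.
  by rewrite (_ : lcomb _ _ = fun=> 0); [exact: smeas_cst|apply/funext => w; rewrite lcomb_nil].
rewrite (_ : lcomb _ _ = fun w => p.1 * Z p.2 w + lcomb Z l w); last first.
  by apply/funext => w; exact: lcomb_cons.
apply: smeas_lin; first by apply: h; rewrite inE eqxx.
by apply: IH => q hq; apply: h; rewrite inE hq orbT.
Qed.

Lemma smeas_riemann (c : R -> R) (Z : R -> T -> R) t Y : 0 <= t ->
  (forall s, 0 <= s <= t -> smeas F (Z s)) ->
  (forall w, riemann_sum (fun s => c s * Z s w) t @ \oo --> Y w) -> smeas F Y.
Proof.
move=> t0 hZ; apply: smeas_cvg => n.
rewrite -(funext (lcomb_weighted_list Z c t n)); apply: smeas_lcomb => _ /mapP[p hp ->] /=.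
by apply: hZ; exact: riemann_list_times hp.
Qed.

End MeasurabilityClosure.

Section SigmaProcess.
Context d (T : measurableType d) (R : realType) (P : probability T R).
Implicit Types (Y : R -> {RV P >-> R}) (I : set R).

Lemma sigma_process_sigma I Y : sigma_algebra setT (sigma_process I Y).
Proof. exact: smallest_sigma_algebra. Qed.

Lemma sigma_process_meas I Y : sigma_process I Y `<=` measurable.
Proof.
apply: smallest_sub; first exact: sigma_algebra_measurable.
move=> A [s _ [B mB <-]]; rewrite setTI -[X in measurable X]setTI.
exact: (@measurable_funPT _ _ _ _ (Y s)).
Qed.

Lemma sigma_process_smeas I Y s : I s -> smeas (sigma_process I Y) (Y s).
Proof. by move=> Is B mB; apply: sub_sigma_algebra; exists s => //; exists B => //; rewrite setTI. Qed.

Lemma sigma_process_sub I Y (S : set (set T)) : sigma_algebra setT S ->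
  (forall s, I s -> smeas S (Y s)) -> sigma_process I Y `<=` S.
Proof.
move=> sS h; apply: smallest_sub => //.
by move=> A [s Is [B mB <-]]; rewrite setTI; exact: h.
Qed.

End SigmaProcess.

Section TwoProcesses.
Context d (T : measurableType d) (R : realType) (P : probability T R).
Local Notation E f := (Rintegral P setT f).
Variables (H1 H2 : R) (hH1 : 0 < H1 < 1) (hH2 : 0 < H2 < 1).
Variables (W V : R -> {RV P >-> R}) (hW : fBm H1 W) (hV : fBm H2 V).
Hypothesis hWV : independent_processes W V.

Definition srep2 (Z : T -> R) (f1 f2 : bool -> R -> R) := exists Z1 Z2 : T -> R,
  [/\ forall w, Z w = Z1 w + Z2 w, srep W Z1 f1 & srep V Z2 f2].

(** The addition formula splits the transform of the sum into a cosine product and a sine product.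
    Independence factorises both, and the second vanishes because the sine transform of [Z1] at
    phase zero does. *)
Lemma cgaussD (Z1 Z2 : T -> R) v1 v2 :
  smeas (sigma_process `[0, +oo[%classic W) Z1 ->
  smeas (sigma_process `[0, +oo[%classic V) Z2 ->
  cgauss P Z1 v1 -> cgauss P Z2 v2 -> cgauss P (fun w => Z1 w + Z2 w) (v1 + v2).
Proof.
move=> s1 s2 [m1 c1] [m2 c2]; split; first exact: measurable_funD.
move=> u th.
have sc (G : set (set T)) (Z : T -> R) a : sigma_algebra setT G -> smeas G Z ->
    smeas G (fun w => cos (u * Z w + a)).
  move=> sG hZ B mB; rewrite (_ : _ @^-1` B = Z @^-1` ((fun x => cos (u * x + a)) @^-1` B))//.
  apply: hZ; rewrite -[X in measurable X]setTI.
  by have := continuous_measurable_fun (@continuous_cos_aff R u a); apply.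
have S1 := @sigma_process_sigma _ _ _ P `[0, +oo[%classic W.
have S2 := @sigma_process_sigma _ _ _ P `[0, +oo[%classic V.
have ind a b : E (fun w => cos (u * Z1 w + a) * cos (u * Z2 w + b)) =
    E (fun w => cos (u * Z1 w + a)) * E (fun w => cos (u * Z2 w + b)).
  apply: (indep_Rintegral (M := 1) (N := 1) S1 S2); try exact: sigma_process_meas; try exact: hWV.
  - exact: sc.
  - exact: sc.
  - by move=> w; exact: cos_max.
  - by move=> w; exact: cos_max.
pose A w := cos (u * Z1 w + 0) * cos (u * Z2 w + th).
pose B w := cos (u * Z1 w + - (pi / 2)) * cos (u * Z2 w + (th - pi / 2)).
have iM a b : P.-integrable setT (EFin \o (fun w => cos (u * Z1 w + a) * cos (u * Z2 w + b))).
  apply: (@intg_bounded _ _ _ P _ 1).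
    by apply: measurable_funM; exact: measurable_cos_aff.
  by move=> w; rewrite normrM mulr_ile1// cos_max.
transitivity (E A - E B).
  rewrite -RintegralB//; try exact: iM.
  apply: eq_Rintegral => w _; rewrite /A /B addr0 cosBpihalf addrA cosBpihalf -cosD.
  by congr cos; ring.
rewrite /A /B !ind !c1 !c2 cosN cos_pihalf cos0 !mul0r subr0 mul1r mulrCA -expRD.
by congr (_ * expR _); field.
Qed.

Lemma srep2_cgauss Z f1 f2 : srep2 Z f1 f2 ->
  [/\ decays2 f1, decays2 f2 & cgauss P Z (ninner H1 f1 f1 + ninner H2 f2 f2)].
Proof.
move=> [Z1 [Z2 [ZE s1 s2]]].
have [d1 c1] := srep_cgauss hH1 hW s1; have [d2 c2] := srep_cgauss hH2 hV s2.
split => //; rewrite (funext ZE); apply: cgaussD => //; [exact: srep_smeas s1|exact: srep_smeas s2].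
Qed.

Lemma srep2_lin a Z Z' f1 f2 f1' f2' : srep2 Z f1 f2 -> srep2 Z' f1' f2' ->
  srep2 (fun w => a * Z w + Z' w) (fun k x => a * f1 k x + f1' k x) (fun k x => a * f2 k x + f2' k x).
Proof.
move=> [Z1 [Z2 [ZE s1 s2]]] [Z1' [Z2' [ZE' s1' s2']]].
exists (fun w => a * Z1 w + Z1' w), (fun w => a * Z2 w + Z2' w); split; [|exact: srep_lin..].
by move=> w; rewrite ZE ZE'; ring.
Qed.

Lemma srep0 (U : R -> {RV P >-> R}) : srep U (fun=> 0) (fun _ _ => 0).
Proof.
exists (fun=> [::]), 0; split => //.
- by move=> w; rewrite lcomb_nil; exact: cvg_cst.
- by move=> k x x0; rewrite /vcomb lcomb_nil; exact: cvg_cst.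
- by move=> n k x x0; rewrite /vcomb lcomb_nil normr0 mul0r.
Qed.

Lemma srep2_ext Z Z' f1 f1' f2 f2' : (forall w, Z w = Z' w) ->
  (forall k x, f1 k x = f1' k x) -> (forall k x, f2 k x = f2' k x) ->
  srep2 Z f1 f2 -> srep2 Z' f1' f2'.
Proof.
move=> /funext -> h1 h2.
by have -> : f1 = f1'; [apply/funext => k; exact/funext|have -> : f2 = f2' by apply/funext => k; exact/funext].
Qed.

Lemma srep2l Z f : srep W Z f -> srep2 Z f (fun _ _ => 0).
Proof. by move=> h; exists Z, (fun=> 0); split => //; [move=> w; rewrite addr0|exact: srep0]. Qed.

Lemma srep2r Z f : srep V Z f -> srep2 Z (fun _ _ => 0) f.
Proof. by move=> h; exists (fun=> 0), Z; split => //; [move=> w; rewrite add0r|exact: srep0]. Qed.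

Definition gspace Z := exists f1 f2, srep2 Z f1 f2.

Lemma gspace_gaussian : gaussian_space P gspace.
Proof.
split=> [Z [f1 [f2 /srep2_cgauss[_ _ h]]]|a Z Z' [f1 [f2 h]] [f1' [f2' h']]].
  by exists (ninner H1 f1 f1 + ninner H2 f2 f2).
by eexists; eexists; exact: srep2_lin h h'.
Qed.

Lemma srep2_sqr Z f1 f2 : srep2 Z f1 f2 ->
  E (fun w => Z w ^+ 2) = ninner H1 f1 f1 + ninner H2 f2 f2.
Proof. by move=> /srep2_cgauss[_ _ /cgauss_sqr[]]. Qed.

End TwoProcesses.

(** * The filtering error as a least squares problem *)

Section PathwiseEquations.
Context {R : realType}.
Local Notation mu := (@lebesgue_measure R).
Local Notation halfline := (`[0, +oo[%classic : set R).
Local Notation int f t := (Rintegral mu `[0, t] f).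
Implicit Types (f g x : R -> R) (a b t : R).

Lemma within_segment f t : {within halfline, continuous f} ->
  {within `[0, t], continuous f}.
Proof.
apply: continuous_subspaceW => s; rewrite /= !in_itv/= andbT.
by case/andP.
Qed.

Lemma within_intg f t : {within halfline, continuous f} ->
  mu.-integrable `[0, t] (EFin \o f).
Proof.
move=> cf; apply: continuous_compact_integrable; first exact: segment_compact.
exact: within_segment.
Qed.

Lemma within_ext f g : (forall t, 0 <= t -> f t = g t) ->
  {within halfline, continuous g} -> {within halfline, continuous f}.
Proof.
move=> fg; apply: subspace_eq_continuous => s; rewrite inE/= in_itv/= andbT => s0.
exact/esym/fg.
Qed.

Lemma within_lin a f g : {within halfline, continuous f} ->
  {within halfline, continuous g} -> {within halfline, continuous (fun t => a * f t + g t)}.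
Proof.
move=> cf cg s; apply: (@cvgD _ _ _ (nbhs _)); last exact: cg.
by apply: (@cvgM _ _ (nbhs _)); [exact: cvg_cst|exact: cf].
Qed.

Lemma int_clamp f t : int f t = int (fun s => f (Num.max s 0)) t.
Proof.
by apply: eq_Rintegral => s; rewrite inE/= in_itv/= => /andP[s0 _]; rewrite max_l.
Qed.

Lemma riemann_sum_eq f g t n : 0 <= t -> (forall s, 0 <= s -> f s = g s) ->
  riemann_sum f t n = riemann_sum g t n.
Proof.
move=> t0 fg; rewrite /riemann_sum; congr (_ * _); apply: eq_bigr => j _.
by rewrite fg// !mulr_ge0// invr_ge0.
Qed.

Lemma riemann_sum_within f t : 0 <= t -> {within halfline, continuous f} ->
  riemann_sum f t @ \oo --> int f t.
Proof.
move=> t0 cf; rewrite int_clamp.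
apply: cvg_trans (riemann_sum_integral t0 (continuous_clamp cf)).
apply: near_eq_cvg; apply: nearW => n; apply: riemann_sum_eq => // s s0.
by rewrite max_l.
Qed.

Lemma continuous_int f : {within halfline, continuous f} ->
  {within halfline, continuous (fun t => int f t)}.
Proof.
move=> cf; have [F [dF FE]] := primitive_ext (continuous_clamp cf).
apply: (@within_ext _ (fun t => F (Num.max t 0) - F 0)).
  by move=> t t0; rewrite int_clamp -FE// max_l.
apply: continuous_subspaceT => t; apply: cvgB; last exact: cvg_cst.
have m0 : 0 <= Num.max t 0 :> R by rewrite le_max lexx orbT.
apply: (@continuous_comp _ _ _ (fun t : R => Num.max t 0) F).
  apply: (@continuous_clamp R id); apply: continuous_subspaceT => s; exact: cvg_id.
apply: differentiable_continuous; apply/derivable1_diffP.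
by have [] := dF (Num.max t 0) (lt_le_trans (ltrN10 R) m0).
Qed.

(* [expR (- b * t) * int y t] is an antiderivative of the summand. *)
Lemma riemann_sum_ode b y t : 0 <= t -> {within halfline, continuous y} ->
  riemann_sum (fun s => expR (- b * s) * (y s - b * int y s)) t @ \oo -->
  expR (- b * t) * int y t.
Proof.
move=> t0 cy; have cc := continuous_clamp cy.
have [F [dF FE]] := primitive_ext cc.
pose G s := expR (- b * s) * (F s - F 0).
pose g s := expR (- b * s) * (y (Num.max s 0) - b * (F s - F 0)).
have de (s : R) : is_derive s 1 (fun s : R => expR (- b * s)) (expR (- b * s) * (- b)).
  apply: derive_expR_fun; apply: is_derive_ext (derive_affine (- b) 0 0 s) => // z.
  by rewrite subr0 addr0.
have dG (s : R) : -1 < s -> is_derive s 1 G (g s).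
  move=> s1; have dB := deriveD_fun (dF s s1) (is_derive_cst (- F 0 : R) s 1).
  apply: is_derive_ext (deriveM_fun (de s) dB) => //; rewrite /g/=; ring.
have cg (s : R) : 0 <= s -> {for s, continuous g}.
  move=> s0; apply: cvgM; first exact: (is_derive_continuous de).
  apply: cvgB; first exact: cc.
  apply: cvgM; first exact: cvg_cst.
  apply: cvgB; last exact: cvg_cst.
  apply: differentiable_continuous; apply/derivable1_diffP.
  by have [] := dF s (lt_le_trans (ltrN10 R) s0).
have := riemann_sum_cvg t0 cg dG.
rewrite /G subrr mulr0 subr0 FE// -int_clamp => h; apply: cvg_trans h.
apply: near_eq_cvg; apply: nearW => n; apply: riemann_sum_eq => // s s0.
by rewrite /g max_l// FE// -int_clamp.
Qed.

Lemma int_lin a f g t : {within halfline, continuous f} -> {within halfline, continuous g} ->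
  int (fun s => a * f s + g s) t = a * int f t + int g t.
Proof.
move=> cf cg; have i1 := @within_intg _ t cf; have i2 := @within_intg _ t cg.
rewrite RintegralD//; last exact: intgZ.
by rewrite RintegralZl.
Qed.

Section StateEquation.
Variables (b : R) (x W : R -> R).
Hypothesis cW : {within halfline, continuous W}.
Hypothesis hx : forall t, 0 <= t ->
  mu.-integrable `[0, t] (EFin \o x) /\ x t = b * int x t + W t.

(** The state equation assumes integrability only: the integral is continuous first, and
    [state_continuous] then reads continuity of [x] off the equation. *)
Lemma state_int_continuous : {within halfline, continuous (fun t => int x t)}.
Proof.
apply/subspace_continuousP => t; rewrite /= in_itv/= andbT => t0.
have t1 : 0 < t + 1 by rewrite ltr_wpDl.
have [ix _] := hx (ltW t1).
have ct := @parameterized_integral_continuous R 0 (t + 1) x (ltW t1) ix.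
have tm : `[0, t + 1]%classic t by rewrite /= in_itv/= t0/= lerDl.
have /subspace_continuousP/(_ _ tm) h := ct.
move=> U hU.
have h1 : \forall s \near t, `[0, t + 1]%classic s -> U (int x s) := h U hU.
have h2 : \forall s \near t, s < t + 1 by apply: lt_nbhsl; rewrite ltrDl.
suff : \forall s \near t, `[0, +oo[%classic s -> U (int x s) by [].
apply: filterS2 h1 h2 => s h1 h2; rewrite /= in_itv/= andbT => s0; apply: h1.
by rewrite /= in_itv/= s0 ltW.
Qed.

Lemma state_continuous : {within halfline, continuous x}.
Proof.
apply: (@within_ext _ (fun t => b * int x t + W t)); first by move=> t /hx[].
by apply: within_lin => //; exact: state_int_continuous.
Qed.

End StateEquation.
End PathwiseEquations.

Section FilteringError.
Context d (T : measurableType d) (R : realType) (P : probability T R).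
Local Notation E f := (Rintegral P setT f).
Local Notation leb := (@lebesgue_measure R).
Local Notation int f t := (Rintegral leb `[0, t] f).
Variables (H1 H2 : R) (hH1 : 0 < H1 < 1) (hH2 : 0 < H2 < 1).

Definition horizon (t : R) (l : seq (R * R)) := forall p, p \in l -> 0 <= p.2 <= t.

(* Representatives of the [W]- and [V]-parts of
   [X_t - (b / mu) Y_t - \sum_(p <- l) p.1 * whitened p.2]; the second one is
   stripped of the factor [- sqrt eps]. *)
Definition state_kernel (mu t : R) (l : seq (R * R)) (k : bool) (x : R) : R :=
  vker k t x - mu * lcomb (uker k) l x.

Definition noise_kernel (mu b t : R) (l : seq (R * R)) (k : bool) (x : R) : R :=
  lcomb (vker k) l x + b / mu * state_kernel mu t l k x.

Definition cost (mu b eps t : R) (l : seq (R * R)) : R :=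
  ninner H1 (state_kernel mu t l) (state_kernel mu t l) +
  eps * ninner H2 (noise_kernel mu b t l) (noise_kernel mu b t l).

Definition min_cost (mu b eps t : R) : R := inf [set cost mu b eps t l | l in horizon t].

Lemma horizon_nonneg t l : horizon t l -> nonneg_times l.
Proof. by move=> h p /h /andP[]. Qed.

Lemma decays2_state_kernel mu t l : 0 <= t -> nonneg_times l -> decays2 (state_kernel mu t l).
Proof.
move=> t0 hl k; have h1 := decays_vker k t0.
have h2 := decays2_lcomb (fun k t => @decays_uker R k t) hl k.
have := decays_lin (- mu) h2 h1; congr decays; apply/funext => x.
by rewrite /state_kernel; ring.
Qed.

Lemma decays2_noise_kernel mu b t l : 0 <= t -> nonneg_times l -> decays2 (noise_kernel mu b t l).
Proof.
move=> t0 hl k; have h1 := decays2_state_kernel mu t0 hl k.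
have := decays_lin (b / mu) h1 (decays2_vcomb hl k); congr decays; apply/funext => x.
by rewrite /noise_kernel /vcomb addrC.
Qed.

Variables (W V X Y : R -> {RV P >-> R}) (mu b eps : R).
Hypotheses (hW : fBm H1 W) (hV : fBm H2 V) (hWV : independent_processes W V).
Hypotheses (mu0 : mu != 0) (eps0 : 0 < eps).
Hypotheses (hX : state_equation b W X) (hY : observation_equation mu eps X V Y).

(* The state drops out: this is [mu int W + sqrt eps (V - b int V)]. *)
Definition whitened (t : R) (w : T) : R := path Y t w - b * int (path Y ^~ w) t.

Lemma path_state_continuous w : {within `[0, +oo[, continuous (path X ^~ w)}.
Proof.
have [_ _ _ cW] := hW; apply: (@state_continuous R b _ (path W ^~ w)) => [|t t0].
  exact: cW.
by have := hX w t0.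
Qed.

Lemma path_obs_continuous w : {within `[0, +oo[, continuous (path Y ^~ w)}.
Proof.
have [_ _ _ cV] := hV.
apply: (@within_ext _ _ (fun t => mu * int (path X ^~ w) t + (Num.sqrt eps * path V t w + 0))).
  by move=> t t0; rewrite addr0; exact: hY.
apply: within_lin; first by apply: continuous_int; exact: path_state_continuous.
apply: (@within_lin _ _ (fun t => path V t w) (fun=> 0)); first exact: cV.
by apply: continuous_subspaceT => s; exact: cvg_cst.
Qed.

Lemma whitenedE t w : 0 <= t -> whitened t w =
  mu * int (path W ^~ w) t +
  (Num.sqrt eps * path V t w + - (Num.sqrt eps * b) * int (path V ^~ w) t).
Proof.
move=> t0; have [_ _ _ cV] := hV; have [_ _ _ cW] := hW.
have cVw : {within `[0, +oo[, continuous (path V ^~ w)} by exact: cV.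
have cX := @path_state_continuous w; have cI := continuous_int cX.
have eqint (f g : R -> R) s : (forall r, 0 <= r -> f r = g r) -> int f s = int g s.
  by move=> fg; apply: eq_Rintegral => r; rewrite inE/= in_itv/= => /andP[r0 _]; exact: fg.
have c0 : {within `[0, +oo[, continuous (fun _ : R => 0 : R)}.
  by apply: continuous_subspaceT => s; exact: cvg_cst.
have iX : int (path X ^~ w) t = b * int (fun s => int (path X ^~ w) s) t + int (path W ^~ w) t.
  rewrite -(int_lin _ _ cI (cW w)); apply: eqint => s s0.
  by have [_] := hX w s0.
have iY : int (path Y ^~ w) t =
    mu * int (fun s => int (path X ^~ w) s) t + Num.sqrt eps * int (path V ^~ w) t.
  rewrite (eqint _ (fun s => mu * int (path X ^~ w) s + (Num.sqrt eps * path V s w + 0))); last first.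
    by move=> s s0; rewrite addr0; exact: hY.
  have cVe := @within_lin _ (Num.sqrt eps) _ _ cVw c0.
  transitivity (mu * int (fun s => int (path X ^~ w) s) t + int (fun s => Num.sqrt eps * path V s w + 0) t).
    exact: (@int_lin _ mu _ _ t cI cVe).
  congr (_ + _); transitivity (Num.sqrt eps * int (path V ^~ w) t + int (fun=> 0) t).
    exact: (@int_lin _ (Num.sqrt eps) _ _ t cVw c0).
  by rewrite Rintegral_cst//= mul0r addr0.
rewrite /whitened iY {1}/path (hY w t0) -/(path X) iX; rewrite /path; ring.
Qed.

Lemma whitened_srep2 t : 0 <= t -> srep2 W V (whitened t) (fun k x => mu * uker k t x)
  (fun k x => Num.sqrt eps * (vker k t x - b * uker k t x)).
Proof.
move=> t0.
have h1 := srep2l V (srep_integral hW t0).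
have h2 := srep2r W (srep_path V t0).
have h3 := srep2r W (srep_integral hV t0).
have z := srep2l V (srep0 W).
have h := srep2_lin mu h1 (srep2_lin (Num.sqrt eps) h2 (srep2_lin (- (Num.sqrt eps * b)) h3 z)).
apply: srep2_ext h => [w|k x|k x]; first by rewrite whitenedE// addr0.
- ring.
- ring.
Qed.

Lemma lcomb_whitened_srep2 l : nonneg_times l ->
  srep2 W V (lcomb whitened l) (fun k x => mu * lcomb (uker k) l x)
  (fun k x => Num.sqrt eps * (lcomb (vker k) l x - b * lcomb (uker k) l x)).
Proof.
elim: l => [_|p l IH /nonneg_times_cons[p0 hl]].
  apply: srep2_ext (srep2l V (srep0 W)) => [w|k x|k x]; rewrite !lcomb_nil ?mulr0//.
  by rewrite subrr mulr0.
apply: srep2_ext (srep2_lin p.1 (whitened_srep2 p0) (IH hl)) => [w|k x|k x]; rewrite !lcomb_cons//.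
- ring.
- ring.
Qed.

(** Since [X - b int X = W], the integrating factor of [riemann_sum_ode] presents
    [expR (- b t) int X] as a limit of Riemann sums in [W]. *)
Lemma state_int_gspace t : 0 <= t -> gspace W V (fun w => int (path X ^~ w) t).
Proof.
move=> t0.
have ce : continuous (fun s : R => expR (- b * s)).
  apply: (@is_derive_continuous _ _ (fun s => expR (- b * s) * (- b))) => s.
  apply: derive_expR_fun; apply: is_derive_ext (derive_affine (- b) 0 0 s) => // z.
  by rewrite subr0 addr0.
have h : srep W (fun w => expR (- b * t) * int (path X ^~ w) t)
    (fun k x => int (fun s => expR (- b * s) * vker k s x) t).
  apply: srep_riemann => // w.
  apply: cvg_trans (@riemann_sum_ode _ b _ _ t0 (@path_state_continuous w)).
  apply: near_eq_cvg; apply: nearW => n; apply: riemann_sum_eq => // s s0.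
  congr (_ * _); have [_ e] := hX w s0; rewrite {1}/path e -/(path W); rewrite /path; ring.
have := srep2_lin (expR (- b * t))^-1 (srep2l V h) (srep2l V (srep0 W)).
rewrite (_ : (fun w => _) = fun w => int (path X ^~ w) t); first by move=> hh; do 2 eexists; exact: hh.
by apply/funext => w; rewrite addr0 mulKf// gt_eqF// expR_gt0.
Qed.

Lemma state_gspace t : 0 <= t -> gspace W V (path X t).
Proof.
move=> t0; have [f1 [f2 h]] := state_int_gspace t0.
have := srep2_lin b h (srep2l V (srep_path W t0)).
rewrite (_ : (fun w => _) = path X t); first by move=> hh; do 2 eexists; exact: hh.
by apply/funext => w; have [_] := hX w t0.
Qed.

Lemma obs_gspace t : 0 <= t -> gspace W V (path Y t).
Proof.
move=> t0; have [f1 [f2 h]] := state_int_gspace t0; have z := srep2l V (srep0 W).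
have := srep2_lin mu h (srep2_lin (Num.sqrt eps) (srep2r W (srep_path V t0)) z).
rewrite (_ : (fun w => _) = path Y t); first by move=> hh; do 2 eexists; exact: hh.
by apply/funext => w; rewrite addr0; exact/esym/hY.
Qed.

Section Horizon.
Variables (t : R) (t0 : 0 <= t).
Local Notation FY := (sigma_process `[0, t]%classic Y).

Lemma whitened_smeas s : 0 <= s <= t -> smeas FY (whitened s).
Proof.
move=> /andP[s0 st]; have sF := sigma_process_sigma `[0, t]%classic Y.
have hY' r : 0 <= r <= s -> smeas FY (path Y r).
  move=> /andP[r0 rs]; apply: sigma_process_smeas.
  by rewrite /= in_itv/= r0 (le_trans rs).
have hI : smeas FY (fun w => int (path Y ^~ w) s).
  apply: (smeas_riemann (c := fun=> 1) sF s0 hY') => w.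
  apply: cvg_trans (riemann_sum_within s0 (@path_obs_continuous w)).
  by apply: near_eq_cvg; apply: nearW => n; apply: riemann_sum_eq => // r r0; rewrite mul1r.
have := smeas_lin sF (- b) hI (hY' s _); rewrite s0 lexx => /(_ isT).
by congr smeas; apply/funext => w; rewrite /whitened; ring.
Qed.

(** Whitening is causally invertible: the integrating factor recovers first [int Y] and then [Y]
    from the whitened values up to the same time. *)
Lemma obs_whitened_sub (S : set (set T)) : sigma_algebra setT S ->
  (forall s, 0 <= s <= t -> smeas S (whitened s)) -> FY `<=` S.
Proof.
move=> sS h; apply: sigma_process_sub => // s; rewrite /= in_itv/= => /andP[s0 st].
have hI : smeas S (fun w => expR (- b * s) * int (path Y ^~ w) s).
  apply: (smeas_riemann (c := fun r => expR (- b * r)) (Z := whitened) sS s0) => [r /andP[r0 rs]|w].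
    by apply: h; rewrite r0 (le_trans rs).
  exact: riemann_sum_ode (@path_obs_continuous w).
have := smeas_lin sS (b / expR (- b * s)) hI (h s _); rewrite s0 st => /(_ isT).
congr smeas; apply/funext => w; rewrite /whitened mulrA divfK ?gt_eqF ?expR_gt0//.
by rewrite addrC subrK.
Qed.

(** Subtracting the observable [(b / mu) Y_t] shifts the state and its conditional expectation
    alike. The error of the remaining variable [xi] against whitened combinations has kernels given
    by finite lists, without the exponentials of the drift. *)
Lemma filtering_error_cost : filtering_error X Y t = min_cost mu b eps t.
Proof.
have gH := gspace_gaussian hH1 hH2 hW hV hWV.
have [_ linH] := gH.
have sF := sigma_process_sigma `[0, t]%classic Y.
have Fm : FY `<=` measurable by exact: sigma_process_meas.
have hXt := state_gspace t0; have hYt := obs_gspace t0.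
have iX : P.-integrable setT (EFin \o path X t) := sqi_intg (gspace_sqi gH hXt).
have iY : P.-integrable setT (EFin \o path Y t) := sqi_intg (gspace_sqi gH hYt).
have [eta0 ceX0] := cond_exp_exists sF Fm iX.
pose eta := cond_exp P FY (X t).
(* [cond_exp] is a choice with default zero; existence guarantees that the value chosen is a version
   of the conditional expectation. *)
have ceX : is_cond_exp P FY (path X t) eta by apply: (xgetPex (cst 0)); exists eta0.
pose c := b / mu.
pose xi w := - c * path Y t w + path X t w.
have hxi : gspace W V xi by exact: linH.
pose zeta w := - c * path Y t w + eta w.
have sY : smeas FY (path Y t).
  by apply: sigma_process_smeas; rewrite /= in_itv/= t0 lexx.
have [me ie Ee] := ceX.
have seta : smeas FY eta by move=> B mB; apply: me; exists B => //; rewrite setTI.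
have ce : is_cond_exp P FY xi zeta.
  split.
  - by move=> _ [B mB <-]; rewrite setTI; exact: (smeas_lin sF).
  - by apply: intgD => //; exact: intgZ.
  - move=> A FA; have mA := Fm _ FA.
    have iA (f : T -> R) : P.-integrable setT (EFin \o f) -> P.-integrable A (EFin \o f).
      by move=> h; apply: integrableS h.
    have iZY : P.-integrable A (EFin \o (fun w => - c * path Y t w)) by apply: iA; exact: intgZ.
    rewrite /zeta /xi; under eq_integral do rewrite EFinD.
    under [RHS]eq_integral do rewrite EFinD.
    rewrite integralD//; last exact: iA.
    rewrite integralD//; last exact: iA.
    by rewrite Ee.
pose L := [set lcomb whitened l | l in horizon t].
have LH : L `<=` gspace W V.
  by move=> _ [l /horizon_nonneg hl <-]; do 2 eexists; exact: lcomb_whitened_srep2.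
have linL : linspace L.
  move=> a _ _ [l hl <-] [l' hl' <-]; exists (scale_list a l ++ l').
    by move=> p; rewrite mem_cat => /orP[/mapP[q /hl hq ->]|/hl'].
  by apply/funext => w; rewrite lcomb_cat lcomb_scale.
have L0 : L (fun=> 0) by exists [::] => //; apply/funext => w; rewrite lcomb_nil.
have FL S : sigma_algebra setT S ->
    (forall Z (B : set R), L Z -> measurable B -> S (Z @^-1` B)) -> FY `<=` S.
  move=> sS h; apply: obs_whitened_sub => // s hs B mB; apply: h => //.
  exists [:: (1, s)]; first by move=> p; rewrite inE => /eqP ->.
  by apply/funext => w; rewrite lcomb1 mul1r.
have LF Z : L Z -> smeas FY Z.
  move=> [l hl <-]; apply: smeas_lcomb => // p /hl hp; exact: whitened_smeas.
have := gaussian_projection gH LH linL L0 sF Fm FL LF hxi ce.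
rewrite /filtering_error /min_cost.
have -> : E (fun w => (xi w - zeta w) ^+ 2) =
    fine ('E_P[fun w => ((X t w - cond_exp P FY (X t) w) ^+ 2)%R])%E.
  rewrite unlock; congr fine; apply: eq_integral => w _; congr (_%:E).
  by rewrite /xi /zeta /path -/eta; ring.
move=> ->; congr inf.
have costE l : nonneg_times l ->
    E (fun w => (xi w - lcomb whitened l w) ^+ 2) = cost mu b eps t l.
  move=> hl.
  have h : srep2 W V (fun w => xi w - lcomb whitened l w) (state_kernel mu t l)
      (fun k x => - Num.sqrt eps * noise_kernel mu b t l k x + 0).
    have z := srep2l V (srep0 W).
    have h1 := srep2_lin (- (c * Num.sqrt eps)) (srep2r W (srep_path V t0)) z.
    have h2 := srep2_lin 1 (srep2l V (srep_path W t0)) h1.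
    have h3 := srep2_lin (-1) (lcomb_whitened_srep2 hl) h2.
    apply: srep2_ext h3 => [w|k x|k x].
    + have [_ e] := hX w t0; rewrite /xi [path X t w]e [path Y t w](hY w t0) /path /c.
      by field.
    + by rewrite /state_kernel; ring.
    + by rewrite /noise_kernel /state_kernel /c; field.
  rewrite (srep2_sqr hH1 hH2 hW hV hWV h) /cost; congr (_ + _).
  have dn := decays2_noise_kernel mu b t0 hl.
  have d0 : decays2 (fun _ _ => 0 : R) by move=> k; exact: decays0.
  rewrite (ninner_sqr_lin hH2 _ dn d0) ninnerC !(ninner0l hH2)//.
  by rewrite mulr0 !addr0 sqrrN sqr_sqrtr// ltW.
apply/seteqP; split => [_ [_ [l hl <-] <-]|_ [l hl <-]].
  by exists l => //; rewrite costE//; exact: horizon_nonneg hl.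
exists (lcomb whitened l); first by exists l.
by rewrite costE//; exact: horizon_nonneg hl.
Qed.

End Horizon.
End FilteringError.

(** * Scaling of the least squares problem *)

Section Scaling.
Variables (R : realType) (H1 H2 : R) (hH1 : 0 < H1 < 1) (hH2 : 0 < H2 < 1) (mu : R).
Hypothesis mu0 : mu != 0.

(** Dividing the weights by [c] compensates the extra factor that [uker] picks up compared with
    [vker], so that the state kernel scales as a whole. *)
Definition dilate (c : R) (l : seq (R * R)) := [seq (p.1 / c, c * p.2) | p <- l].

Lemma dilate_horizon c t l : 0 < c -> horizon t l -> horizon (c * t) (dilate c l).
Proof.
move=> c0 h _ /mapP[p /h /andP[p0 pt] ->] /=.
by rewrite mulr_ge0 ?(ltW c0)//= ler_wpM2l ?(ltW c0).
Qed.

Lemma dilateK c l : c != 0 -> dilate c (dilate c^-1 l) = l.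
Proof.
move=> c0; rewrite /dilate -map_comp -[RHS]map_id; apply: eq_map => -[a t] /=.
by rewrite mulVKf// invrK mulfK.
Qed.

Lemma vker_scale k c t (x : R) : 0 < c -> vker k t (c * x) = c^-1 * vker k (c * t) x.
Proof.
move=> c0; have e : c * x * t = x * (c * t) by ring.
by case: k; rewrite /vker e invfM mulrCA.
Qed.

Lemma uker_scale k c t (x : R) : 0 < c -> 0 < x -> uker k t (c * x) = c^-1 * (c^-1 * uker k (c * t) x).
Proof.
move=> c0 x0; have e : c * x * t = x * (c * t) by ring.
have cn : c != 0 by rewrite gt_eqF.
have xn : x != 0 by rewrite gt_eqF.
by case: k; rewrite /uker e; field; rewrite cn xn.
Qed.

Lemma state_kernel_scale c t l k x : 0 < c -> 0 < x ->
  state_kernel mu t l k (c * x) = c^-1 * state_kernel mu (c * t) (dilate c l) k x.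
Proof.
move=> c0 x0; rewrite /state_kernel vker_scale// mulrBr; congr (_ - _).
rewrite mulrCA; congr (_ * _); rewrite /lcomb big_map mulr_sumr; apply: eq_bigr => p _ /=.
by rewrite uker_scale//; ring.
Qed.

Lemma noise_kernel_scale b c t l k x : 0 < c -> 0 < x ->
  noise_kernel mu b t l k (c * x) = noise_kernel mu (b / c) (c * t) (dilate c l) k x.
Proof.
move=> c0 x0; rewrite /noise_kernel state_kernel_scale//; congr (_ + _); last by ring.
rewrite /lcomb big_map; apply: eq_bigr => p _ /=.
by rewrite vker_scale// mulrA.
Qed.

Lemma ninner_scale (H c : R) f : 0 < H < 1 -> 0 < c -> decays2 f ->
  ninner H f f = c `^ (2 - 2 * H) * ninner H (fun k x => f k (c * x)) (fun k x => f k (c * x)).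
Proof.
move=> hH c0 df; rewrite /ninner mulrCA; congr (_ * _).
have d2 := decays_ninner df df.
have := @wint_scale _ H c _ hH c0 d2 => /= ->.
rewrite mulrA -powRD; last by rewrite (gt_eqF c0) implybT.
by rewrite (_ : 2 - 2 * H + (2 * H - 2) = 0) ?powRr0 ?mul1r//; ring.
Qed.

(** The state part scales by [c ^ (2 - 2 H1)] times [c ^ (-2)], the noise part by [c ^ (2 - 2 H2)];
    their ratio is absorbed into the noise intensity. *)
Lemma cost_scale b eps c t l : 0 < c -> 0 <= t -> horizon t l ->
  cost H1 H2 mu b eps t l = c `^ (- (2 * H1)) *
    cost H1 H2 mu (b / c) (eps * c `^ (2 + 2 * H1 - 2 * H2)) (c * t) (dilate c l).
Proof.
move=> c0 t0 /horizon_nonneg hl; have cn : c != 0 by rewrite gt_eqF.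
have pD p q : c `^ p * c `^ q = c `^ (p + q) by rewrite powRD// cn implybT.
have ct0 : 0 <= c * t by rewrite mulr_ge0// ltW.
have hd : nonneg_times (dilate c l).
  by move=> _ /mapP[p /hl hp ->] /=; rewrite mulr_ge0// ltW.
have d1 := decays2_state_kernel mu t0 hl.
have d1' := decays2_state_kernel mu ct0 hd.
have d2 := decays2_noise_kernel mu b t0 hl.
have dz : decays2 (fun _ _ => 0 : R) by move=> k; exact: decays0.
rewrite /cost mulrDr; congr (_ + _).
  rewrite (ninner_scale hH1 c0 d1).
  rewrite (@eq_ninner _ _ _ (fun k x => c^-1 * state_kernel mu (c * t) (dilate c l) k x + 0)
    _ (fun k x => c^-1 * state_kernel mu (c * t) (dilate c l) k x + 0)); last 2 first.
  - by move=> k x x0; rewrite addr0 state_kernel_scale.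
  - by move=> k x x0; rewrite addr0 state_kernel_scale.
  rewrite ninner_sqr_lin// ninnerC !ninner0l// mulr0 !addr0 mulrA; congr (_ * _).
  rewrite -powR_inv1 ?(ltW c0)// -powR_mulrn ?powR_ge0// -powRrM pD.
  by congr (_ `^ _); ring.
rewrite (ninner_scale hH2 c0 d2).
rewrite (@eq_ninner _ _ _ (noise_kernel mu (b / c) (c * t) (dilate c l))
    _ (noise_kernel mu (b / c) (c * t) (dilate c l))); last 2 first.
- by move=> k x x0; rewrite noise_kernel_scale.
- by move=> k x x0; rewrite noise_kernel_scale.
rewrite !mulrA; congr (_ * _); congr (_ * _); rewrite [RHS]mulrAC pD [LHS]mulrC; congr (_ * _).
by congr (_ `^ _); ring.
Qed.

Lemma cost_ge0 b eps t l : 0 <= eps -> 0 <= cost H1 H2 mu b eps t l.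
Proof. by move=> e0; apply: addr_ge0; [exact: ninner_ge0|apply: mulr_ge0 => //; exact: ninner_ge0]. Qed.

Lemma min_cost_le b eps t l : 0 <= eps -> horizon t l ->
  min_cost H1 H2 mu b eps t <= cost H1 H2 mu b eps t l.
Proof.
move=> e0 hl; apply: ge_inf; last by exists l.
by exists 0 => _ [l' _ <-]; exact: cost_ge0.
Qed.

Lemma le_min_cost b eps t m : (forall l, horizon t l -> m <= cost H1 H2 mu b eps t l) ->
  m <= min_cost H1 H2 mu b eps t.
Proof.
move=> h; apply: lb_le_inf; first by exists (cost H1 H2 mu b eps t [::]), [::].
by move=> _ [l hl <-]; exact: h.
Qed.

Lemma min_cost_scale_le b eps c t : 0 < c -> 0 <= t -> 0 <= eps ->
  min_cost H1 H2 mu b eps t <= c `^ (- (2 * H1)) *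
    min_cost H1 H2 mu (b / c) (eps * c `^ (2 + 2 * H1 - 2 * H2)) (c * t).
Proof.
move=> c0 t0 e0; have cn : c != 0 by rewrite gt_eqF.
have ci : 0 < c^-1 by rewrite invr_gt0.
have p0 : 0 < c `^ (- (2 * H1)) by rewrite powR_gt0.
rewrite mulrC -ler_pdivrMr//; apply: le_min_cost => l hl.
rewrite ler_pdivrMr// mulrC -[in leRHS](dilateK l cn).
have hd : horizon t (dilate c^-1 l).
  by have := dilate_horizon ci hl; rewrite mulKf.
by rewrite -cost_scale//; exact: min_cost_le.
Qed.

Lemma min_cost_scale b eps c t : 0 < c -> 0 <= t -> 0 <= eps ->
  min_cost H1 H2 mu b eps t = c `^ (- (2 * H1)) *
    min_cost H1 H2 mu (b / c) (eps * c `^ (2 + 2 * H1 - 2 * H2)) (c * t).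
Proof.
move=> c0 t0 e0; apply/eqP; rewrite eq_le min_cost_scale_le//=.
have cn : c != 0 by rewrite gt_eqF.
have ci : 0 < c^-1 by rewrite invr_gt0.
have ct0 : 0 <= c * t by rewrite mulr_ge0// ltW.
set e := eps * _; have e0' : 0 <= e by rewrite mulr_ge0// powR_ge0.
have pV p : c^-1 `^ p = c `^ (- p).
  by rewrite -powR_inv1 ?(ltW c0)// -powRrM mulN1r.
have pD p q : c `^ p * c `^ q = c `^ (p + q) by rewrite powRD// cn implybT.
have := min_cost_scale_le (b / c) ci ct0 e0'.
rewrite !pV mulKf// invrK divfK// opprK /e -mulrA pD subrr powRr0 mulr1.
by rewrite -(ler_pM2l (powR_gt0 (- (2 * H1)) c0)) mulrA pD addNr powRr0 mul1r.
Qed.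

(** This [c] solves [eps c ^ (2 + 2 H1 - 2 H2) = 1]; the prefactor [c ^ (- 2 H1)] then equals
    [eps ^ nu], which is where the exponent originates. *)
Lemma min_cost_small_noise b eps t : 0 < eps -> 0 <= t ->
  let c := eps `^ (- (2 * (1 + H1 - H2))^-1) in
  eps `^ (- (H1 / (1 + H1 - H2))) * min_cost H1 H2 mu b eps t =
  min_cost H1 H2 mu (b / c) 1 (c * t).
Proof.
move=> e0 t0 c; have [/andP[H10 H11] /andP[H20 H21]] := (hH1, hH2).
have D0 : 1 + H1 - H2 != 0 by rewrite gt_eqF//; lra.
have en : eps != 0 by rewrite gt_eqF.
have c0 : 0 < c by rewrite powR_gt0.
rewrite (min_cost_scale b c0 t0 (ltW e0)) /c -!powRrM mulrA -powRD; last by rewrite en implybT.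
rewrite [X in eps `^ X * _](_ : _ = 0); last by field.
rewrite powRr0 mul1r -/c; congr (min_cost _ _ _ _ _ _).
rewrite -[X in X * _](powRr1 (ltW e0)) -powRD; last by rewrite en implybT.
by rewrite [X in eps `^ X](_ : _ = 0) ?powRr0//; field.
Qed.

End Scaling.

(** * The Riemann-Lebesgue lemma for spectral kernels *)

Section RiemannLebesgue.
Variables (R : realType) (H : R) (hH : 0 < H < 1).
Implicit Types (f g : bool -> R -> R) (s t : R) (l : seq (R * R)).
Local Notation D := (`]0, +oo[%classic : set R).

(* Multiplication by [expi (x * s)], on real and imaginary parts. *)
Definition rot s f (k : bool) (x : R) : R :=
  if k then cos (x * s) * f true x - sin (x * s) * f false x
  else sin (x * s) * f true x + cos (x * s) * f false x.

Lemma decays2_rot s f : decays2 f -> decays2 (rot s f).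
Proof.
move=> df; have c1 j : decays 1 (fun x => cos (x * s) * f j x).
  apply: (@decays_bounded _ 1 _ _ 1) (df j) _ _; first exact: measurable_cos_halfline.
  by move=> x _; exact: cos_max.
have s1 j : decays 1 (fun x => sin (x * s) * f j x).
  apply: (@decays_bounded _ 1 _ _ 1) (df j) _ _; first exact: measurable_sin_halfline.
  by move=> x _; exact: sin_max.
by case; [exact: decaysB|exact: decaysD].
Qed.

Lemma rot_sqr s f x : rot s f true x ^+ 2 + rot s f false x ^+ 2 = f true x ^+ 2 + f false x ^+ 2.
Proof.
rewrite /rot; transitivity ((cos (x * s) ^+ 2 + sin (x * s) ^+ 2) * (f true x ^+ 2 + f false x ^+ 2)).
  by ring.
by rewrite cos2Dsin2 mul1r.
Qed.

Lemma ninner_rot s f : ninner H (rot s f) (rot s f) = ninner H f f.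
Proof. by congr (_ * _); apply: eq_wint => x x0; rewrite -!expr2 rot_sqr. Qed.

Lemma rot_lin s a f g k x :
  rot s (fun k x => a * f k x + g k x) k x = a * rot s f k x + rot s g k x.
Proof. by case: k; rewrite /rot; ring. Qed.

(** From [e^(i x (t + s)) - 1 = (e^(i x s) - 1) + e^(i x s) (e^(i x t) - 1)], in components. *)
Lemma vker_shift k s t x : vker k (t + s) x = vker k s x + rot s (fun k => vker k t) k x.
Proof.
by case: k; rewrite /vker /rot mulrDr ?sinD ?cosD; ring.
Qed.

Lemma ninner_Cauchy f g : decays2 f -> decays2 g ->
  ninner H f g ^+ 2 <= ninner H f f * ninner H g g.
Proof.
move=> df dg; apply: discriminant_le0 => [|t]; first exact: ninner_ge0.
by rewrite -ninner_sqr_lin//; exact: ninner_ge0.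
Qed.

Lemma ninner_vker s t : 0 <= s -> 0 <= t ->
  ninner H (fun k => vker k s) (fun k => vker k t) = fBm_cov H s t.
Proof. by move=> s0 t0; rewrite fBm_cov_spectral. Qed.

Lemma powR_neg_cvg0 (q a : R) (s_ : nat -> R) : 0 < q -> s_ @ \oo --> +oo ->
  (s_ n - a) `^ (- q) @[n --> \oo] --> 0.
Proof.
move=> q0 sc; apply/cvgrPdist_le => e e0.
have /cvgryPge/(_ (a + 1 + e `^ (- q^-1))) h := sc.
apply: filterS h => n hn; rewrite sub0r normrN ger0_norm ?powR_ge0//.
have e1 : 0 < e `^ (- q^-1) by rewrite powR_gt0.
have -> : e = (e `^ (- q^-1)) `^ (- q).
  by rewrite -powRrM mulrNN mulVf ?gt_eqF// powRr1// ltW.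
have h1 : e `^ (- q^-1) <= s_ n - a by lra.
have h2 := lt_le_trans e1 h1.
rewrite !(powRN _ q) lef_pV2 ?posrE ?powR_gt0//.
by apply: ge0_ler_powR h1; [exact: ltW|rewrite nnegrE ltW..].
Qed.

Lemma powR_MVT (p t x : R) : 0 < x -> 0 <= t ->
  exists2 y, x <= y <= x + t & (x + t) `^ p - x `^ p = p * y `^ (p - 1) * t.
Proof.
move=> x0 t0; have xt : x <= x + t by rewrite lerDl.
have [|y|y] := @MVT_segment R (fun x => x `^ p) (fun x => p * x `^ (p - 1)) x (x + t) xt.
- by move=> y; rewrite in_itv/= => /andP[xy _]; apply: derive_powR; exact: lt_trans xy.
- apply: continuous_in_subspaceT => z; rewrite inE/= in_itv/= => /andP[xz _].
  by apply: continuous_powR_pos; exact: lt_le_trans xz.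
- by rewrite in_itv/= => yx ->; exists y => //; rewrite [X in _ * X]addrC addrA addNr add0r.
Qed.

(** Two applications of the mean value theorem give [p (p - 1) t a z ^ (p - 2)] with [z >= s - a],
    which decays as [p < 2]. At [p = 2 H] this is the decorrelation of distant increments, long
    memory included. *)
Lemma powR_second_difference (p a t : R) (s_ : nat -> R) : p < 2 -> 0 <= a -> 0 <= t ->
  s_ @ \oo --> +oo ->
  (s_ n + t) `^ p - s_ n `^ p - ((s_ n - a + t) `^ p - (s_ n - a) `^ p) @[n --> \oo] --> 0.
Proof.
move=> p2 a0 t0 sc; have q0 : 0 < 2 - p by rewrite subr_gt0.
pose C := `|p * (p - 1) * t * a|.
have c0 : C * (s_ n - a) `^ (- (2 - p)) @[n --> \oo] --> 0.
  by rewrite -[X in _ --> X](mulr0 C); apply: cvgM; [exact: cvg_cst|exact: powR_neg_cvg0].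
have /cvgryPgt/(_ a) big := sc.
apply/norm_cvg0P; apply: squeeze_cvgr (cvg_cst 0) c0.
apply: filterS big => n an; rewrite normr_ge0/=; set x := s_ n - a.
have x0 : 0 < x by rewrite subr_gt0.
pose F (y : R) := (y + t) `^ p - y `^ p.
pose F' (y : R) := p * (y + t) `^ (p - 1) - p * y `^ (p - 1).
have dF (y : R) : 0 < y -> is_derive y 1 F (F' y).
  move=> y0; have yt : 0 < y + t by rewrite ltr_wpDr.
  have d1 : is_derive y 1 (fun y : R => y + t) 1.
    by apply: is_derive_ext (derive_affine 1 0 t y) => // z; rewrite subr0 mul1r.
  have d2 : is_derive y 1 (fun y : R => (y + t) `^ p) (p * (y + t) `^ (p - 1)).
    have dp := derive_powR p yt.
    have := @is_derive1_comp _ (fun x : R => x `^ p) (fun y => y + t) y _ _ dp d1.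
    by rewrite mulr1; exact: is_derive_ext.
  exact: (deriveD_fun d2 (deriveN_fun (derive_powR p y0))).
have xa : x <= x + a by rewrite lerDl.
have [y hy|y|y hy] := @MVT_segment R F F' x (x + a) xa.
- by apply: dF; move: hy; rewrite in_itv/= => /andP[xy _]; exact: lt_trans xy.
- apply: continuous_in_subspaceT => z; rewrite inE/= in_itv/= => /andP[xz _].
  apply: differentiable_continuous; apply/derivable1_diffP.
  by have [] := dF z (lt_le_trans x0 xz).
- move: hy; rewrite in_itv/= => /andP[xy _].
  have y0 : 0 < y := lt_le_trans x0 xy.
  have [z /andP[yz _] Ez] := powR_MVT (p - 1) y0 t0.
  have z0 : 0 < z := lt_le_trans y0 yz.
  rewrite /F /x subrK => ->; rewrite /F' -mulrBr Ez subKr -/x.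
  have -> : p * ((p - 1) * z `^ (p - 1 - 1) * t) * a = p * (p - 1) * t * a * z `^ (p - 1 - 1) by ring.
  rewrite normrM ler_wpM2l// ger0_norm ?powR_ge0//.
  rewrite [X in z `^ X](_ : _ = - (2 - p)); last by ring.
  rewrite !powRN lef_pV2 ?posrE ?powR_gt0//.
  by apply: ge0_ler_powR (le_trans xy yz); [exact: ltW|rewrite nnegrE ltW..].
Qed.

End RiemannLebesgue.

Section SpectralClass.
Variables (R : realType) (H : R) (hH : 0 < H < 1).
Implicit Types (f g : bool -> R -> R) (s t : R) (l : seq (R * R)).

(** The deterministic half of [srep]: dominated pointwise limits of kernels of finite lists, the
    class on which density arguments for [ninner] run. *)
Definition spectral f := exists (l : nat -> seq (R * R)) (C : R),
  [/\ forall n, nonneg_times (l n),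
      forall n k x, 0 < x -> `|vcomb (l n) k x| <= C * (1 + x)^-1
    & forall k x, 0 < x -> vcomb (l n) k x @[n --> \oo] --> f k x].

Lemma spectral_decays f : spectral f -> decays2 f.
Proof.
move=> [l [C [hl lC lf]]].
by have [] := ninner_cvg hH (fun n => decays2_vcomb (hl n)) lC lf.
Qed.

Lemma spectral_lin a f g : spectral f -> spectral g -> spectral (fun k x => a * f k x + g k x).
Proof.
move=> [l [C [hl lC lf]]] [l' [C' [hl' lC' lf']]].
exists (fun n => scale_list a (l n) ++ l' n), (`|a| * C + C'); split.
- by move=> n; apply: nonneg_times_cat => //; exact: nonneg_times_scale.
- move=> n k x x0; rewrite /vcomb lcomb_cat lcomb_scale mulrDl.
  rewrite (le_trans (ler_normD _ _))// lerD//; last exact: lC'.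
  by rewrite normrM -mulrA ler_wpM2l// lC.
- move=> k x x0; rewrite (_ : (fun n => _) = fun n => a * vcomb (l n) k x + vcomb (l' n) k x).
    by apply: cvgD; [apply: cvgM; [exact: cvg_cst|exact: lf]|exact: lf'].
  by apply/funext => n; rewrite /vcomb lcomb_cat lcomb_scale.
Qed.

Lemma spectral_ext f g : (forall k x, f k x = g k x) -> spectral f -> spectral g.
Proof. by move=> fg; have -> : f = g by apply/funext => k; exact/funext. Qed.

Lemma spectral_vker t : 0 <= t -> spectral (fun k => vker k t).
Proof.
move=> t0; exists (fun=> [:: (1, t)]), (t + 2); split.
- by move=> n p; rewrite inE => /eqP ->.
- by move=> n k x x0; rewrite /vcomb lcomb1 mul1r; apply: vker_bound; rewrite ?t0/=.
- by move=> k x x0; rewrite /vcomb lcomb1 mul1r; exact: cvg_cst.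
Qed.

Lemma spectral_uker t : 0 <= t -> spectral (fun k => uker k t).
Proof.
move=> t0; have c1 : continuous (fun _ : R => 1 : R) by move=> s; exact: cvg_cst.
have [C hC] := weighted_list_bound t0 c1.
exists (weighted_list (fun=> 1) t), C; split => // [n|k x x0]; first exact: weighted_list_times.
rewrite -(int_vker k t0 x0); have := weighted_list_cvg (k := k) (x := x) t0 c1.
by congr (_ --> _); apply: eq_Rintegral => s _; rewrite mul1r.
Qed.

Lemma spectral0 : spectral (fun _ _ => 0).
Proof.
apply: spectral_ext (spectral_lin (-1) (spectral_vker (lexx 0)) (spectral_vker (lexx 0))) => k x.
by rewrite mulN1r addNr.
Qed.

Lemma spectral_lcomb (ker : bool -> R -> R -> R) l :
  (forall t, 0 <= t -> spectral (fun k => ker k t)) -> nonneg_times l ->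
  spectral (fun k => lcomb (ker k) l).
Proof.
move=> hk; elim: l => [_|p l IH /nonneg_times_cons[p0 hl]].
  by apply: spectral_ext spectral0 => k x; rewrite lcomb_nil.
by apply: spectral_ext (spectral_lin p.1 (hk _ p0) (IH hl)) => k x; rewrite lcomb_cons.
Qed.

Section Sequence.
Variable s_ : nat -> R.
Hypothesis s_oo : s_ @ \oo --> +oo.

(** The rotated kernel is [vker (t + s) - vker s], so this is the covariance of the value at [a]
    with a distant increment, a second difference of the power [2 H]. *)
Lemma vker_rot_cvg0 a t : 0 <= a -> 0 <= t ->
  ninner H (fun k => vker k a) (rot (s_ n) (fun k => vker k t)) @[n --> \oo] --> 0.
Proof.
move=> a0 t0; have /andP[H0 H1] := hH.
have p2 : 2 * H < 2 by lra.
have c0 : 2^-1 * ((s_ n + t) `^ (2 * H) - s_ n `^ (2 * H) -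
    ((s_ n - a + t) `^ (2 * H) - (s_ n - a) `^ (2 * H))) @[n --> \oo] --> 0.
  rewrite -[X in _ --> X](mulr0 2^-1); apply: cvgM; first exact: cvg_cst.
  exact: powR_second_difference.
have /cvgryPgt/(_ a) big := s_oo.
apply: cvg_trans c0; apply: near_eq_cvg; apply: filterS big => n an.
have s0 : 0 <= s_ n := le_trans a0 (ltW an).
have ts0 : 0 <= t + s_ n by rewrite addr_ge0.
have d1 := decays2_rot (s_ n) (fun k => decays_vker k t0).
have d2 : decays2 (fun k => vker k (s_ n)) by move=> k; exact: decays_vker.
have d3 : decays2 (fun k => vker k a) by move=> k; exact: decays_vker.
have d4 : decays2 (fun k => vker k (t + s_ n)) by move=> k; exact: decays_vker.
transitivity (ninner H (fun k => vker k a) (fun k => vker k (t + s_ n)) -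
    ninner H (fun k => vker k a) (fun k => vker k (s_ n))).
  rewrite !ninner_vker// /fBm_cov.
  rewrite (_ : `|a - s_ n| = s_ n - a); last by rewrite distrC ger0_norm// subr_ge0 ltW.
  rewrite (_ : `|a - (t + s_ n)| = s_ n - a + t); last first.
    by rewrite distrC ger0_norm; [ring|rewrite subr_ge0 (le_trans (ltW an))// lerDr].
  by rewrite [t + s_ n]addrC; ring.
transitivity (-1 * ninner H (fun k => vker k a) (fun k => vker k (s_ n)) +
    ninner H (fun k => vker k a) (fun k => vker k (t + s_ n))); first by ring.
rewrite -ninner_linr//; apply: eq_ninner => // k x _.
by rewrite vker_shift; ring.
Qed.

Lemma lin_cvg0 (a : R) (u v : nat -> R) : u @ \oo --> 0 -> v @ \oo --> 0 ->
  a * u n + v n @[n --> \oo] --> 0.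
Proof.
move=> hu hv; rewrite -[X in _ --> X](addr0 0); apply: cvgD => //.
by rewrite -[X in _ --> X](mulr0 a); apply: cvgM => //; exact: cvg_cst.
Qed.

Lemma vcomb_rot_cvg0 l l' : nonneg_times l -> nonneg_times l' ->
  ninner H (vcomb l) (rot (s_ n) (vcomb l')) @[n --> \oo] --> 0.
Proof.
move=> hl hl'.
have h1 t : 0 <= t -> ninner H (vcomb l) (rot (s_ n) (fun k => vker k t)) @[n --> \oo] --> 0.
  move=> t0; have d n := decays2_rot (s_ n) (fun k => decays_vker k t0).
  elim: l hl => [_|p l IH /nonneg_times_cons[p0 hl]].
    apply: cvg_trans (@cvg_cst _ (0 : R) _ \oo _); apply: near_eq_cvg; apply: nearW => n.
    rewrite -(ninner0l hH (d n)); apply: eq_ninner => // k x _.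
    by rewrite /vcomb lcomb_nil.
  apply: cvg_trans (lin_cvg0 p.1 (vker_rot_cvg0 p0 t0) (IH hl)); apply: near_eq_cvg; apply: nearW => n /=.
  rewrite -ninner_linl//; [|by move=> k; exact: decays_vker|exact: decays2_vcomb].
  by apply: eq_ninner => // k x _; rewrite /vcomb lcomb_cons.
have dl := decays2_vcomb hl.
elim: l' hl' => [_|p l' IH /nonneg_times_cons[p0 hl']].
  apply: cvg_trans (@cvg_cst _ (0 : R) _ \oo _); apply: near_eq_cvg; apply: nearW => n.
  rewrite -(ninner0l hH dl) ninnerC; apply: eq_ninner => // k x _.
  by case: k; rewrite /rot /vcomb !lcomb_nil !mulr0 ?subrr ?addr0.
apply: cvg_trans (lin_cvg0 p.1 (h1 _ p0) (IH hl')); apply: near_eq_cvg; apply: nearW => n /=.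
have d1 := decays2_rot (s_ n) (fun k => decays_vker k p0).
have d2 := decays2_rot (s_ n) (decays2_vcomb hl').
rewrite -ninner_linr//; apply: eq_ninner => // k x _.
by rewrite -rot_lin; case: k; rewrite /rot /vcomb !lcomb_cons.
Qed.

Lemma spectral_diff f (l : nat -> seq (R * R)) C : decays2 f ->
  (forall n, nonneg_times (l n)) ->
  (forall n k x, 0 < x -> `|vcomb (l n) k x| <= C * (1 + x)^-1) ->
  (forall k x, 0 < x -> vcomb (l n) k x @[n --> \oo] --> f k x) ->
  let r n k x := - 1 * vcomb (l n) k x + f k x in
  (forall n, decays2 (r n)) /\ ninner H (r n) (r n) @[n --> \oo] --> 0.
Proof.
move=> df hl lC lf r.
have dr n : decays2 (r n) by apply: decays2_lin => //; exact: decays2_vcomb.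
split=> //.
have fC k x : 0 < x -> `|f k x| <= C * (1 + x)^-1.
  move=> x0; apply: (cvgr_to_le (cvg_norm (lf k x x0))).
  by apply: nearW => n; exact: lC.
have rC n k x : 0 < x -> `|r n k x| <= (C + C) * (1 + x)^-1.
  move=> x0; rewrite mulrDl (le_trans (ler_normD _ _))// lerD//; last exact: fC.
  by rewrite normrM normrN1 mul1r; exact: lC.
have rf k x : 0 < x -> r n k x @[n --> \oo] --> 0.
  move=> x0; rewrite -[X in _ --> X](addNr (f k x)) -mulN1r; apply: cvgD; last exact: cvg_cst.
  by apply: cvgM; [exact: cvg_cst|exact: lf].
have [d0] := ninner_cvg hH dr rC rf.
by rewrite ninner0l.
Qed.

(* Rotation becomes asymptotically orthogonal: for increments of the process
   this is the decay of the covariance, and it passes to L2 limits. *)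
Lemma spectral_rot_cvg0 f g : spectral f -> spectral g ->
  ninner H f (rot (s_ n) g) @[n --> \oo] --> 0.
Proof.
move=> sf sg; have df := spectral_decays sf; have dg := spectral_decays sg.
have [l [C [hl lC lf]]] := sf; have [l' [C' [hl' lC' lg]]] := sg.
have [dr r0] := spectral_diff df hl lC lf; have [dr' r0'] := spectral_diff dg hl' lC' lg.
have [_ nF] := ninner_cvg hH (fun n => decays2_vcomb (hl n)) lC lf.
set r := fun n k x => -1 * vcomb (l n) k x + f k x in dr r0.
set r' := fun n k x => -1 * vcomb (l' n) k x + g k x in dr' r0'.
(* The mean square cost of replacing both kernels by finite lists; the factor [3] comes from
   squaring a sum of three terms. *)
pose A m := 3 * (ninner H (r m) (r m) * ninner H g g +
  ninner H (vcomb (l m)) (vcomb (l m)) * ninner H (r' m) (r' m)).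
have A0 : A @ \oo --> 0.
  rewrite -[X in _ --> X](mulr0 3); apply: cvgM; first exact: cvg_cst.
  rewrite -[X in _ --> X](addr0 0); apply: cvgD.
    by rewrite -[X in _ --> X](mul0r (ninner H g g)); apply: cvgM r0 (cvg_cst _).
  by rewrite -[X in _ --> X](mulr0 (ninner H f f)); exact: cvgM nF r0'.
apply: cvg_sqr0; apply/cvgrPdist_le => e e0.
have e2 : 0 < e / 2 by rewrite divr_gt0.
have /cvgrPdist_le/(_ _ e2)[m _ hm] := A0.
have Am : A m <= e / 2.
  by have := hm m (leqnn m); rewrite sub0r normrN; apply: le_trans; exact: ler_norm.
have B0 : 3 * ninner H (vcomb (l m)) (rot (s_ n) (vcomb (l' m))) ^+ 2 @[n --> \oo] --> 0.
  rewrite -[X in _ --> X](mulr0 3); apply: cvgM; first exact: cvg_cst.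
  rewrite -[X in _ --> X](mulr0 0); have cz := vcomb_rot_cvg0 (hl m) (hl' m).
  exact: (cvgM cz cz).
have /cvgrPdist_le/(_ _ e2) := B0; apply: filterS => n.
rewrite !sub0r !normrN !ger0_norm ?sqr_ge0//; last by rewrite mulr_ge0 ?sqr_ge0.
move=> Bn; have dl := decays2_vcomb (hl m); have dl' := decays2_vcomb (hl' m).
have d1 := decays2_rot (s_ n) dg; have d2 := decays2_rot (s_ n) (dr' m).
have d3 := decays2_rot (s_ n) dl'.
set a := ninner H (vcomb (l m)) (rot (s_ n) (vcomb (l' m))) in Bn.
set b := ninner H (vcomb (l m)) (rot (s_ n) (r' m)).
set c := ninner H (r m) (rot (s_ n) g).
have E : ninner H f (rot (s_ n) g) = c + (b + a).
  have e1 := ninner_linl hH 1 (dr m) dl d1; have e2' := ninner_linr hH 1 dl d2 d3.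
  rewrite mul1r -/c in e1; rewrite mul1r -/b -/a in e2'.
  rewrite -e2' (_ : ninner H (vcomb (l m)) _ = ninner H (vcomb (l m)) (rot (s_ n) g)).
    by rewrite -e1; apply: eq_ninner => // k x _; rewrite /r; ring.
  by apply: eq_ninner => // k x _; rewrite -rot_lin /r'; case: k; rewrite /rot; ring.
have hb : b ^+ 2 <= ninner H (vcomb (l m)) (vcomb (l m)) * ninner H (r' m) (r' m).
  by rewrite -(ninner_rot H (s_ n) (r' m)); exact: ninner_Cauchy.
have hc : c ^+ 2 <= ninner H (r m) (r m) * ninner H g g.
  by rewrite -(ninner_rot H (s_ n) g); exact: (ninner_Cauchy hH (dr m) d1).
rewrite E; move: Am; rewrite /A => Am.
have := sqr_ge0 (a - b); have := sqr_ge0 (b - c); have := sqr_ge0 (a - c).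
by move: hb hc Am Bn; clear; nra.
Qed.

End Sequence.
End SpectralClass.

(** * The long horizon limit *)

Section ConstrainedProblem.
Variables (R : realType) (H1 H2 : R) (hH1 : 0 < H1 < 1) (hH2 : 0 < H2 < 1) (mu : R).
Hypothesis mu0 : mu != 0.
Implicit Types (F G : bool -> bool -> R -> R) (l : seq (R * R)) (s t a b : R).

(** One inner product space for both noises, component [true] carrying the exponent [H1] and [false]
    the exponent [H2]; the cost at unit noise is a squared norm in it. *)
Definition ip F G := ninner H1 (F true) (G true) + ninner H2 (F false) (G false).

Definition decays4 F := forall j, decays2 (F j).

Lemma ipC F G : ip F G = ip G F.
Proof. by rewrite /ip ninnerC [in X in _ + X]ninnerC. Qed.

Lemma ip_ge0 F : 0 <= ip F F.
Proof. by rewrite /ip addr_ge0// ninner_ge0. Qed.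

Lemma eq_ip F F' G G' : (forall j k x, 0 < x -> F j k x = F' j k x) ->
  (forall j k x, 0 < x -> G j k x = G' j k x) -> ip F G = ip F' G'.
Proof. by move=> ff gg; congr (_ + _); apply: eq_ninner => k x x0; rewrite ?ff ?gg. Qed.

Lemma ip_linl a F F' G : decays4 F -> decays4 F' -> decays4 G ->
  ip (fun j k x => a * F j k x + F' j k x) G = a * ip F G + ip F' G.
Proof. by move=> hF hF' hG; rewrite /ip !ninner_linl//; ring. Qed.

Lemma decays4_lin a F G : decays4 F -> decays4 G -> decays4 (fun j k x => a * F j k x + G j k x).
Proof. by move=> hF hG j; exact: decays2_lin. Qed.

Lemma ip_sqr_lin a F G : decays4 F -> decays4 G ->
  ip (fun j k x => a * F j k x + G j k x) (fun j k x => a * F j k x + G j k x) =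
  a ^+ 2 * ip F F + 2 * a * ip F G + ip G G.
Proof. by move=> hF hG; rewrite /ip !ninner_sqr_lin//; ring. Qed.

Lemma ip_sqr_le F G : decays4 F -> decays4 G ->
  ip (fun j k x => 1 * F j k x + G j k x) (fun j k x => 1 * F j k x + G j k x) <= 2 * (ip F F + ip G G).
Proof.
move=> hF hG; rewrite ip_sqr_lin//.
have := ip_ge0 (fun j k x => -1 * F j k x + G j k x).
by rewrite ip_sqr_lin//; lra.
Qed.

Lemma ip_young F G : decays4 F -> decays4 G -> 2 * ip F G - ip G G <= ip F F.
Proof.
move=> hF hG; have := ip_ge0 (fun j k x => -1 * G j k x + F j k x).
by rewrite ip_sqr_lin// (ipC G); lra.
Qed.

Definition rotv s F j := rot s (F j).

Lemma ip_rotv s F : ip (rotv s F) (rotv s F) = ip F F.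
Proof. by rewrite /ip /rotv !ninner_rot. Qed.

Definition kernels b t l (j : bool) : bool -> R -> R :=
  if j then state_kernel mu t l else noise_kernel mu b t l.

Lemma decays4_kernels b t l : 0 <= t -> nonneg_times l -> decays4 (kernels b t l).
Proof. by move=> t0 hl; case; [exact: decays2_state_kernel|exact: decays2_noise_kernel]. Qed.

Lemma cost_ip b t l : cost H1 H2 mu b 1 t l = ip (kernels b t l) (kernels b t l).
Proof. by rewrite /cost mul1r. Qed.

Definition mass l : R := \sum_(p <- l) p.1.
Definition moment l : R := \sum_(p <- l) p.1 * p.2.
(** The constant [lam] of the kernel identity: the one part of its right-hand side that
    multiplication by [e^(i x s)] does not carry to the right-hand side at a later time. *)
Definition defect l := 1 - mu * moment l.

(** Delaying the times by [s] produces rotated kernels plus [mass l] times the kernel at [s]; the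
    extra point with weight [- mass l] cancels the latter. *)
Definition shift_list s l := (- mass l, s) :: [seq (p.1, p.2 + s) | p <- l].

Lemma uker_shift k s t x : 0 < x ->
  uker k (t + s) x = uker k s x + t * vker k s x + rot s (fun k => uker k t) k x.
Proof.
move=> x0; have xn : x != 0 by rewrite gt_eqF.
by case: k; rewrite /uker /vker /rot mulrDr ?sinD ?cosD; field.
Qed.

Lemma lcomb_shift_vker k s l x :
  lcomb (vker k) (shift_list s l) x = rot s (vcomb l) k x.
Proof.
rewrite /shift_list lcomb_cons.
suff -> : lcomb (vker k) [seq (p.1, p.2 + s) | p <- l] x = mass l * vker k s x + rot s (vcomb l) k x.
  by rewrite mulNr addKr.
elim: l => [|p l IH].
  by rewrite lcomb_nil /mass big_nil mul0r add0r; case: k; rewrite /rot /vcomb !lcomb_nil !mulr0 ?subrr ?addr0.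
rewrite lcomb_cons IH /mass big_cons /= vker_shift.
have -> : rot s (vcomb (p :: l)) k x = p.1 * rot s (fun k => vker k p.2) k x + rot s (vcomb l) k x.
  by rewrite -rot_lin; case: (k); rewrite /rot /vcomb !lcomb_cons.
ring.
Qed.

Lemma lcomb_shift_uker k s l x : 0 < x ->
  lcomb (uker k) (shift_list s l) x = moment l * vker k s x + rot s (fun k => lcomb (uker k) l) k x.
Proof.
move=> x0; rewrite /shift_list lcomb_cons.
suff -> : lcomb (uker k) [seq (p.1, p.2 + s) | p <- l] x =
    mass l * uker k s x + (moment l * vker k s x + rot s (fun k => lcomb (uker k) l) k x).
  by rewrite mulNr addKr.
elim: l => [|p l IH].
  rewrite lcomb_nil /mass /moment !big_nil !mul0r !add0r.
  by case: k; rewrite /rot !lcomb_nil !mulr0 ?subrr ?addr0.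
rewrite lcomb_cons IH /mass /moment !big_cons /= uker_shift//.
have -> : rot s (fun k => lcomb (uker k) (p :: l)) k x =
    p.1 * rot s (fun k => uker k p.2) k x + rot s (fun k => lcomb (uker k) l) k x.
  by rewrite -rot_lin; case: (k); rewrite /rot !lcomb_cons.
ring.
Qed.

(** After the cancellation built into [shift_list], the only term left unrotated is [vker s] with a
    coefficient proportional to the defect. *)
Lemma kernels_shift b s t l j k x : 0 < x -> defect l = 0 ->
  kernels b (t + s) (shift_list s l) j k x = rotv s (kernels b t l) j k x.
Proof.
move=> x0 dl; have e k' : state_kernel mu (t + s) (shift_list s l) k' x = rot s (state_kernel mu t l) k' x.
  rewrite /state_kernel lcomb_shift_uker// vker_shift mulrDr.
  transitivity (defect l * vker k' s x + (rot s (fun k => vker k t) k' x -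
      mu * rot s (fun k => lcomb (uker k) l) k' x)); first by rewrite /defect; ring.
  by rewrite dl mul0r add0r; case: k'; rewrite /rot; ring.
case: j => //=; rewrite /rotv /kernels /noise_kernel lcomb_shift_vker e.
by case: k; rewrite /rot /vcomb; ring.
Qed.

Lemma horizon_shift s t l : 0 <= s -> 0 <= t -> horizon t l -> horizon (t + s) (shift_list s l).
Proof.
move=> s0 t0 hl p; rewrite inE => /predU1P[->|/mapP[q /hl /andP[q0 qt] ->]] /=.
  by rewrite s0 lerDr.
by rewrite addr_ge0//= lerD.
Qed.

Lemma defect_shift s l : defect (shift_list s l) = defect l.
Proof.
rewrite /defect; congr (_ - _ * _); rewrite /moment /shift_list big_cons big_map /=.
under eq_bigr do rewrite mulrDr; rewrite big_split/= -mulr_suml -/(mass l).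
by rewrite mulNr addrCA addNr addr0.
Qed.

(* A time shift merely rotates the kernels of a list of zero defect, so the
   infimum does not see the horizon. *)
Definition admissible (tl : R * seq (R * R)) :=
  [/\ 0 <= tl.1, horizon tl.1 tl.2 & defect tl.2 = 0].

Definition limit_cost b := inf [set cost H1 H2 mu b 1 tl.1 tl.2 | tl in admissible].

Lemma limit_cost_has_inf b : has_inf [set cost H1 H2 mu b 1 tl.1 tl.2 | tl in admissible].
Proof.
split; last by exists 0 => _ [tl _ <-]; rewrite cost_ge0.
(* The single time [1] with weight [mu^-1] has moment [mu^-1], hence zero defect. *)
exists (cost H1 H2 mu b 1 1 [:: (mu^-1, 1)]), (1, [:: (mu^-1, 1)]) => //; split => //=.
  by move=> p; rewrite inE => /eqP -> /=; rewrite ler01 lexx.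
by rewrite /defect /moment big_cons big_nil addr0 mulr1 mulfV// subrr.
Qed.

Lemma limit_cost_le b t l : 0 <= t -> horizon t l -> defect l = 0 ->
  limit_cost b <= cost H1 H2 mu b 1 t l.
Proof.
move=> t0 hl dl; apply: ge_inf; first by have [] := limit_cost_has_inf b.
by exists (t, l).
Qed.

Lemma limit_cost_ge0 b : 0 <= limit_cost b.
Proof.
apply: lb_le_inf; first by have [] := limit_cost_has_inf b.
by move=> _ [tl _ <-]; rewrite cost_ge0.
Qed.

Lemma limit_cost_approx b e : 0 < e -> exists t l,
  [/\ 0 <= t, horizon t l, defect l = 0 & cost H1 H2 mu b 1 t l < limit_cost b + e].
Proof.
move=> e0; have [_ [[t l] [/= t0 hl dl] <-] h] := inf_adherent e0 (limit_cost_has_inf b).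
by exists t, l.
Qed.

Lemma lcomb_affine (ker : R -> R -> R) s l l' x :
  lcomb ker (scale_list (1 - s) l ++ scale_list s l') x =
  lcomb ker l x + s * (lcomb ker l' x - lcomb ker l x).
Proof. by rewrite lcomb_cat !lcomb_scale; ring. Qed.

Lemma kernels_affine b t s l l' j k x :
  kernels b t (scale_list (1 - s) l ++ scale_list s l') j k x =
  s * (-1 * kernels b t l j k x + kernels b t l' j k x) + kernels b t l j k x.
Proof.
have e k' : state_kernel mu t (scale_list (1 - s) l ++ scale_list s l') k' x =
  s * (-1 * state_kernel mu t l k' x + state_kernel mu t l' k' x) + state_kernel mu t l k' x.
  by rewrite /state_kernel lcomb_affine; ring.
by case: j => //=; rewrite /noise_kernel e lcomb_affine; ring.
Qed.

Lemma moment_scale a l : moment (scale_list a l) = a * moment l.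
Proof.
by rewrite /moment /scale_list big_map mulr_sumr; apply: eq_bigr => p _ /=; rewrite mulrA.
Qed.

Lemma defect_affine s l l' : defect l = 0 -> defect l' = 0 ->
  defect (scale_list (1 - s) l ++ scale_list s l') = 0.
Proof.
rewrite /defect {3}/moment big_cat /= -!/(moment _) !moment_scale => h h'.
have -> : 1 - mu * ((1 - s) * moment l + s * moment l') =
  (1 - s) * (1 - mu * moment l) + s * (1 - mu * moment l') by ring.
by rewrite h h' !mulr0 addr0.
Qed.

(* Near-minimality of [l] makes its kernels nearly orthogonal to the
   directions of the admissible affine space. *)
Lemma limit_cost_convexity b t l l' e : 0 <= t -> horizon t l -> horizon t l' ->
  defect l = 0 -> defect l' = 0 -> 0 < e ->
  cost H1 H2 mu b 1 t l <= limit_cost b + e ^+ 2 ->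
  limit_cost b - e / 2 - e * (cost H1 H2 mu b 1 t l' + cost H1 H2 mu b 1 t l) <=
  ip (kernels b t l') (kernels b t l).
Proof.
move=> t0 hl hl' dl dl' e0 hc; set Q := limit_cost b.
set g := kernels b t l; set a := kernels b t l'.
have dg : decays4 g by apply: decays4_kernels => //; exact: horizon_nonneg hl.
have da : decays4 a by apply: decays4_kernels => //; exact: horizon_nonneg hl'.
have dag : decays4 (fun j k x => -1 * g j k x + a j k x) by exact: decays4_lin.
have hm : horizon t (scale_list (1 - e) l ++ scale_list e l').
  by move=> p; rewrite mem_cat => /orP[/mapP[q /hl hq ->]|/mapP[q /hl' hq ->]].
have := limit_cost_le b t0 hm (defect_affine e dl dl').
rewrite cost_ip (eq_ip (fun j k x _ => kernels_affine b t e l l' j k x)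
  (fun j k x _ => kernels_affine b t e l l' j k x)).
rewrite ip_sqr_lin// ip_sqr_lin// ip_linl// -/g -/a -/Q.
have := limit_cost_le b t0 hl dl; rewrite -/Q.
move: hc; rewrite !cost_ip -/g -/a -/Q (ipC g a).
have := ip_ge0 (fun j k x => 1 * a j k x + g j k x); rewrite ip_sqr_lin//.
move: (ip a g) (ip a a) (ip g g) (ip_ge0 a) (ip_ge0 g) => z A G A0 G0 h1 h2 h3 h4.
(* The variational inequality at step [e] is divided by [2 e]: the slack [e ^ 2] contributes
   [e / 2], the quadratic term at most [e (A + G)]. *)
rewrite -(ler_pM2l (_ : 0 < 2 * e)); last lra.
have : e ^+ 2 * (2 * (A + G) - (G - 2 * z + A)) >= 0 by rewrite mulr_ge0 ?sqr_ge0//; lra.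
have : e * (G - Q) >= 0 by rewrite mulr_ge0 ?(ltW e0)//; lra.
by move: h2 h4; clear; lra.
Qed.

End ConstrainedProblem.

(** * A priori bounds from the kernel identity *)

Section DriftEstimates.
Variables (R : realType) (H1 H2 : R) (hH1 : 0 < H1 < 1) (hH2 : 0 < H2 < 1) (mu : R).
Hypothesis mu0 : mu != 0.
Implicit Types (l : seq (R * R)) (t b x : R).
Local Notation D := (`]0, +oo[%classic : set R).
Local Notation I := (\1_(`[1, 2]%classic) : R -> R).
Local Notation m := (fun x : R => (1 + x) ^- 2).

Definition nsqr (f : bool -> R -> R) (x : R) : R := f true x * f true x + f false x * f false x.

Lemma nsqr_ge0 f x : 0 <= nsqr f x.
Proof. by rewrite /nsqr -!expr2 addr_ge0// sqr_ge0. Qed.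

Lemma decays_nsqr f : decays2 f -> decays 2 (nsqr f).
Proof. by move=> df; exact: decays_ninner. Qed.

Lemma wint_nsqr (H : R) f : 0 < H < 1 -> wint H (nsqr f) = 2 * cosint H 1 * ninner H f f.
Proof.
move=> hH; rewrite /ninner mulVKf// mulf_neq0// gt_eqF//; exact: cosint_gt0.
Qed.

Lemma mul_uker_true l x : 0 < x -> x * lcomb (uker true) l x = lcomb (vker false) l x.
Proof.
move=> x0; rewrite /lcomb mulr_sumr; apply: eq_bigr => p _; rewrite /uker /vker.
by field; rewrite gt_eqF.
Qed.

Lemma mul_uker_false l x : 0 < x -> x * lcomb (uker false) l x = moment l - lcomb (vker true) l x.
Proof.
move=> x0; rewrite /lcomb /moment -sumrB mulr_sumr; apply: eq_bigr => p _; rewrite /uker /vker.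
by field; rewrite gt_eqF.
Qed.

(* The Laplace-domain form of the state equation: with [f + i f'] standing for
   the pair of components, [(i x - b) phi + mu p = expi (x t) - defect]. *)
Lemma kernel_identity b t l x : 0 < x ->
  let phi k := state_kernel mu t l k x in let p k := noise_kernel mu b t l k x in
  - x * phi false - b * phi true + mu * p true = cos (x * t) - defect mu l /\
  x * phi true - b * phi false + mu * p false = sin (x * t).
Proof.
move=> x0; rewrite /noise_kernel.
have e1 : x * state_kernel mu t l false x = 1 - cos (x * t) - mu * (moment l - lcomb (vker true) l x).
  rewrite -(mul_uker_false l x0) /state_kernel /vker; by field; rewrite gt_eqF.
have e2 : x * state_kernel mu t l true x = sin (x * t) - mu * lcomb (vker false) l x.
  rewrite -(mul_uker_true l x0) /state_kernel /vker; by field; rewrite gt_eqF.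
have mp (a c : R) : mu * (a + b / mu * c) = mu * a + b * c by field.
by split; rewrite mp ?mulNr ?e1 ?e2 /defect; ring.
Qed.

Lemma sqr3_le (a b c : R) : (a + b + c) ^+ 2 <= 3 * (a ^+ 2 + b ^+ 2 + c ^+ 2).
Proof. by have := sqr_ge0 (a - b); have := sqr_ge0 (a - c); have := sqr_ge0 (b - c); nra. Qed.

(** Solving the identity for the state kernel, with [|i x - b|^2 = x^2 + b^2], bounds it pointwise
    by the noise kernel and the defect, hence in the [H2] norm as well, where the cost alone gives
    no control. *)
Lemma kernel_sqr_le b t l x : 0 < x ->
  (x ^+ 2 + b ^+ 2) * nsqr (state_kernel mu t l) x <=
  3 * (1 + defect mu l ^+ 2) + 3 * mu ^+ 2 * nsqr (noise_kernel mu b t l) x.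
Proof.
move=> x0; have [] := kernel_identity b t l x0; rewrite /nsqr.
set f := state_kernel mu t l true x; set g := state_kernel mu t l false x.
set p := noise_kernel mu b t l true x; set q := noise_kernel mu b t l false x.
set L := defect _ _ => h1 h2.
have -> : (x ^+ 2 + b ^+ 2) * (f * f + g * g) =
  (cos (x * t) + - L + - (mu * p)) ^+ 2 + (sin (x * t) + - (mu * q) + 0) ^+ 2.
  rewrite -h1 -h2; ring.
have := sqr3_le (cos (x * t)) (- L) (- (mu * p)).
have := sqr3_le (sin (x * t)) (- (mu * q)) 0.
have := cos2Dsin2 (x * t); nra.
Qed.

(** On this window [x^2 <= 4], so the real part of the identity, solved for the defect as a sum of
    four terms, has bounded coefficients. *)
Lemma defect_sqr_le b t l x : 1 <= x <= 2 ->
  defect mu l ^+ 2 <= 4 + 4 * (4 + b ^+ 2) * nsqr (state_kernel mu t l) x +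
    4 * mu ^+ 2 * nsqr (noise_kernel mu b t l) x.
Proof.
move=> /andP[x1 x2]; have x0 : 0 < x := lt_le_trans ltr01 x1.
have [+ _] := kernel_identity b t l x0; rewrite /nsqr.
set f := state_kernel mu t l false x; set g := state_kernel mu t l true x.
set p := noise_kernel mu b t l true x; set q := noise_kernel mu b t l false x.
set L := defect _ _ => h1.
have -> : L = cos (x * t) + x * f + b * g - mu * p by rewrite -[cos _](subrK L) -h1; ring.
have c1 : cos (x * t) ^+ 2 <= 1 by have := cos2Dsin2 (x * t); have := sqr_ge0 (sin (x * t)); lra.
have xx : x ^+ 2 <= 4 by nra.
have h4 (a c d e : R) : (a + c + d - e) ^+ 2 <= 4 * (a ^+ 2 + c ^+ 2 + d ^+ 2 + e ^+ 2).
  have := sqr_ge0 (a - c); have := sqr_ge0 (a - d); have := sqr_ge0 (a + e).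
  by have := sqr_ge0 (c - d); have := sqr_ge0 (c + e); have := sqr_ge0 (d + e); nra.
apply: le_trans (h4 _ _ _ _) _; rewrite !exprMn.
have f0 := sqr_ge0 f; have g0 := sqr_ge0 g; have b0 := sqr_ge0 b; have m0 := sqr_ge0 mu.
have q0 : 0 <= mu ^+ 2 * q ^+ 2 by rewrite mulr_ge0// sqr_ge0.
have e1 : x ^+ 2 * f ^+ 2 <= 4 * f ^+ 2 by rewrite ler_wpM2r.
have e2 : 0 <= b ^+ 2 * f ^+ 2 by rewrite mulr_ge0.
by rewrite -!expr2; lra.
Qed.

Lemma powR_segment (q x : R) : -1 <= q <= 1 -> 1 <= x <= 2 -> 2^-1 <= x `^ q <= 2.
Proof.
move=> /andP[q1 q2] /andP[x1 x2]; have x0 : 0 < x := lt_le_trans ltr01 x1.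
have hx : x `^ q <= x by rewrite -[leRHS](powRr1 (ltW x0)); exact: ler_powR.
have hy : x^-1 <= x `^ q by rewrite -powR_inv1 ?(ltW x0)//; exact: ler_powR.
rewrite (le_trans _ hy)/= ?(le_trans hx)// lef_pV2 ?posrE//.
Qed.

(** Both weights lie between [1/2] and [2] on the window, so they differ by a factor of at most [4]:
    a quantity controlled with [H1] can be integrated with [H2]. *)
Lemma wint_segment_le f : decays 2 f -> (forall x, 0 < x -> 0 <= f x) ->
  wint H2 (fun x => I x * f x) <= 4 * wint H1 f.
Proof.
move=> df f0; have [/andP[H10 H11] /andP[H20 H21]] := (hH1, hH2).
have mI : measurable_fun D I by apply: measurable_indic; exact: measurable_itv.
have dI : decays 2 (fun x => I x * f x).
  apply: (@decays_bounded _ 2 _ _ 1) df mI _ => x _.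
  by rewrite indicE; case: (_ \in _); rewrite ?normr1 ?normr0.
rewrite -(wintZ hH1 _ df); apply: le_Rintegral => //.
- exact: (decays_intg hH2 dI).
- exact: (decays_intg hH1 (decaysZ 4 df)).
move=> x; rewrite halflineP => x0; rewrite indicE; case: (boolP (x \in _)) => [|_].
  rewrite inE/= in_itv/= mul1r => hx.
  have /andP[_ h2] : 2^-1 <= x `^ (1 - 2 * H2) <= 2 by apply: powR_segment => //; lra.
  have /andP[h1 _] : 2^-1 <= x `^ (1 - 2 * H1) <= 2 by apply: powR_segment => //; lra.
  have := f0 x x0; nra.
by rewrite !mul0r !mulr_ge0 ?powR_ge0// f0.
Qed.

(** The defect does not depend on the frequency, so averaging [defect_sqr_le] over the window bounds
    it by the cost. The bound is uniform in the horizon and in the list, and depends on the drift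
    through [B] only. *)
Lemma defect_bound B K : 0 <= K -> exists M, 0 <= M /\ forall b t l, b ^+ 2 <= B -> 0 <= t ->
  horizon t l -> cost H1 H2 mu b 1 t l <= K -> defect mu l ^+ 2 <= M.
Proof.
move=> K0; pose i := wint H2 I; have i0 : 0 < i by exact: wint_indic_gt0.
pose c1 := 2 * cosint H1 1; have c10 : 0 < c1 by rewrite mulr_gt0// cosint_gt0.
pose c2 := 2 * cosint H2 1; have c20 : 0 < c2 by rewrite mulr_gt0// cosint_gt0.
pose M0 := 4 * i + 4 * (4 + B) * (4 * (c1 * K)) + 4 * mu ^+ 2 * (c2 * K).
exists (`|M0| / i); split; first by rewrite divr_ge0// ltW.
move=> b t l bB t0 hl hc; have hn := horizon_nonneg hl.
have d1 := decays_nsqr (decays2_state_kernel mu t0 hn).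
have d2 := decays_nsqr (decays2_noise_kernel mu b t0 hn).
set u := nsqr (state_kernel mu t l) in d1; set v := nsqr (noise_kernel mu b t l) in d2.
have [n1 n2] : ninner H1 (state_kernel mu t l) (state_kernel mu t l) <= K /\
    ninner H2 (noise_kernel mu b t l) (noise_kernel mu b t l) <= K.
  move: hc; rewrite /cost mul1r.
  have := ninner_ge0 hH1 (state_kernel mu t l); have := ninner_ge0 hH2 (noise_kernel mu b t l).
  by move=> *; split; lra.
have dI := @decays_indic R.
have mI : measurable_fun D I by apply: measurable_indic; exact: measurable_itv.
have dIu : decays 2 (fun x => I x * u x).
  apply: (@decays_bounded _ 2 _ _ 1) d1 mI _ => x _.
  by rewrite indicE; case: (_ \in _); rewrite ?normr1 ?normr0.
have e1 : 4 * (4 + b ^+ 2) * wint H2 (fun x => I x * u x) <= 4 * (4 + B) * (4 * (c1 * K)).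
  have b0 := sqr_ge0 b.
  apply: ler_pM; [lra|by apply: wint_ge0 => x _; rewrite mulr_ge0 ?nsqr_ge0// indicE|lra|].
  apply: le_trans (wint_segment_le d1 (fun x _ => nsqr_ge0 _ x)) _.
  rewrite wint_nsqr// -/c1 ler_wpM2l// ler_wpM2l//; exact: ltW.
have m2 : 0 <= 4 * mu ^+ 2 by apply: mulr_ge0 => //; exact: sqr_ge0.
have e2 : 4 * mu ^+ 2 * wint H2 v <= 4 * mu ^+ 2 * (c2 * K).
  rewrite (ler_wpM2l m2)// /v wint_nsqr// -/c2 ler_wpM2l//; exact: ltW.
rewrite ler_pdivlMr// (le_trans _ (ler_norm _))//.
apply: (@le_trans _ _ (4 * i + 4 * (4 + b ^+ 2) * wint H2 (fun x => I x * u x) + 4 * mu ^+ 2 * wint H2 v)); last first.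
  by rewrite /M0; lra.
rewrite -(wintZ hH2 _ dI) -(wintZ hH2 _ dI) -(wintZ hH2 _ dIu) -(wintZ hH2 _ d2).
rewrite -!wintD//; try (apply: decaysD); try exact: decaysZ.
apply: wint_le => //; [exact: decaysZ|by do 2?apply: decaysD; exact: decaysZ|] => x x0.
have v0 := nsqr_ge0 (noise_kernel mu b t l) x.
rewrite indicE; case: (boolP (x \in _)) => [|_].
  rewrite inE/= in_itv/= !mulr1 mul1r; exact: defect_sqr_le.
by rewrite !mulr0 mul0r mulr0 !add0r mulr_ge0.
Qed.

End DriftEstimates.

Section DriftPerturbation.
Variables (R : realType) (H1 H2 : R) (hH1 : 0 < H1 < 1) (hH2 : 0 < H2 < 1) (mu : R).
Hypothesis mu0 : mu != 0.
Local Notation D := (`]0, +oo[%classic : set R).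
Local Notation m := (fun x : R => (1 + x) ^- 2).

(** The factor by which [kernel_sqr_le] bounds [|de phi|^2]. With [de = - b] it is at most one and
    tends to zero with [b] at each frequency, though not uniformly near [x = 0]. *)
Definition drift_ratio (de b x : R) : R := de ^+ 2 * (x ^+ 2 + b ^+ 2)^-1.

Lemma drift_ratio_ge0 de b x : 0 <= drift_ratio de b x.
Proof. by rewrite mulr_ge0 ?sqr_ge0// invr_ge0 addr_ge0 ?sqr_ge0. Qed.

Lemma measurable_drift_ratio de b : measurable_fun D (drift_ratio de b).
Proof.
apply: measurable_funM => //; apply: open_continuous_measurable_fun; first exact: interval_open.
move=> x; rewrite inE halflineP => x0; apply: cvgV.
  by rewrite gt_eqF// ltr_pwDl ?exprn_gt0 ?sqr_ge0.
by apply: cvgD; [exact: (cvgM cvg_id cvg_id)|exact: cvg_cst].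
Qed.

Lemma wint_norm_le f g : decays 2 f -> decays 2 g ->
  (forall x : R, 0 < x -> `|f x| <= g x) -> `|wint H2 f| <= wint H2 g.
Proof.
move=> df dg fg; rewrite ler_norml -mulN1r -wintZ//; apply/andP; split; apply: wint_le => //.
- exact: decaysZ.
- by move=> x /fg; rewrite ler_norml mulN1r => /andP[].
- by move=> x /fg; rewrite ler_norml => /andP[].
Qed.

Lemma decays_weight : decays 2 m.
Proof. by have := @decays_dom R 2 1; congr decays; apply/funext => x; rewrite mul1r. Qed.

Lemma weight_le1 (x : R) : 0 < x -> 0 <= m x <= 1.
Proof.
move=> x0; have x1 : 1 <= 1 + x by rewrite lerDl ltW.
by rewrite invr_ge0 exprn_ge0 ?(le_trans ler01)//= invf_le1 ?exprn_ege1// exprn_gt0// (lt_le_trans ltr01).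
Qed.

Variables (de b t C : R) (l : seq (R * R)).
Hypotheses (t0 : 0 <= t) (hl : horizon t l).
Hypothesis C_bound : forall x, 0 < x -> drift_ratio de b x <= C * m x.

Local Notation phi := (state_kernel mu t l).
Local Notation p := (noise_kernel mu b t l).
Local Notation L := (3 * (1 + defect mu l ^+ 2)).
Local Notation drift := (fun k x => de * phi k x).

Lemma decays_drift_ratio : decays 2 (drift_ratio de b).
Proof.
split; first exact: measurable_drift_ratio.
by exists C => x x0; rewrite ger0_norm ?drift_ratio_ge0// C_bound.
Qed.

Lemma drift_const_ge0 : 0 <= C.
Proof.
have := le_trans (drift_ratio_ge0 de b 1) (C_bound ltr01).
by rewrite pmulr_lge0// invr_gt0 exprn_gt0.
Qed.

Lemma decays2_drift : decays2 drift.
Proof. by move=> k; apply: decaysZ; exact: (decays2_state_kernel mu t0 (horizon_nonneg hl)). Qed.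

Lemma drift_nsqr_le x : 0 < x ->
  nsqr drift x <= drift_ratio de b x * (L + 3 * mu ^+ 2 * nsqr p x).
Proof.
move=> x0; have q0 : x ^+ 2 + b ^+ 2 != 0 by rewrite gt_eqF// ltr_pwDl ?exprn_gt0 ?sqr_ge0.
have -> : nsqr drift x = drift_ratio de b x * ((x ^+ 2 + b ^+ 2) * nsqr phi x).
  by rewrite /drift_ratio /nsqr; field.
by rewrite ler_wpM2l ?drift_ratio_ge0// kernel_sqr_le.
Qed.

Lemma mu_nsqr_ge0 x : 0 <= 3 * mu ^+ 2 * nsqr p x.
Proof. by apply: mulr_ge0; [apply: mulr_ge0 => //; exact: sqr_ge0|exact: nsqr_ge0]. Qed.

Lemma L_ge0 : 0 <= L.
Proof. by apply: mulr_ge0 => //; apply: addr_ge0 => //; exact: sqr_ge0. Qed.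

Let dp : decays 2 (nsqr p).
Proof. exact: decays_nsqr (decays2_noise_kernel mu b t0 (horizon_nonneg hl)). Qed.

(** This gives boundedness only, through the constant [C]; smallness is obtained in
    [drift_cross_le], against a fixed profile. *)
Lemma drift_norm_le : wint H2 (nsqr drift) <=
  L * (C * wint H2 m) + 3 * mu ^+ 2 * C * wint H2 (nsqr p).
Proof.
have dm := decays_weight; have C0 := drift_const_ge0.
rewrite -(wintZ hH2 _ dm) -(wintZ hH2 _ (decaysZ C dm)) -(wintZ hH2 _ dp).
rewrite -wintD//; [|exact: decaysZ (decaysZ C dm)|exact: decaysZ].
apply: wint_le => //; first exact: decays_nsqr decays2_drift.
  by apply: decaysD; [exact: decaysZ (decaysZ C dm)|exact: decaysZ].
move=> x x0; apply: le_trans (drift_nsqr_le x0) _.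
have h := C_bound x0; have /andP[m0 m1] := weight_le1 x0.
have h1 : drift_ratio de b x * L <= L * (C * m x) by rewrite mulrC ler_wpM2l// L_ge0.
have h2 : drift_ratio de b x * (3 * mu ^+ 2 * nsqr p x) <= 3 * mu ^+ 2 * C * nsqr p x.
  rewrite [leRHS](_ : _ = C * (3 * mu ^+ 2 * nsqr p x)); last by ring.
  by rewrite ler_wpM2r ?mu_nsqr_ge0// (le_trans h)// ler_piMr.
by rewrite mulrDr lerD.
Qed.

(* The mean inequality is used with the weight [m] so that the first summand
   is integrable although the kernels satisfy only a pointwise bound. *)
Lemma drift_cross_le G Cg s : decays2 G -> 0 < s ->
  (forall x, 0 < x -> nsqr G x <= Cg * m x) ->
  2 * (2 * cosint H2 1) * `|ninner H2 drift G| <=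
  s * (L * wint H2 m + 3 * mu ^+ 2 * wint H2 (nsqr p)) + Cg / s * wint H2 (drift_ratio de b).
Proof.
move=> dG s0 hG; have dm := decays_weight; have dk := decays_drift_ratio.
have c0 := cosint_gt0 hH2; have c20 : 0 < 2 * cosint H2 1 by rewrite mulr_gt0.
have dd := decays_ninner decays2_drift dG.
rewrite /ninner normrM gtr0_norm ?invr_gt0// [leLHS](_ : _ = 2 * `|wint H2 (fun x => drift true x * G true x + drift false x * G false x)|); last first.
  by field; rewrite gt_eqF.
have d1 : decays 2 (fun x => L * m x + 3 * mu ^+ 2 * nsqr p x).
  exact: decaysD (decaysZ L dm) (decaysZ (3 * mu ^+ 2) dp).
have d2 : decays 2 (fun x => s * (L * m x + 3 * mu ^+ 2 * nsqr p x) + Cg / s * drift_ratio de b x).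
  exact: decaysD (decaysZ s d1) (decaysZ (Cg / s) dk).
have -> : s * (L * wint H2 m + 3 * mu ^+ 2 * wint H2 (nsqr p)) + Cg / s * wint H2 (drift_ratio de b) =
    wint H2 (fun x => s * (L * m x + 3 * mu ^+ 2 * nsqr p x) + Cg / s * drift_ratio de b x).
  rewrite -(wintZ hH2 L dm) -(wintZ hH2 _ dp) -(wintZ hH2 (Cg / s) dk).
  rewrite -(wintD hH2 (decaysZ L dm) (decaysZ _ dp)) -(wintZ hH2 s d1).
  by rewrite -(wintD hH2 (decaysZ s d1) (decaysZ _ dk)).
rewrite -[2 in leLHS]ger0_norm// -normrM -wintZ//; apply: wint_norm_le => //; first exact: decaysZ.
move=> x x0; have /andP[m0 m1] := weight_le1 x0.
set E := L + 3 * mu ^+ 2 * nsqr p x.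
have E0 : 0 <= E by rewrite addr_ge0 ?mu_nsqr_ge0// L_ge0.
set k := drift_ratio de b x; have k0 : 0 <= k := drift_ratio_ge0 de b x.
have Cgm : 0 <= Cg * m x := le_trans (nsqr_ge0 G x) (hG x x0).
have Cg0 : 0 <= Cg.
  by move: Cgm; rewrite pmulr_lge0// invr_gt0 exprn_gt0// ltr_wpDl.
apply: (@le_trans _ _ (s * (m x * E) + Cg / s * k)); last first.
  rewrite lerD2r ler_wpM2l ?(ltW s0)// /E mulrDr lerD//; first by rewrite mulrC.
  by rewrite ler_piMl ?mu_nsqr_ge0.
have A0 : 0 <= s * (m x * E) by rewrite mulr_ge0 ?(ltW s0)// mulr_ge0.
have B0 : 0 <= Cg / s * k by rewrite mulr_ge0// divr_ge0// ltW.
rewrite -(ler_pXn2r (n := 2)) ?nnegrE ?addr_ge0// real_normK ?num_real//.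
have cs : (drift true x * G true x + drift false x * G false x) ^+ 2 <= nsqr drift x * nsqr G x.
  by rewrite /nsqr; have := sqr_ge0 (drift true x * G false x - drift false x * G true x); nra.
(* The weight [m] is moved from the bound on [G] to the bound on the drift, and [s] is inserted, so
   that the arithmetic-geometric mean of the two factors is the claimed sum. *)
have AB : nsqr drift x * nsqr G x <= (s * (m x * E)) * (Cg / s * k).
  rewrite [leRHS](_ : _ = (k * E) * (Cg * m x)); last by move: (m x) => y; field; rewrite gt_eqF.
  by apply: ler_pM; rewrite ?nsqr_ge0//; [exact: drift_nsqr_le|exact: hG].
move: (le_trans cs AB); move: (s * (m x * E)) (Cg / s * k) A0 B0 => A B A0 B0 h.
by have := sqr_ge0 (A - B); nra.
Qed.

End DriftPerturbation.

Section LongHorizonLimit.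
Variables (R : realType) (H1 H2 : R) (hH1 : 0 < H1 < 1) (hH2 : 0 < H2 < 1) (mu : R).
Hypothesis mu0 : mu != 0.
Implicit Types (l : seq (R * R)) (t b : R).
Local Notation m := (fun x : R => (1 + x) ^- 2).
Local Notation Q b := (limit_cost H1 H2 mu b).
Local Notation J b t l := (cost H1 H2 mu b 1 t l).

Lemma cost_shift b s t l : defect mu l = 0 -> J b (t + s) (shift_list s l) = J b t l.
Proof.
move=> dl; rewrite !cost_ip -[RHS](ip_rotv H1 H2 s).
by apply: eq_ip => j k x x0; rewrite kernels_shift.
Qed.

Lemma min_cost_le_shift b T t l : 0 <= t <= T -> horizon t l -> defect mu l = 0 ->
  min_cost H1 H2 mu b 1 T <= J b t l.
Proof.
move=> /andP[t0 tT] hl dl; have s0 : 0 <= T - t by rewrite subr_ge0.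
rewrite -(cost_shift b (T - t) t dl) addrC subrK; apply: min_cost_le => //.
by have := horizon_shift s0 t0 hl; rewrite addrC subrK.
Qed.

Lemma cost_cvg (b_ : nat -> R) b t l : 0 <= t -> horizon t l -> b_ @ \oo --> b ->
  J (b_ n) t l @[n --> \oo] --> J b t l.
Proof.
move=> t0 /horizon_nonneg hl bb.
have d1 := decays2_state_kernel mu t0 hl; have d2 := decays2_noise_kernel mu b t0 hl.
set f := state_kernel mu t l in d1; set p := noise_kernel mu b t l in d2.
pose a n := (b_ n - b) / mu.
have a0 : a @ \oo --> 0.
  rewrite -[X in _ --> X](mul0r mu^-1) -(subrr b); apply: cvgM; last exact: cvg_cst.
  by apply: cvgB => //; exact: cvg_cst.
have JE n : J (b_ n) t l = ninner H1 f f + (a n * a n * ninner H2 f f + 2 * (a n) * ninner H2 f p + ninner H2 p p).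
  rewrite /cost mul1r -expr2 -ninner_sqr_lin//; congr (_ + _).
  by apply: eq_ninner => k x _; rewrite /p /noise_kernel -/f /a; ring.
rewrite (_ : (fun n => _) = fun n => ninner H1 f f + (a n * a n * ninner H2 f f + 2 * (a n) * ninner H2 f p + ninner H2 p p)); last exact/funext.
rewrite /cost mul1r; apply: cvgD; first exact: cvg_cst.
rewrite -[X in _ --> X]add0r; apply: cvgD; last exact: cvg_cst.
rewrite -[X in _ --> X]addr0; apply: cvgD.
  rewrite -[X in _ --> X](mul0r (ninner H2 f f)); apply: cvgM; last exact: cvg_cst.
  by rewrite -[X in _ --> X](mul0r 0); exact: (cvgM a0 a0).
rewrite -[X in _ --> X](mul0r (ninner H2 f p)); apply: cvgM; last exact: cvg_cst.
by rewrite -[X in _ --> X](mulr0 2); apply: cvgM => //; exact: cvg_cst.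
Qed.

(* Change of the kernels when the defect is repaired by one increment of
   length one. *)
Definition repair b (j : bool) (k : bool) (x : R) : R :=
  if j then -1 * uker k 1 x + 0 else mu^-1 * (- b * uker k 1 x + vker k 1 x) + 0.

(** Effect of changing the drift by [de] with the list fixed: only the noise kernel moves. The
    summand [0] matches the shape [a * f + g] of the linearity lemmas. *)
Definition drift_part de t l (j : bool) (k : bool) (x : R) : R :=
  if j then 0 else mu^-1 * (de * state_kernel mu t l k x) + 0.

Lemma spectral_repair b j : spectral (repair b j).
Proof.
have s1 := @spectral_uker R 1 ler01; have s2 := @spectral_vker R 1 ler01.
have s0 := @spectral0 R.
case: j; rewrite /repair; first exact: (spectral_lin (-1) s1 s0).
exact: (spectral_lin mu^-1 (spectral_lin (- b) s1 s2) s0).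
Qed.

Lemma spectral_kernels b t l j : 0 <= t -> nonneg_times l -> spectral (kernels mu b t l j).
Proof.
move=> t0 hl.
have sv : spectral (fun k => lcomb (vker k) l) by apply: spectral_lcomb => // r; exact: spectral_vker.
have su : spectral (fun k => lcomb (uker k) l) by apply: spectral_lcomb => // r; exact: spectral_uker.
have ss : spectral (state_kernel mu t l).
  apply: spectral_ext (spectral_lin (- mu) su (spectral_vker t0)) => k x.
  by rewrite /state_kernel; ring.
case: j => //=; apply: spectral_ext (spectral_lin (b / mu) ss sv) => k x.
by rewrite /noise_kernel addrC.
Qed.

Definition repaired l := (defect mu l / mu, 1) :: l.

Lemma defect_repaired l : defect mu (repaired l) = 0.
Proof. by rewrite {1}/defect /moment big_cons -/(moment l) /= /defect; field. Qed.

Lemma horizon_repaired t l : 1 <= t -> horizon t l -> horizon t (repaired l).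
Proof. by move=> t1 hl q; rewrite inE => /predU1P[->/=|/hl//]; rewrite ler01. Qed.

Lemma kernels_repaired b d t l j k x : kernels mu b t (repaired l) j k x =
  1 * (defect mu l * repair b j k x + kernels mu d t l j k x) + drift_part (b - d) t l j k x.
Proof.
case: j; rewrite /= /noise_kernel /state_kernel /repaired !lcomb_cons/=.
  by field.
by rewrite /state_kernel; field.
Qed.

Lemma decays4_drift_part de t l : 0 <= t -> nonneg_times l -> decays4 (drift_part de t l).
Proof.
move=> t0 hl; case=> k; first exact: decays0.
apply: (@decays_lin _ 1 mu^-1 (fun x => de * state_kernel mu t l k x) (fun=> 0)).
  by apply: decaysZ; exact: decays2_state_kernel.
exact: decays0.
Qed.

Lemma ip_drift_part de t l G : 0 <= t -> nonneg_times l -> decays4 G ->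
  ip H1 H2 (drift_part de t l) G =
  mu^-1 * ninner H2 (fun k x => de * state_kernel mu t l k x) (G false).
Proof.
move=> t0 hl dG; have dd : decays2 (fun k x => de * state_kernel mu t l k x).
  by move=> k; apply: decaysZ; exact: decays2_state_kernel.
have d0 : decays2 (fun _ _ => 0 : R) by move=> k; exact: decays0.
rewrite /ip /drift_part ninner0l// add0r (ninner_linl hH2 _ dd d0 (dG false)).
by rewrite ninner0l// addr0.
Qed.

Section Sequence.
Variables (T_ b_ : nat -> R) (b C : R).
Hypotheses (T_oo : T_ @ \oo --> +oo) (b_cvg : b_ @ \oo --> b).
Hypothesis C_bound : forall n x, 0 < x -> drift_ratio (b - b_ n) (b_ n) x <= C * m x.

(** One near-minimiser of zero defect is shifted to each horizon at no cost, so the varying drift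
    enters only through the continuity of the cost of a fixed list. *)
Lemma min_cost_upper e : 0 < e ->
  \forall n \near \oo, min_cost H1 H2 mu (b_ n) 1 (T_ n) <= Q b + e.
Proof.
move=> e0; have e2 : 0 < e / 2 by rewrite divr_gt0.
have [t [l [t0 hl dl hc]]] := limit_cost_approx hH1 hH2 mu0 b e2.
have /cvgryPge/(_ t) big := T_oo.
have /cvgrPdist_le/(_ _ e2) near_b := cost_cvg t0 hl b_cvg.
apply: filterS2 big near_b => n tT; rewrite ler_norml => /andP[h _].
by apply: le_trans (min_cost_le_shift _ _ hl dl) _; [rewrite t0|lra].
Qed.

Lemma wint_drift_ratio_cvg0 : wint H2 (drift_ratio (b - b_ n) (b_ n)) @[n --> \oo] --> 0.
Proof.
have hb n (x : R) : 0 < x -> `|drift_ratio (b - b_ n) (b_ n) x| <= C * m x.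
  by move=> x0; rewrite ger0_norm ?drift_ratio_ge0// C_bound.
have hc (x : R) : 0 < x -> drift_ratio (b - b_ n) (b_ n) x @[n --> \oo] --> 0.
  move=> x0; have x2 : 0 < x ^+ 2 by rewrite exprn_gt0.
  have c0 : (b - b_ n) * (b - b_ n) * (x ^+ 2)^-1 @[n --> \oo] --> 0.
    rewrite -[X in _ --> X](mul0r (x ^+ 2)^-1); apply: cvgM; last exact: cvg_cst.
    have z : b - b_ n @[n --> \oo] --> 0.
      by rewrite -(subrr b); apply: cvgB => //; exact: cvg_cst.
    by rewrite -[X in _ --> X](mul0r 0); exact: cvgM.
  apply: squeeze_cvgr (cvg_cst 0) c0; apply: nearW => n.
  rewrite drift_ratio_ge0/= /drift_ratio expr2 ler_wpM2l -?expr2 ?sqr_ge0//.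
  by rewrite lef_pV2 ?posrE ?ltr_pwDl ?sqr_ge0// lerDl sqr_ge0.
have [_] := wint_cvg hH2 (fun n => @measurable_drift_ratio R (b - b_ n) (b_ n)) hb hc.
by rewrite wint0.
Qed.

End Sequence.
End LongHorizonLimit.

(** * Lower bound for arbitrary lists by comparison with a shifted near-minimiser *)

Section LowerBound.
Variables (R : realType) (H1 H2 : R) (hH1 : 0 < H1 < 1) (hH2 : 0 < H2 < 1) (mu : R).
Hypothesis mu0 : mu != 0.
Local Notation m := (fun x : R => (1 + x) ^- 2).
Local Notation Q b := (limit_cost H1 H2 mu b).
Local Notation J b t l := (cost H1 H2 mu b 1 t l).
Local Notation ip := (ip H1 H2).
Local Notation c2 := (2 * cosint H2 1).

(** A majorant independent of the horizon and of the list; the factors [2] come from splitting the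
    repaired kernels successively into repair, original kernels and drift part. *)
Definition repaired_bound (b C M : R) : R :=
  2 * (2 * (M * ip (repair mu b) (repair mu b) + Q b) +
    mu^-1 * (mu^-1 * (c2^-1 * (3 * (1 + M) * (C * wint H2 m) + 3 * mu ^+ 2 * C * (c2 * Q b))))).

Section FixedHorizon.
Variables (b d T C M : R) (l : seq (R * R)).
Hypotheses (T1 : 1 <= T) (hl : horizon T l) (M_bound : defect mu l ^+ 2 <= M).
Hypothesis C_bound : forall x, 0 < x -> drift_ratio (b - d) d x <= C * m x.
Hypothesis cost_l : J d T l <= Q b.

Let T0 : 0 <= T. Proof. exact: le_trans T1. Qed.
Let C0 : 0 <= C. Proof. exact: drift_const_ge0 C_bound. Qed.
Let hn : nonneg_times l. Proof. exact: horizon_nonneg hl. Qed.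
Let c20 : 0 < c2. Proof. by rewrite mulr_gt0// cosint_gt0. Qed.
Let wm0 : 0 <= wint H2 m.
Proof. by apply: wint_ge0 => x x0; have /andP[] := weight_le1 x0. Qed.

Lemma noise_cost_le : wint H2 (nsqr (noise_kernel mu d T l)) <= c2 * Q b.
Proof.
rewrite wint_nsqr// ler_wpM2l//; first exact: ltW.
by move: cost_l; rewrite /cost mul1r; have := ninner_ge0 hH1 (state_kernel mu T l); lra.
Qed.

Lemma repaired_cost_le : J b T (repaired mu l) <= repaired_bound b C M.
Proof.
have dz : decays4 (repair mu b) by move=> j; apply: spectral_decays hH1 _ _; exact: spectral_repair.
have de := decays4_kernels mu d T0 hn.
have dw := decays4_drift_part mu (b - d) T0 hn.
have dze := decays4_lin (defect mu l) dz de.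
rewrite cost_ip (eq_ip H1 H2 (fun j k x _ => kernels_repaired mu0 b d T l j k x)
  (fun j k x _ => kernels_repaired mu0 b d T l j k x)).
apply: le_trans (ip_sqr_le hH1 hH2 dze dw) _; rewrite /repaired_bound ler_wpM2l// lerD//.
  rewrite ip_sqr_lin//; have := ip_ge0 hH1 hH2 (fun j k x => - defect mu l * repair mu b j k x + kernels mu d T l j k x).
  rewrite ip_sqr_lin// sqrrN -cost_ip => h.
  have : defect mu l ^+ 2 * ip (repair mu b) (repair mu b) <= M * ip (repair mu b) (repair mu b).
    by rewrite ler_wpM2r// ip_ge0.
  by move: cost_l; lra.
have dd := decays2_drift mu (b - d) T0 hl.
have d0 : decays2 (fun _ _ => 0 : R) by move=> k; exact: decays0.
rewrite ip_drift_part// ninnerC (ninner_linl hH2 _ dd d0 dd) ninner0l// addr0.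
rewrite !(mulrA mu^-1); apply: ler_wpM2l; first by rewrite -expr2 sqr_ge0.
rewrite -(ler_pM2l c20) -wint_nsqr// mulVKf ?gt_eqF//.
apply: le_trans (drift_norm_le hH2 mu0 T0 hl C_bound) _; apply: lerD.
  apply: ler_wpM2r; first by rewrite mulr_ge0.
  by rewrite ler_wpM2l// lerD2l.
apply: ler_wpM2l; last exact: noise_cost_le.
by apply: mulr_ge0 => //; apply: mulr_ge0 => //; exact: sqr_ge0.
Qed.

(** Young's inequality against the near-minimiser [lg] bounds the cost of [l] below by an inner
    product. Passing from [l] to its repaired list makes [limit_cost_convexity] applicable, at the
    price of the inner products of [lg] with the repair and with the drift part. *)
Lemma perturbed_lower lg e : horizon T lg -> defect mu lg = 0 -> 0 < e ->
  J b T lg <= Q b + e ^+ 2 ->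
  Q b - e ^+ 2 - e - 2 * e * (repaired_bound b C M + Q b + e ^+ 2) -
    2 * (M + 1) * `|ip (repair mu b) (kernels mu b T lg)| -
    2 * `|mu^-1| * `|ninner H2 (fun k x => (b - d) * state_kernel mu T l k x) (kernels mu b T lg false)|
  <= J d T l.
Proof.
move=> hlg dlg e0 cg; have hng := horizon_nonneg hlg.
have dz : decays4 (repair mu b) by move=> j; apply: spectral_decays hH1 _ _; exact: spectral_repair.
have de := decays4_kernels mu d T0 hn; have dg := decays4_kernels mu b T0 hng.
have dw := decays4_drift_part mu (b - d) T0 hn.
have dze := decays4_lin (defect mu l) dz de.
have := limit_cost_convexity hH1 hH2 mu0 T0 hlg (@horizon_repaired _ mu _ _ T1 hl) dlg (defect_repaired mu0 l) e0 cg.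
rewrite (eq_ip H1 H2 (fun j k x _ => kernels_repaired mu0 b d T l j k x) (fun j k x _ => erefl)).
rewrite !ip_linl// mul1r ip_drift_part//.
have := ip_young hH1 hH2 de dg; rewrite -!cost_ip.
have := repaired_cost_le; move: cg.
set g := kernels mu b T lg; set z := ip (repair mu b) g; set X := ninner H2 _ _; set y := ip _ g.
set A := cost H1 H2 mu b 1 T (repaired mu l); set G := cost _ _ _ _ _ _ lg.
set K := repaired_bound b C M => cg hA hy hc.
have hlam : `|defect mu l| <= M + 1.
  have h := sqr_ge0 (`|defect mu l| - 1); have h2 := real_normK (num_real (defect mu l)).
  have h3 := normr_ge0 (defect mu l); move: M_bound; rewrite -h2; move: h h3.
  by move: `|defect mu l| => u; nra.
have h1 : defect mu l * z <= (M + 1) * `|z|.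
  by rewrite (le_trans (ler_norm _))// normrM ler_wpM2r.
have h2 : mu^-1 * X <= `|mu^-1| * `|X| by rewrite (le_trans (ler_norm _))// normrM.
have h3 : e * (A + G) <= e * (K + Q b + e ^+ 2).
  by rewrite ler_wpM2l ?(ltW e0)//; lra.
by lra.
Qed.

End FixedHorizon.

Section Sequence.
Variables (T_ b_ : nat -> R) (b C : R).
Hypotheses (T_oo : T_ @ \oo --> +oo) (b_cvg : b_ @ \oo --> b).
Hypothesis C_bound : forall n x, 0 < x -> drift_ratio (b - b_ n) (b_ n) x <= C * m x.

(** The comparison list is one near-minimiser shifted to end at [T_n]. Its kernels are rotations of
    fixed ones: they become orthogonal to the fixed repair, and their modulus stays fixed, as the
    estimate of the drift part requires. *)
Lemma min_cost_lower : exists K, forall e, 0 < e <= 1 ->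
  \forall n \near \oo, Q b - e * K <= min_cost H1 H2 mu (b_ n) 1 (T_ n).
Proof.
pose B := b ^+ 2 + 1.
have Q0 : 0 <= Q b := limit_cost_ge0 hH1 hH2 mu0 b.
have [M [M0 hM]] := defect_bound hH1 hH2 mu0 B Q0.
have C0 : 0 <= C := drift_const_ge0 (C_bound 0).
have c20 : 0 < c2 by rewrite mulr_gt0// cosint_gt0.
have wm0 : 0 <= wint H2 m by apply: wint_ge0 => x x0; have /andP[] := weight_le1 x0.
pose Ka := repaired_bound b C M.
exists (2 + 2 * (`|Ka| + Q b + 1) + 2 * (M + 1) + 2 * `|mu^-1| / c2) => e /andP[e0 e1].
have e20 : 0 < e ^+ 2 by rewrite exprn_gt0.
have [t0 [l0 [t00 hl0 dl0 hc0]]] := limit_cost_approx hH1 hH2 mu0 b e20.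
pose s n := T_ n - t0; pose g := kernels mu b t0 l0.
have hn0 := horizon_nonneg hl0.
have s_oo : s @ \oo --> +oo.
  apply/cvgryPge => A; have /cvgryPge/(_ (A + t0)) h := T_oo.
  by apply: filterS h => n; rewrite /s lerBrDr.
have zeta0 : ip (repair mu b) (rotv (s n) g) @[n --> \oo] --> 0.
  rewrite -[X in _ --> X](addr0 0); apply: cvgD; rewrite /rotv.
    by apply: spectral_rot_cvg0 => //; [exact: spectral_repair|exact: spectral_kernels].
  by apply: spectral_rot_cvg0 => //; [exact: spectral_repair|exact: spectral_kernels].
have dg := decays4_kernels mu b t00 hn0.
have [_ [Cg hCg]] := decays_nsqr (dg false).
pose A := 3 * (1 + M) * wint H2 m + 3 * mu ^+ 2 * (c2 * Q b).
have A0 : 0 <= A.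
  rewrite /A addr_ge0// mulr_ge0//; first by rewrite mulr_ge0// addr_ge0.
    by apply: mulr_ge0 => //; exact: sqr_ge0.
  by rewrite mulr_ge0// ltW.
(* The parameter of the weighted mean inequality: [r A <= e] makes the first summand small uniformly
   in [n], after which the second tends to zero with [r] fixed. *)
pose r := e / (A + 1); have A1 : 0 < A + 1 by rewrite ltr_wpDl.
have r0 : 0 < r by rewrite divr_gt0.
have kappa0 : Cg / r * wint H2 (drift_ratio (b - b_ n) (b_ n)) @[n --> \oo] --> 0.
  rewrite -[X in _ --> X](mulr0 (Cg / r)); apply: cvgM; first exact: cvg_cst.
  exact: wint_drift_ratio_cvg0 b_cvg C_bound.
have /cvgrPdist_le/(_ _ e0) near_z := zeta0.
have /cvgrPdist_le/(_ _ e0) near_k := kappa0.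
have near_B : \forall n \near \oo, b_ n ^+ 2 <= B.
  have c : b_ n * b_ n @[n --> \oo] --> b * b by exact: cvgM.
  have /cvgrPdist_le/(_ _ ltr01) := c; apply: filterS => n.
  by rewrite /B !expr2 ler_norml => /andP[h _]; lra.
have /cvgryPge/(_ (t0 + 1)) near_T := T_oo.
near=> n; apply: le_min_cost => l hl.
have Tn : t0 + 1 <= T_ n by near: n.
have Bn : b_ n ^+ 2 <= B by near: n.
have zn : `|ip (repair mu b) (rotv (s n) g)| <= e.
  by rewrite -normrN -sub0r; near: n.
have kn : Cg / r * wint H2 (drift_ratio (b - b_ n) (b_ n)) <= e.
  apply: le_trans (ler_norm _) _; rewrite -normrN -sub0r; near: n; exact: near_k.
have T1 : 1 <= T_ n by rewrite (le_trans _ Tn)// lerDr.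
have sn0 : 0 <= s n by rewrite subr_ge0 (le_trans _ Tn)// lerDl.
(* Only lists cheaper than [Q b] need an argument, and for these the defect is bounded by [M]. *)
have [hQ|hQ] := leP (Q b) (J (b_ n) (T_ n) l).
  apply: le_trans _ hQ; rewrite lerBlDr lerDl mulr_ge0 ?(ltW e0)//.
  have k0 : 0 <= 2 * `|mu^-1| / c2 by rewrite divr_ge0 ?(ltW c20)// mulr_ge0.
  by have := normr_ge0 Ka; lra.
have TE : t0 + s n = T_ n by rewrite addrC subrK.
have hsh := horizon_shift sn0 t00 hl0; rewrite TE in hsh.
have dsh : defect mu (shift_list (s n) l0) = 0 by rewrite defect_shift.
have Tn0 : 0 <= T_ n by exact: le_trans T1.
have Mn := hM _ _ _ Bn Tn0 hl (ltW hQ).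
have csh : J b (T_ n) (shift_list (s n) l0) <= Q b + e ^+ 2.
  by rewrite -TE cost_shift// ltW.
have := perturbed_lower T1 hl Mn (C_bound n) (ltW hQ) hsh dsh e0 csh.
have gE j k x : 0 < x -> kernels mu b (T_ n) (shift_list (s n) l0) j k x = rotv (s n) g j k x.
  by move=> x0; rewrite -TE kernels_shift.
rewrite (eq_ip H1 H2 (fun j k x _ => erefl) gE).
rewrite (eq_ninner H2 (fun k x _ => erefl) (gE false)).
set X := ninner H2 _ _ => hfin.
have hX : `|X| <= c2^-1 * e.
  have dG : decays2 (rotv (s n) g false) by exact: decays2_rot.
  have hG x : 0 < x -> nsqr (rotv (s n) g false) x <= Cg * m x.
    move=> x0; rewrite /nsqr /rotv -!expr2 rot_sqr.
    by apply: le_trans (hCg x x0); rewrite /nsqr -!expr2 ler_norm.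
  have := drift_cross_le hH2 mu0 Tn0 hl (C_bound n) dG r0 hG.
  have := noise_cost_le (ltW hQ); set wn := wint H2 (nsqr _) => hw.
  rewrite -/X => hX; rewrite mulrC ler_pdivlMr// -(ler_pM2l (ltr0n R 2 : 0 < 2)).
  have : r * (3 * (1 + defect mu l ^+ 2) * wint H2 m + 3 * mu ^+ 2 * wn) <= e.
    apply: (@le_trans _ _ (r * A)).
      rewrite ler_wpM2l ?(ltW r0)// lerD//; first by rewrite ler_wpM2r// ler_wpM2l// lerD2l.
      by apply: ler_wpM2l => //; apply: mulr_ge0 => //; exact: sqr_ge0.
    by rewrite /r mulrAC ler_pdivrMr// ler_wpM2l ?(ltW e0)// lerDl.
  by move: hX kn; lra.
apply: le_trans hfin.
have h1 : e ^+ 2 <= e by rewrite expr2 ler_piMl// ltW.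
have h2 : 2 * (M + 1) * `|ip (repair mu b) (rotv (s n) g)| <= 2 * (M + 1) * e.
  by rewrite ler_wpM2l// mulr_ge0// addr_ge0.
have h3 : 2 * `|mu^-1| * `|X| <= 2 * `|mu^-1| / c2 * e.
  by rewrite -[leRHS]mulrA ler_wpM2l// mulr_ge0.
have h4 : e * (repaired_bound b C M + Q b + e ^+ 2) <= e * (`|Ka| + Q b + 1).
  by rewrite ler_wpM2l ?(ltW e0)//; have := ler_norm Ka; rewrite /Ka; lra.
by lra.
Unshelve. all: by end_near. Qed.

Lemma min_cost_cvg : min_cost H1 H2 mu (b_ n) 1 (T_ n) @[n --> \oo] --> Q b.
Proof.
have [K hK] := min_cost_lower; apply/cvgrPdist_le => e e0.
pose e' := Num.min 1 (e / (`|K| + 1)).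
have K1 : 0 < `|K| + 1 by rewrite ltr_wpDl.
have e'0 : 0 < e' <= 1 by rewrite lt_min ltr01 divr_gt0//= ge_min lexx.
have eK : e' * K <= e.
  have /andP[p _] := e'0.
  apply: (@le_trans _ _ (e' * (`|K| + 1))).
    by rewrite ler_wpM2l ?(ltW p)// (le_trans (ler_norm K))// lerDl.
  by rewrite -ler_pdivlMr// ge_min lexx orbT.
apply: filterS2 (hK _ e'0) (min_cost_upper hH1 hH2 mu0 T_oo b_cvg e0) => n h1 h2.
by rewrite ler_norml; apply/andP; split; lra.
Qed.

End Sequence.
End LowerBound.

(** * Long time and small noise limits of the minimal cost *)

Section Asymptotics.
Variables (R : realType) (H1 H2 : R) (hH1 : 0 < H1 < 1) (hH2 : 0 < H2 < 1) (mu : R).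
Hypothesis mu0 : mu != 0.
Local Notation nu := (H1 / (1 + H1 - H2)).
Local Notation rate := (2 * (1 + H1 - H2))^-1.

Lemma rate_gt0 : 0 < rate.
Proof. by have [/andP[? ?] /andP[? ?]] := (hH1, hH2); rewrite invr_gt0 mulr_gt0//; lra. Qed.

Lemma cvg_scale_oo (c : R) (u : nat -> R) : 0 < c -> u @ \oo --> +oo ->
  c * u n @[n --> \oo] --> +oo.
Proof.
move=> c0 /cvgryPge h; apply/cvgryPge => A; apply: filterS (h (A / c)) => n.
by rewrite ler_pdivrMr// mulrC.
Qed.

Lemma min_cost_horizon_cvg1 b :
  min_cost H1 H2 mu b 1 T @[T --> +oo] --> limit_cost H1 H2 mu b.
Proof.
apply/cvg_pinftyP => T_ T_oo.
(* With a constant drift the ratio vanishes identically, so [C = 0] serves. *)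
apply: (@min_cost_cvg _ _ _ hH1 hH2 _ mu0 T_ (fun=> b) b 0 T_oo (cvg_cst b)) => n x x0.
by rewrite /drift_ratio subrr expr0n !mul0r.
Qed.

Lemma min_cost_horizon_cvg b eps : 0 < eps ->
  min_cost H1 H2 mu b eps T @[T --> +oo] -->
  eps `^ nu * limit_cost H1 H2 mu (b / eps `^ (- rate)).
Proof.
move=> e0; set c := eps `^ (- rate); have c0 : 0 < c by rewrite powR_gt0.
apply/cvg_pinftyP => T_ T_oo.
have cT : c * T_ n @[n --> \oo] --> +oo := cvg_scale_oo c0 T_oo.
have /cvg_pinftyP/(_ _ cT) h := @min_cost_horizon_cvg1 (b / c).
have /cvgryPge/(_ 0) T_pos := T_oo.
apply: cvg_trans (cvgM (cvg_cst (eps `^ nu)) h).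
apply: near_eq_cvg; apply: filterS T_pos => n T0 /=.
rewrite -(min_cost_small_noise hH1 hH2 mu b e0 T0) mulrA -powRD; last by rewrite (gt_eqF e0) implybT.
by rewrite subrr powRr0 mul1r.
Qed.

(** In rescaled units the horizon [T / v] grows while the drift [b v] vanishes, which is why the
    limit theorem lets both vary along a sequence. *)
Lemma min_cost_noise_cvg b T : 0 < T ->
  eps `^ (- nu) * min_cost H1 H2 mu b eps T @[eps --> 0^'+] --> limit_cost H1 H2 mu 0.
Proof.
move=> T0; apply/cvg_at_rightP => u [u0 uc]; have r0 := rate_gt0.
pose v n := u n `^ rate.
have v0 n : 0 < v n by rewrite powR_gt0.
have vV n : u n `^ (- rate) = (v n)^-1 by rewrite powRN.
have uV : (fun n => (u n)^-1) @ \oo --> +oo.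
  apply/gtr0_cvgV0; first by apply: nearW => n; rewrite invr_gt0.
  by rewrite inv_funK.
have v_cvg : v @ \oo --> 0.
  have := powR_neg_cvg0 0 r0 uV; apply: cvg_trans; apply: near_eq_cvg; apply: nearW => n.
  by rewrite subr0 -powR_inv1 ?(ltW (u0 n))// -powRrM mulrNN mul1r.
have vV_oo : (fun n => (v n)^-1) @ \oo --> +oo.
  apply/gtr0_cvgV0; first by apply: nearW => n; rewrite invr_gt0.
  by rewrite inv_funK.
have T_oo : T * (v n)^-1 @[n --> \oo] --> +oo := cvg_scale_oo T0 vV_oo.
have b_cvg : b * v n @[n --> \oo] --> 0.
  by rewrite -[X in _ --> X](mulr0 b); apply: cvgM => //; exact: cvg_cst.
have [B [B0 hB]] : exists B, 0 <= B /\ forall n, (b * v n) ^+ 2 <= B.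
  have /cvg_seq_bounded/pinfty_ex_gt0[M M0 hM] : cvg ((fun n => b * v n) @ \oo).
    by apply/cvg_ex; exists 0.
  exists (M ^+ 2); split=> [|n]; first exact: sqr_ge0.
  by rewrite -(real_normK (num_real (b * v n))) ler_pXn2r ?nnegrE ?(ltW M0)//; exact: hM.
(* With [y = (b v)^2 <= B], the bound follows from [(1 + x)^2 <= 2 (1 + x^2)] and
   [y x^2 <= B x^2]. *)
have C_bound n x : 0 < x ->
    drift_ratio (0 - b * v n) (b * v n) x <= (2 * (1 + B)) * (1 + x) ^- 2.
  move=> x0; rewrite /drift_ratio sub0r sqrrN.
  have := hB n; have := sqr_ge0 (b * v n); move: ((b * v n) ^+ 2) => y y0 yB.
  have x2 : 0 < x ^+ 2 by rewrite exprn_gt0.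
  rewrite ler_pdivrMr ?ltr_pwDl// mulrAC ler_pdivlMr ?exprn_gt0 ?ltr_wpDl//.
  have := sqr_ge0 (1 - x); have : 0 <= (B - y) * x ^+ 2 by rewrite mulr_ge0 ?subr_ge0// ltW.
  by nra.
apply: cvg_trans (min_cost_cvg hH1 hH2 mu0 T_oo b_cvg C_bound).
apply: near_eq_cvg; apply: nearW => n.
by have /= -> := min_cost_small_noise hH1 hH2 mu b (u0 n) (ltW T0); rewrite vV invrK [T * _]mulrC.
Qed.

End Asymptotics.

Theorem theorem2p1 (R : realType) (d : measure_display)
    (Omega : measurableType d) (P : probability Omega R)
    (H1 H2 mu : R) (W V : R -> {RV P >-> R})
    (X : R -> R -> {RV P >-> R}) (Y : R -> R -> R -> {RV P >-> R})
    (hH1 : 0 < H1 < 1) (hH2 : 0 < H2 < 1) (hmu : mu != 0)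
    (hW : fBm H1 W) (hV : fBm H2 V) (hWV : independent_processes W V)
    (hX : forall beta, state_equation beta W (X beta))
    (hY : forall beta eps, 0 < eps ->
       observation_equation mu eps (X beta) V (Y beta eps)) :
  let P_ beta eps T := filtering_error (X beta) (Y beta eps) T in
  let P_infty beta eps := lim (P_ beta eps T @[T --> +oo]) in
  let nu := H1 / (1 + H1 - H2) in
  forall beta : R,
    (forall eps, 0 < eps -> cvg (P_ beta eps T @[T --> +oo])) /\
    (forall T, 0 < T ->
       eps `^ (- nu) * P_ beta eps T @[eps --> 0^'+] --> P_infty 0 1).
Proof.
move=> P_ P_infty nu beta.
have P_E b eps T : 0 < eps -> 0 <= T -> P_ b eps T = min_cost H1 H2 mu b eps T.
  move=> e0 T0.
  exact: (filtering_error_cost hH1 hH2 hW hV hWV hmu e0 (hX b) (hY b eps e0) T0).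
have P_cvg b eps : 0 < eps -> P_ b eps T @[T --> +oo] -->
    eps `^ nu * limit_cost H1 H2 mu (b / eps `^ (- (2 * (1 + H1 - H2))^-1)).
  move=> e0; apply: cvg_trans (@min_cost_horizon_cvg _ _ _ hH1 hH2 _ hmu b eps e0).
  apply: near_eq_cvg; have : \forall T \near +oo, 0 <= T :> R by exact: nbhs_pinfty_ge.
  by apply: filterS => T T0; rewrite P_E.
split=> [eps e0|T T0]; first by apply/cvg_ex; eexists; exact: P_cvg.
(* At unit noise and zero drift the rescaling is trivial, so the long time limit is [limit_cost] at
   drift zero, the limit found for small noise. *)
rewrite /P_infty (cvg_lim _ (P_cvg 0 1 ltr01))// powR1 !mul1r mul0r.
apply: cvg_trans (@min_cost_noise_cvg _ _ _ hH1 hH2 _ hmu beta T T0).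
apply: near_eq_cvg; have : \forall eps \near 0^'+, 0 < eps :> R by exact: nbhs_right_gt.
by apply: filterS => eps e0; rewrite P_E// ltW.
Qed.
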